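(* Let $n\ge1$ and $w\in S_n$. The map $\mathrm{flip}$ is a bijection from the set of chains from $w$ to $w_0$ compatible with $(n-1,\dots,1)$ to the set of chains from $w$ to $w_0$ compatible with $(1,\dots,n-1)$, and it is weight-reversing: $\mathrm{wt}(\mathrm{flip}(C))$ is the reverse of $\mathrm{wt}(C)$. Consequently, $\mathrm{chain}_{\mathrm{PD}}^{-1}\circ\mathrm{flip}\circ\mathrm{chain}_{\mathrm{BPD}}$ is a bijection from $\mathrm{BPD}(w)$ to $\mathrm{PD}(w)$.
   Context: Permutations in one-line notation; $w_0=[n,\dots,1]$; $t_{i,j}$, $wt_{i,j}$ (swap positions $i<j$), $\ell$ = number of inversions. $u\lessdot w$ iff $w=ut_{i,j}$, $i<j$, $\ell(w)=\ell(u)+1$; for $k\in[n-1]$, $u\lessdot_k w$ iff moreover $i\le k<j$. A saturated $k$-chain is $v_1\lessdot_k\cdots\lessdot_k v_d$ ($d\ge1$), of length $d-1$; it is increasing if the smaller of the two values exchanged at each step strictly increases along the chain. $(w_1,\dots,w_d)$ is compatible with $(k_1,\dots,k_{d-1})$ if there is an increasing $k_s$-chain from $w_s$ to $w_{s+1}$ for each $s$ (such an increasing chain is unique when it exists); its weight is $(\ell(w_2)-\ell(w_1),\dots,\ell(w_d)-\ell(w_{d-1}))$. A permutation $\gamma\in S_{n-1}$ is identified with the sequence $(\gamma(1),\dots,\gamma(n-1))$. Lenart's growth diagram: given $k_1,k_2\in[n-1]$, a saturated $k_1$-chain $C_1$ from $u$ to $v$ and a saturated $k_2$-chain $C_2$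 from $v$ to $w$, write the concatenation with each step labelled $k_1$ or $k_2$. A local move applies to a segment $a\xrightarrow{k_1}b\xrightarrow{k_2}c$ (so $a\lessdot_{k_1}b\lessdot_{k_2}c$): there is a unique $b'\ne b$ with $a\lessdot b'\lessdot c$; if $a\lessdot_{k_2}b'\lessdot_{k_1}c$ the segment is replaced by $a\xrightarrow{k_2}b'\xrightarrow{k_1}c$, and otherwise (in which case $a\lessdot_{k_2}b\lessdot_{k_1}c$) by $a\xrightarrow{k_2}b\xrightarrow{k_1}c$. Apply local moves until all $k_2$-labels precede all $k_1$-labels; the output is the resulting saturated $k_2$-chain from $u$ to some $v'$ followed by the saturated $k_1$-chain from $v'$ to $w$ (independent of the order of moves). For $(u,v,w)$ compatible with $(k_1,k_2)$, let $\mathrm{growth}_{k_1,k_2}(u,v,w)=(u,v',w)$, where $v'$ is obtained by applying this algorithm to the increasing $k_1$-chain from $u$ to $v$ and the increasing $k_2$-chain from $v$ to $w$. The map $\mathrm{flip}$: for $C$ a chain from $w$ to $w_0$ compatible with $(n-1,\dots,1)$, set $C_{[n-1,\dots,1]}=C$. Given $C_\gamma=(w_1,\dots,w_n)$ compatible with $\gamma\ne[1,\dots,n-1]$, let $i$ be smallest with $\gamma(i)\ne i$ and $a$ with $\gamma(a)=i$; let $\mathrm{growth}_{\gamma(a-1),i}(w_{a-1},w_a,w_{a+1})=(w_{a-1},w_a',w_{a+1})$ and set $C_{\gamma t_{a-1,a}}=(w_1,\dots,w_{a-1},w_a',w_{a+1},\dots,w_n)$. Iterating reaches $C_{[1,\dots,n-1]}$,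 defined to be $\mathrm{flip}(C)$. Pipe dreams: a PD is a filling of the staircase grid with cells $(i,j)$, $i+j\le n+1$ (matrix coordinates), where the cell with $i+j=n+1$ holds a single elbow joining its left and top edges, and every other cell is a cross or a bump (two elbows, one joining left and top edges, one joining bottom and right edges); pipes enter at the left edge of each row and exit the top edge, and two pipes cross at most once. It is associated with $w$ where $w(i)$ is the column at which the pipe entering row $i$ exits the top; $\mathrm{PD}(w)$ is the set of these. For $P\in\mathrm{PD}(w)$ and $i\in[n]$, the last $i$ rows of $P$ form a pipe dream $P_i$ of size $i$, associated with some $u_i'\in S_i$; let $u_i=[n,n-1,\dots,i+1,u_i'(1),\dots,u_i'(i)]$ and $\mathrm{chain}_{\mathrm{PD}}(P)=(u_n,\dots,u_1)$; this is a bijection from $\mathrm{PD}(w)$ onto chains from $w$ to $w_0$ compatible with $(1,\dots,n-1)$. Bumpless pipe dreams: tiles are blank, cross, horizontal, vertical, elbow joining right and bottom edges, elbow joining top and left edges. A $k$-row BPD is a filling of a $k\times n$ grid with such tiles, pipe segments matching across edges, no pipe through the left or top boundary, a pipe entering the right edge of each cell of column $n$, and any two pipes crossing at most once; it is associated with the unique $u$ with $u(k+1)>\dots>u(n)$ and $u(i)$ ($i\le k$) the column where the pipe from row $i$ exits the bottom of row $k$. $\mathrm{BPD}(w)$ is the set of $n$-row BPDs associated with $w$. For $D\in\mathrm{BPD}(w)$, $\mathrm{chain}_{\mathrm{BPD}}(D)=(u_{n-1},\dots,u_0)$ where $u_k$ is associated with the first $k$ rows of $D$; this is a bijection from $\mathrm{BPD}(w)$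 onto chains from $w$ to $w_0$ compatible with $(n-1,\dots,1)$. *)

(* Defs.v *)
From mathcomp Require Import all_boot.
Set Implicit Arguments.
Unset Strict Implicit.
Unset Printing Implicit Defensive.

(* A permutation of [n] is a seq w with perm_eq w [1..n];  w(i) = pat w i
   with 1-indexed positions. *)
Definition pat (w : seq nat) (i : nat) : nat := nth 0 w i.-1.

Definition is_perm (n : nat) (w : seq nat) : bool := perm_eq w (iota 1 n).

Definition w0 (n : nat) : seq nat := rev (iota 1 n).

Definition pairs (m : nat) : seq (nat * nat) :=
  [seq p <- [seq (i, j) | i <- iota 1 m, j <- iota 1 m] | p.1 < p.2].

Definition ell (w : seq nat) : nat :=
  count (fun p => pat w p.2 < pat w p.1) (pairs (size w)).

Definition swap (w : seq nat) (i j : nat) : seq nat :=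
  [seq (if p == i then pat w j else if p == j then pat w i else pat w p)
  | p <- iota 1 (size w)].

Definition cover (u v : seq nat) : bool :=
  has (fun p => v == swap u p.1 p.2) (pairs (size u)) && (ell v == (ell u).+1).

Definition kcover (k : nat) (u v : seq nat) : bool :=
  has (fun p => (p.1 <= k < p.2) && (v == swap u p.1 p.2)) (pairs (size u))
  && (ell v == (ell u).+1).

Definition swapmin (u v : seq nat) : nat :=
  foldr minn (size u).+1
    [seq pat u p | p <- iota 1 (size u) & pat u p != pat v p].

Definition is_kchain (k : nat) (c : seq (seq nat)) : bool :=
  if c is v :: cs then path (kcover k) v cs else false.

Definition inc_kchain (k : nat) (c : seq (seq nat)) : bool :=
  is_kchain k c && sorted ltn (pairmap swapmin (head [::] c) (behead c)).

Definition has_inc_chain (k : nat) (u v : seq nat) : Prop :=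
  exists c, [/\ inc_kchain k c, head [::] c = u & last [::] c = v].

Definition compatible (ws : seq (seq nat)) (ks : seq nat) : Prop :=
  size ws = (size ks).+1 /\
  forall s, s < size ks ->
    has_inc_chain (nth 0 ks s) (nth [::] ws s) (nth [::] ws s.+1).

Definition chain_from_to (n : nat) (w : seq nat) (ks : seq nat)
  (C : seq (seq nat)) : Prop :=
  [/\ compatible C ks, head [::] C = w & last [::] C = w0 n].

Definition wt (C : seq (seq nat)) : seq nat :=
  pairmap (fun x y => ell y - ell x) (head [::] C) (behead C).

Definition kcovers (k : nat) (u : seq nat) : seq (seq nat) :=
  [seq v <- [seq swap u p.1 p.2 | p <- pairs (size u)] | kcover k u v].

Definition covers (u : seq nat) : seq (seq nat) :=
  [seq v <- [seq swap u p.1 p.2 | p <- pairs (size u)] | cover u v].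

Fixpoint kchains_from (k m : nat) (u : seq nat) {struct m}
  : seq (seq (seq nat)) :=
  match m with
  | 0 => [:: [:: u]]
  | m'.+1 => flatten [seq [seq u :: c | c <- kchains_from k m' v]
                     | v <- kcovers k u]
  end.

Definition inc_chain (k : nat) (u v : seq nat) : seq (seq nat) :=
  head [:: u] [seq c <- kchains_from k (ell v - ell u) u
              | inc_kchain k c && (last [::] c == v)].

(* A labelled chain: perms ws (length m+1) and step tags ts (length m);
   tag false = label k1, tag true = label k2. *)

(* the unique b' <> b with a <. b' <. c *)
Definition other_mid (a b c : seq nat) : seq nat :=
  head b [seq x <- covers a | (x != b) && cover x c].

(* one local move, applied to the leftmost segment  a -k1-> b -k2-> c *)
Definition grow_step (k1 k2 : nat) (st : seq (seq nat) * seq bool)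
  : seq (seq nat) * seq bool :=
  let: (ws, ts) := st in
  let p := find (fun q => ~~ nth true ts q && nth false ts q.+1)
                (iota 0 (size ts)) in
  if p == size ts then st else
  let a := nth [::] ws p in
  let b := nth [::] ws p.+1 in
  let c := nth [::] ws p.+2 in
  let b' := other_mid a b c in
  let nb := if kcover k2 a b' && kcover k1 b' c then b' else b in
  (set_nth [::] ws p.+1 nb, set_nth false (set_nth false ts p true) p.+1 false).

(* growth_{k1,k2}(u,v,w) = (u,v',w); we return v'.  (For k1 = k2 all
   k2-labels already precede all k1-labels, so v' = v.) *)
Definition growth (k1 k2 : nat) (u v w : seq nat) : seq nat :=
  if k1 == k2 then v else
  let C1 := inc_chain k1 u v in
  let C2 := inc_chain k2 v w in
  let ws := C1 ++ behead C2 in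
  let ts := nseq (size C1).-1 false ++ nseq (size C2).-1 true in
  nth [::] (iter (size ts * size ts) (grow_step k1 k2) (ws, ts)).1
      (size C2).-1.

(* state: (gamma, C_gamma), gamma in one-line notation, C = (w_1,...,w_n) *)
Definition flip_step (st : seq nat * seq (seq nat)) : seq nat * seq (seq nat) :=
  let: (g, C) := st in
  let i := (find (fun q => pat g q != q) (iota 1 (size g))).+1 in
  if size g < i then st else
  let a := (index i g).+1 in
  let wa' := growth (pat g a.-1) i (nth [::] C a.-2) (nth [::] C a.-1)
                    (nth [::] C a) in
  (swap g a.-1 a, set_nth [::] C a.-1 wa').

Definition flip (n : nat) (C : seq (seq nat)) : seq (seq nat) :=
  (iter (n * n) flip_step (rev (iota 1 n.-1), C)).2.

(* A PD of size m: m rows, row r (1-indexed) holds the cells (r,1..m-r),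
   true = cross, false = bump; the cell (r, m+1-r) is the elbow (implicit). *)
Definition pd_shape (m : nat) (P : seq (seq bool)) : Prop :=
  size P = m /\ forall r, r < m -> size (nth [::] P r) = m - r.+1.

Definition pd_cross (P : seq (seq bool)) (r c : nat) : bool :=
  nth false (nth [::] P r.-1) c.-1.

(* trace a pipe: at (r,c), entering from the left (fl) or from the bottom;
   returns visited cells and the column where it exits the top *)
Fixpoint pd_trace (P : seq (seq bool)) (fuel r c : nat) (fl : bool)
  : seq (nat * nat) * nat :=
  match fuel with
  | 0 => ([::], 0)
  | f.+1 =>
    if r == 0 then ([::], c) else
    let res :=
      if pd_cross P r c then
        (if fl then pd_trace P f r c.+1 true else pd_trace P f r.-1 c false)
      else
        (if fl then pd_trace P f r.-1 c false else pd_trace P f r c.+1 true) in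
    ((r, c) :: res.1, res.2)
  end.

Definition pd_pipe (m : nat) (P : seq (seq bool)) (i : nat) :=
  pd_trace P (4 * m).+2 i 1 true.

Definition pd_perm (m : nat) (P : seq (seq bool)) : seq nat :=
  [seq (pd_pipe m P i).2 | i <- iota 1 m].

Definition pd_reduced (m : nat) (P : seq (seq bool)) : Prop :=
  forall i j, 1 <= i -> i < j -> j <= m ->
    count (fun x => (x \in (pd_pipe m P j).1) && pd_cross P x.1 x.2)
          (pd_pipe m P i).1 <= 1.

Definition is_PD (n : nat) (w : seq nat) (P : seq (seq bool)) : Prop :=
  [/\ pd_shape n P, pd_reduced n P & pd_perm n P = w].

Definition chain_PD (n : nat) (P : seq (seq bool)) : seq (seq nat) :=
  [seq rev (iota i.+1 (n - i)) ++ pd_perm i (drop (n - i) P)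
  | i <- rev (iota 1 n)].

Inductive tile := Blank | Cross | Horiz | Vert | ElbowRB | ElbowTL.

Definition e_left (t : tile) : bool :=
  match t with Cross | Horiz | ElbowTL => true | _ => false end.
Definition e_right (t : tile) : bool :=
  match t with Cross | Horiz | ElbowRB => true | _ => false end.
Definition e_top (t : tile) : bool :=
  match t with Cross | Vert | ElbowTL => true | _ => false end.
Definition e_bot (t : tile) : bool :=
  match t with Cross | Vert | ElbowRB => true | _ => false end.

Definition tileat (D : seq (seq tile)) (r c : nat) : tile :=
  nth Blank (nth [::] D r.-1) c.-1.

Definition is_cross (t : tile) : bool := if t is Cross then true else false.

(* trace a pipe in a k-row grid: at (r,c) entering from the right (fr) or
   from the top; returns visited cells and the column where it exits the
   bottom of row k *)
Fixpoint bpd_trace (D : seq (seq tile)) (k fuel r c : nat) (fr : bool)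
  : seq (nat * nat) * nat :=
  match fuel with
  | 0 => ([::], 0)
  | f.+1 =>
    if k < r then ([::], c) else
    let res :=
      match tileat D r c, fr with
      | Horiz, true | Cross, true => bpd_trace D k f r c.-1 true
      | ElbowRB, true => bpd_trace D k f r.+1 c false
      | Vert, false | Cross, false => bpd_trace D k f r.+1 c false
      | ElbowTL, false => bpd_trace D k f r c.-1 true
      | _, _ => ([::], 0)
      end in
    ((r, c) :: res.1, res.2)
  end.

Definition bpd_pipe (n k : nat) (D : seq (seq tile)) (i : nat) :=
  bpd_trace D k (n + k).+2 i n true.

Definition bpd_wf (n k : nat) (D : seq (seq tile)) : Prop :=
  [/\ size D = k,
      (forall r, r < k -> size (nth [::] D r) = n),
      ((forall r c, 1 <= r <= k -> 1 <= c < n ->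
         e_right (tileat D r c) = e_left (tileat D r c.+1)) /\
      (forall r c, 1 <= r < k -> 1 <= c <= n ->
         e_bot (tileat D r c) = e_top (tileat D r.+1 c))) &
      ((forall r, 1 <= r <= k -> ~~ e_left (tileat D r 1)) /\
      (forall c, 1 <= c <= n -> 0 < k -> ~~ e_top (tileat D 1 c)) /\
      (forall r, 1 <= r <= k -> e_right (tileat D r n)))].

Definition bpd_reduced (n k : nat) (D : seq (seq tile)) : Prop :=
  forall i j, 1 <= i -> i < j -> j <= k ->
    count (fun x => (x \in (bpd_pipe n k D j).1) && is_cross (tileat D x.1 x.2))
          (bpd_pipe n k D i).1 <= 1.

Definition is_kBPD (n k : nat) (D : seq (seq tile)) : Prop :=
  bpd_wf n k D /\ bpd_reduced n k D.

Definition bpd_perm (n k : nat) (D : seq (seq tile)) : seq nat :=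
  let ex := [seq (bpd_pipe n k D i).2 | i <- iota 1 k] in
  ex ++ rev [seq c <- iota 1 n | c \notin ex].

Definition is_BPD (n : nat) (w : seq nat) (D : seq (seq tile)) : Prop :=
  is_kBPD n n D /\ bpd_perm n n D = w.

Definition chain_BPD (n : nat) (D : seq (seq tile)) : seq (seq nat) :=
  [seq bpd_perm n k (take k D) | k <- rev (iota 0 n)].

(* Main.v *)
Require Import Defs.
From mathcomp Require Import all_boot zify.
Set Implicit Arguments.
Unset Strict Implicit.
Unset Printing Implicit Defensive.

(* The flip moves the labels 1, 2, ... to the front one after the other, each past
   larger labels k > i.  Growth for such a pair of labels does not preserve
   compatibility in general, but it does for segments u -> v -> w such that the
   first i - 1 entries of u exceed all entries to their right and w is decreasing
   beyond position k: then every i-step moves position i, a local move is an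
   involution (up to exchanging the labels), and three-step segments k, k, i show
   that sliding an i-step through an increasing k-chain keeps it increasing.  In
   particular an i-chain from u is automatically increasing, so growth is a
   bijection exchanging the two lengths.  Both conditions hold throughout the flip,
   since its chains end at w_0.

   For pipe dreams, adding a first row turns the permutation u' of the rest into
   the start of a 1-chain ending at [m+1, u'], with one step per bump, and no two
   pipes cross twice exactly when this works out to a saturated chain.  For bumpless
   pipe dreams, row k is scanned from right to left: the steps of an increasing
   k-chain are read off where a pipe running to the left meets a column of the
   decreasing tail of the permutation above the row. *)

(** * Covers and increasing chains *)

(** Both conditions are obtained by walking back from $w_0$. Decrease beyond position [k] passes
    back through every step with a label at most [k]. Dominance passes back less freely, as a step
    might move a position below [i]. In an increasing chain the smaller value of such a step would
    stay beyond position [k] to the end, which is impossible if position [k] finally holds the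
    largest entry from there on. The labels not yet passed are decreasing, and that provides this
    maximum.

    In the pattern where a move only relabels, the upper positions of the two steps trade places; in
    all others the $k$-step keeps its upper position. As the order of two $k$-labels is read off
    their upper positions, three steps suffice to check that a chain stays increasing.

    Lengths travel with their labels, so the final weight needs no separate computation. The
    bijections from both kinds of pipe dreams to chains are proved here as well, row by row. *)

Ltac clia := clear; lia.

Lemma is_perm_size n u : is_perm n u -> size u = n.
Proof. by move/perm_size; rewrite size_iota. Qed.

Lemma is_perm_mem n u x : is_perm n u -> (x \in u) = (1 <= x <= n).
Proof. by move/perm_mem=> ->; rewrite mem_iota add1n ltnS. Qed.

Lemma perm_inj n u p q : is_perm n u -> 1 <= p <= n -> 1 <= q <= n ->
  pat u p = pat u q -> p = q.
Proof.
move=> Hu Hp Hq E.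
have U : uniq u by rewrite (perm_uniq Hu) iota_uniq.
have S := is_perm_size Hu.
move: E => /eqP; rewrite /pat nth_uniq ?S //; lia.
Qed.

Lemma perm_range n u p : is_perm n u -> 1 <= p <= n -> 1 <= pat u p <= n.
Proof.
move=> Hu Hp; rewrite -(is_perm_mem _ Hu) mem_nth // (is_perm_size Hu); lia.
Qed.

Lemma perm_surj n u x : is_perm n u -> 1 <= x <= n ->
  exists2 p, 1 <= p <= n & pat u p = x.
Proof.
move=> Hu Hx; exists (index x u).+1; rewrite /pat /= -1?(is_perm_size Hu).
  by rewrite index_mem (is_perm_mem _ Hu).
by rewrite nth_index // (is_perm_mem _ Hu).
Qed.

Lemma eq_pat n u v : size u = n -> size v = n ->
  (forall p, 1 <= p <= n -> pat u p = pat v p) -> u = v.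
Proof.
move=> Su Sv H; apply: (@eq_from_nth _ 0); first by rewrite Su.
by move=> i; rewrite Su => Hi; apply: (H i.+1).
Qed.

Lemma size_swap u i j : size (swap u i j) = size u.
Proof. by rewrite size_map size_iota. Qed.

Lemma pat_swap u i j p : 1 <= p <= size u ->
  pat (swap u i j) p =
  if p == i then pat u j else if p == j then pat u i else pat u p.
Proof.
case: p => // p Hp; rewrite {1}/pat /= (nth_map 0) ?size_iota //.
by rewrite nth_iota // add1n.
Qed.

Lemma swap_perm n u i j : is_perm n u -> 1 <= i <= n -> 1 <= j <= n ->
  is_perm n (swap u i j).
Proof.
move=> Hu Hi Hj; have Su := is_perm_size Hu.
have Uu : uniq u by rewrite (perm_uniq Hu) iota_uniq.
have Us : uniq (swap u i j).
  rewrite map_inj_in_uniq ?iota_uniq // => p q.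
  rewrite !mem_iota => Hp Hq.
  have I := @perm_inj n u _ _ Hu.
  case: (p =P i) => ?; case: (p =P j) => ?; case: (q =P i) => ?; case: (q =P j) => ? /= /I; lia.
have sub : {subset swap u i j <= iota 1 n}.
  move=> x /mapP [p]; rewrite mem_iota => Hp ->.
  rewrite mem_iota add1n ltnS.
  case: ifP => _; [|case: ifP => _]; apply: perm_range => //; lia.
have [|_ E] := uniq_min_size Us sub; first by rewrite size_iota size_swap Su.
exact: uniq_perm (iota_uniq _ _) E.
Qed.

(** * The change of length under a transposition *)

Definition covf (f : nat -> nat) a b : Prop :=
  [/\ a < b, f a < f b & forall p, a < p < b -> ~~ (f a < f p < f b)].

Section EllSwap.
Variables (f g : nat -> nat) (a b : nat) (S : seq nat).
Hypotheses (lab : a < b) (ga : g a = f b) (gb : g b = f a).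
Hypothesis (US : uniq S) (aS : a \in S) (bS : b \in S).
Hypothesis go : forall p, p \in S -> p != a -> p != b -> g p = f p.
Hypothesis injf : {in S &, injective f}.
Hypothesis fab : f a < f b.

Let inv (h : nat -> nat) i j := (i < j) && (h j < h i).
Let sym h i j := inv h i j + inv h j i.

(** Inversions are counted on unordered pairs, each taken twice, so that [a] and [b] can be split
    off without regard to where the other positions lie. *)
Lemma sum_pairs h : \sum_(i <- S) \sum_(j <- S) sym h i j =
  2 * \sum_(i <- S) \sum_(j <- S) inv h i j.
Proof.
rewrite mul2n -addnn [X in _ = _ + X]exchange_big /= -big_split /=.
by apply: eq_bigr => i _; rewrite -big_split.
Qed.

Let S' := rem b (rem a S).

Lemma permS : perm_eq S [:: a, b & S'].
Proof.
apply: (perm_trans (perm_to_rem aS)); rewrite perm_cons.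
apply: perm_to_rem; rewrite mem_rem_uniq // inE bS; lia.
Qed.

Lemma memS' p : p \in S' -> [/\ p \in S, p != a & p != b].
Proof.
rewrite mem_rem_uniq ?rem_uniq // inE mem_rem_uniq // inE.
by case/and3P.
Qed.

Lemma sumS h : \sum_(i <- S) \sum_(j <- S) sym h i j =
  2 * sym h a b + 2 * \sum_(p <- S') (sym h p a + sym h p b)
  + \sum_(i <- S') \sum_(j <- S') sym h i j.
Proof.
have symC i j : sym h i j = sym h j i by rewrite /sym addnC.
have sa : sym h a a = 0 by rewrite /sym /inv ltnn.
have sb : sym h b b = 0 by rewrite /sym /inv ltnn.
move: (sym h) symC sa sb => s symC sa sb.
have E i : \sum_(j <- S) s i j = s i a + s i b + \sum_(j <- S') s i j.
  by rewrite (perm_big _ permS) /= !big_cons addnA.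
rewrite (perm_big _ permS) /= !big_cons !E.
under [X in _ + (_ + X)]eq_bigr => i _ do rewrite E.
rewrite !big_split /=.
have F i : \sum_(j <- S') s i j = \sum_(j <- S') s j i.
  by apply: eq_bigr => j _; rewrite symC.
rewrite sa sb (symC b a) (F a) (F b).
set A := \sum_(j <- S') s j a; set B := \sum_(j <- S') s j b.
set T := \sum_(i <- S') \sum_(j <- S') s i j.
by clearbody A B T; lia.
Qed.

(** The pair [a], [b] becomes an inversion and pairs avoiding both are unchanged. A third position
    gains two inversions if it lies strictly between in position and value; otherwise its gains and
    losses cancel. *)
Lemma sum_swap : \sum_(i <- S) \sum_(j <- S) inv g i j =
  (\sum_(i <- S) \sum_(j <- S) inv f i j) + 1 +
  2 * \sum_(p <- S') ((a < p < b) && (f a < f p < f b)).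
Proof.
have E : 2 * (\sum_(i <- S) \sum_(j <- S) inv g i j) = 
   2 * ((\sum_(i <- S) \sum_(j <- S) inv f i j) + 1 +
  2 * \sum_(p <- S') ((a < p < b) && (f a < f p < f b))).
  rewrite -sum_pairs !mulnDr -sum_pairs !sumS.
  have -> : sym g a b = 1 by rewrite /sym /inv ga gb; lia.
  have -> : sym f a b = 0 by rewrite /sym /inv; lia.
  have -> : \sum_(i <- S') \sum_(j <- S') sym g i j =
            \sum_(i <- S') \sum_(j <- S') sym f i j.
    apply: eq_big_seq => i /memS' [iS ia ib].
    apply: eq_big_seq => j /memS' [jS ja jb].
    by rewrite /sym /inv !go.
  have -> : \sum_(p <- S') (sym g p a + sym g p b) =
      \sum_(p <- S') (sym f p a + sym f p b) +
      2 * \sum_(p <- S') ((a < p < b) && (f a < f p < f b)).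
    rewrite big_distrr /= -big_split /=.
    apply: eq_big_seq => p /memS' [pS pa pb].
    rewrite /sym /inv ga gb go //.
    have n1 : f p <> f a by move/injf => E; move: pa; rewrite E ?eqxx.
    have n2 : f p <> f b by move/injf => E; move: pb; rewrite E ?eqxx.
    move: n1 n2 pa pb; clear -fab lab; lia.
  lia.
lia.
Qed.
End EllSwap.

Lemma ellE u : ell u = \sum_(i <- iota 1 (size u)) \sum_(j <- iota 1 (size u))
   ((i < j) && (pat u j < pat u i)).
Proof.
rewrite /ell /pairs -sum1_count big_filter_cond /= big_mkcond /=.
rewrite big_allpairs /=; apply: eq_bigr => i _; apply: eq_bigr => j _.
by case: (_ && _).
Qed.

Lemma ell_swap n u a b : is_perm n u -> 1 <= a -> a < b -> b <= n ->
  pat u a < pat u b ->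
  exists m, ell (swap u a b) = (ell u).+1 + 2 * m /\
   (m = 0 <-> covf (pat u) a b).
Proof.
move=> Hu a1 ab bn fab; have Su := is_perm_size Hu.
set f := pat u; set g := pat (swap u a b).
have H := @sum_swap f g a b (iota 1 n) ab.
have gp p : 1 <= p <= n -> g p = if p == a then f b else if p == b then f a else f p.
  by move=> Hp; rewrite /g pat_swap ?Su.
have {}H := H _ _ (iota_uniq _ _) _ _ _ _ fab.
rewrite !ellE size_swap Su H; first last.
- move=> p q; rewrite !mem_iota => Hp Hq; apply: (perm_inj Hu); lia.
- move=> p; rewrite !mem_iota => Hp pa pb; rewrite gp; last lia.
  by rewrite (negbTE pa) (negbTE pb).
- by rewrite mem_iota; lia.
- by rewrite mem_iota; lia.
- by rewrite gp ?eqxx; [case: eqP => // <-|lia].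
- by rewrite gp ?eqxx //; lia.
eexists; split; first by rewrite addn1.
split=> [/eqP|[_ _ cv]].
- rewrite sum_nat_seq_eq0 => /allP Hz; split=> // p Hp.
  apply/negP => Hv; have := Hz p.
  rewrite mem_rem_uniq ?rem_uniq ?iota_uniq // inE mem_rem_uniq ?iota_uniq // inE mem_iota.
  by rewrite /= Hp Hv /=; lia.
- rewrite big1_seq // => p _; case: andP => // -[Hp Hv].
  by have := cv _ Hp; rewrite Hv.
Qed.

Lemma swapK n u a b : size u = n -> 1 <= a <= n -> 1 <= b <= n -> swap (swap u a b) a b = u.
Proof.
move=> Su Ha Hb; apply: (@eq_pat n); rewrite ?size_swap // => p Hp.
rewrite !pat_swap ?size_swap ?Su // !eqxx.
by case: eqP => [->|pa]; [case: eqP => // -> | case: eqP => [->|]].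
Qed.

Lemma swap_cov n u a b : is_perm n u -> 1 <= a -> a < b -> b <= n ->
  ell (swap u a b) = (ell u).+1 <-> covf (pat u) a b.
Proof.
move=> Hu a1 ab bn.
have [lt|gt|E] := ltngtP (pat u a) (pat u b).
- have [m [E M]] := ell_swap Hu a1 ab bn lt; rewrite E -M; lia.
- split=> [E|[_ ? _]]; last lia.
  have Su := is_perm_size Hu.
  have Hs : is_perm n (swap u a b) by apply: swap_perm; lia.
  have [|m [E' _]] := ell_swap Hs a1 ab bn.
    rewrite !pat_swap ?Su ?eqxx; try lia.
    by case: eqP => // E2; lia.
  by move: E'; rewrite (@swapK n) //; lia.
- have := @perm_inj n u a b Hu; lia.
Qed.

Lemma mem_pairs m p : (p \in pairs m) = [&& 1 <= p.1, p.1 < p.2 & p.2 <= m].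
Proof.
case: p => i j; rewrite mem_filter /=.
have -> : ((i, j) \in [seq (i0, j0) | i0 <- iota 1 m, j0 <- iota 1 m]) =
          (i \in iota 1 m) && (j \in iota 1 m).
  apply/allpairsP/andP => [[[x y] /= [? ? [-> ->]]] //|[? ?]].
  by exists (i, j).
rewrite !mem_iota; lia.
Qed.

(** The cover $u\lessdot ut_{a,b}$ spelled out entry by entry instead of through [swap] and [ell],
    so that questions about it reduce to linear arithmetic on positions and values. The last clause
    needs no upper bound on [p] because [pat] is 0 beyond the end on both sides. *)
Definition tstep n (u v : seq nat) a b : Prop :=
  [/\ is_perm n u, is_perm n v,
     [&& 1 <= a, a < b, b <= n & pat u a < pat u b],
     forall p, a < p < b -> ~~ (pat u a < pat u p < pat u b) &
     [/\ pat v a = pat u b, pat v b = pat u a &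
         forall p, 1 <= p -> p != a -> p != b -> pat v p = pat u p]].

Lemma tstep_swap n u v a b : tstep n u v a b -> v = swap u a b.
Proof.
case=> Hu Hv /and4P[a1 ab bn fab] _ [Ea Eb Eo].
apply: (@eq_pat n); rewrite ?size_swap ?(is_perm_size Hu) ?(is_perm_size Hv) // => p Hp.
rewrite pat_swap ?(is_perm_size Hu) //.
case: eqP => [->|/eqP pa] //; case: eqP => [->|/eqP pb] //.
by apply: Eo => //; lia.
Qed.

Lemma tstepI n u a b : is_perm n u -> 1 <= a -> b <= n -> covf (pat u) a b ->
  tstep n u (swap u a b) a b.
Proof.
move=> Hu a1 bn [ab fab cv]; have Su := is_perm_size Hu.
split => //; first by apply: swap_perm => //; lia.
  by rewrite a1 ab bn.
split; last 1 first.
- move=> p p1 pa pb; case: (leqP p n) => pn.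
    by rewrite pat_swap ?Su ?p1 // (negbTE pa) (negbTE pb).
  by rewrite /pat !nth_default ?size_swap ?Su //; lia.
- by rewrite pat_swap ?Su ?eqxx //; lia.
- by rewrite pat_swap ?Su ?eqxx; [case: eqP => // <-|lia].
Qed.

Lemma tstep_cov n u v a b : tstep n u v a b -> covf (pat u) a b.
Proof. by case=> _ _ /and4P[]. Qed.

Lemma tstep_ell n u v a b : tstep n u v a b -> ell v = (ell u).+1.
Proof.
move=> H; rewrite (tstep_swap H); case: (H) => Hu _ /and4P[a1 ab bn _] _ _.
by apply/(swap_cov Hu) => //; apply: tstep_cov H.
Qed.

Lemma coverP n u v : is_perm n u -> Defs.cover u v <-> exists a b, tstep n u v a b.
Proof.
move=> Hu; have Su := is_perm_size Hu; split.
- case/andP => /hasP [[a b]]; rewrite mem_pairs Su /= => /and3P[a1 ab bn] /eqP -> /eqP E.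
  exists a, b; apply: tstepI => //.
  by apply/(swap_cov Hu).
- move=> [a [b H]]; rewrite /Defs.cover (tstep_ell H) eqxx andbT.
  apply/hasP; exists (a, b); last by rewrite /= -(tstep_swap H).
  by rewrite mem_pairs Su /=; case: H => _ _ /and4P[-> -> ->].
Qed.

Lemma kcoverP n k u v : is_perm n u ->
  kcover k u v <-> exists a b, tstep n u v a b /\ a <= k < b.
Proof.
move=> Hu; have Su := is_perm_size Hu; split.
- case/andP => /hasP [[a b]]; rewrite mem_pairs Su /= => /and3P[a1 ab bn].
  case/andP=> K /eqP -> /eqP E.
  exists a, b; split=> //; apply: tstepI => //.
  by apply/(swap_cov Hu).
- move=> [a [b [H K]]]; rewrite /kcover (tstep_ell H) eqxx andbT.
  apply/hasP; exists (a, b); last by rewrite /= -(tstep_swap H) K eqxx.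
  by rewrite mem_pairs Su /=; case: H => _ _ /and4P[-> -> ->].
Qed.

Lemma kcover_perm n k u v : is_perm n u -> kcover k u v -> is_perm n v.
Proof. by move=> Hu /(kcoverP _ _ Hu) [a [b [[]]]]. Qed.

Lemma foldr_minn_mem d s x : x \in s -> all (fun y => x <= y) s -> x <= d -> foldr minn d s = x.
Proof.
elim: s d => // y s IH d; rewrite inE => /orP[/eqP <-|xs] /= /andP[le al] ld.
  have: x <= foldr minn d s.
    by elim: s al {IH} => //= z s IH /andP[? /IH]; lia.
  lia.
by rewrite (IH d) //; lia.
Qed.

Lemma tstep_swapmin n u v a b : tstep n u v a b -> swapmin u v = pat u a.
Proof.
case=> Hu Hv /and4P[a1 ab bn fab] _ [Ea Eb Eo]; have Su := is_perm_size Hu.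
rewrite /swapmin; apply: foldr_minn_mem; last first.
- by have := @perm_range n u a Hu; lia.
- apply/allP => y /mapP [p]; rewrite mem_filter mem_iota => /andP[ne Hp] ->.
  case: (eqVneq p a) => [->|pa] //; case: (eqVneq p b) => [->|pb]; first exact: ltnW.
  case/negP: ne; rewrite Eo //; lia.
- apply/mapP; exists a => //; rewrite mem_filter Ea mem_iota; lia.
Qed.

Definition dec n k (w : seq nat) : Prop :=
  forall p q, k < p -> p < q -> q <= n -> pat w q < pat w p.

(* Growth with i < k preserves compatibility only when [dom n i] holds at the
   start and [dec n k] at the end of the segment; the flip keeps both. *)
Definition dom n i (u : seq nat) : Prop :=
  forall p q, 1 <= p -> p < i -> p < q -> q <= n -> pat u q < pat u p.

(** Only position [b] can matter, and backwards its entry grows. An earlier tail entry exceeds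
    [pat u a], hence also [pat u b], since none lies in between. *)
Lemma dec_back n k u v a b : tstep n u v a b -> a <= k -> dec n k v -> dec n k u.
Proof.
case=> Hu Hv /and4P[a1 ab bn fab] H [Ea Eb Eo] ak D p q kp pq qn.
have Dpq := D p q kp pq qn.
have := Eo p; have := Eo q.
have [pb|pb] := eqVneq p b; have [qb|qb] := eqVneq q b; try lia.
- subst p => ? ?; lia.
- subst q; have := H p; have := @perm_inj n u p b Hu; lia.
Qed.

Lemma dom_ge n i u v a b : tstep n u v a b -> dom n i u -> i <= a.
Proof.
case=> Hu Hv /and4P[a1 ab bn fab] H _ D.
by rewrite leqNgt; apply/negP => ai; have := D a b a1 ai ab bn; lia.
Qed.

Lemma dom_fwd n i u v a b : tstep n u v a b -> dom n i u -> dom n i v.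
Proof.
move=> T D; have ia := dom_ge T D.
case: T => Hu Hv /and4P[a1 ab bn fab] H [Ea Eb Eo] p q p1 pi pq qn.
rewrite (Eo p) //; [|lia..].
have := D p q p1 pi pq qn; have := D p a p1 pi; have := D p b p1 pi; have := Eo q.
have [?|qa] := eqVneq q a; have [?|qb] := eqVneq q b; subst; lia.
Qed.

Lemma dom_back n i u v a b : tstep n u v a b -> i <= a -> dom n i v -> dom n i u.
Proof.
move=> T ia D.
case: T => Hu Hv /and4P[a1 ab bn fab] H [Ea Eb Eo] p q p1 pi pq qn.
have := D p q p1 pi pq qn; have := D p a p1 pi; have := D p b p1 pi; have := Eo q.
rewrite (Eo p) //; [|lia..].
have [?|qa] := eqVneq q a; have [?|qb] := eqVneq q b; subst; lia.
Qed.

(** * Increasing $k$-chains and their uniqueness *)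

Definition incc k u cs := path (kcover k) u cs && sorted ltn (pairmap swapmin u cs).

Lemma has_incP k u v : has_inc_chain k u v <-> exists2 cs, incc k u cs & last u cs = v.
Proof.
split=> [[[|x cs] [//= I <- <-]]|[cs I <-]]; first by exists cs.
by exists (u :: cs).
Qed.

Lemma path_perm n k u cs : is_perm n u -> path (kcover k) u cs -> is_perm n (last u cs).
Proof.
by elim: cs u => //= v cs IH u Hu /andP[/(kcover_perm Hu) /IH].
Qed.

Lemma path_ell n k u cs : is_perm n u -> path (kcover k) u cs ->
  ell (last u cs) = ell u + size cs.
Proof.
elim: cs u => [|v cs IH] u Hu /=; first by rewrite addn0.
case/andP=> K /IH ->; last exact: kcover_perm K.
by case/(kcoverP _ _ Hu): K => a [b [/tstep_ell -> _]]; lia.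
Qed.

Lemma path_dec n k j u cs : is_perm n u -> path (kcover k) u cs -> k <= j ->
  dec n j (last u cs) -> dec n j u.
Proof.
move=> + + kj; elim: cs u => //= v cs IH u Hu /andP[K P] D.
have Dv := IH v (kcover_perm Hu K) P D.
by case/(kcoverP _ _ Hu): K => a [b [T ?]]; apply: (dec_back T) => //; lia.
Qed.

Lemma path_dom n k i u cs : is_perm n u -> path (kcover k) u cs ->
  dom n i u -> dom n i (last u cs).
Proof.
elim: cs u => //= v cs IH u Hu /andP[K P] D.
apply: (IH v (kcover_perm Hu K) P).
by case/(kcoverP _ _ Hu): K => a [b [T ?]]; apply: dom_fwd T D.
Qed.

Lemma incc_cons k u v cs : incc k u (v :: cs) ->
  [/\ kcover k u v, incc k v cs & all (ltn (swapmin u v)) (pairmap swapmin v cs)].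
Proof.
case/andP=> /= /andP[K P] S; split=> //; last exact: order_path_min ltn_trans S.
by rewrite /incc P (path_sorted S).
Qed.

Lemma incc_consI k u v cs : kcover k u v -> incc k v cs ->
  all (ltn (swapmin u v)) (pairmap swapmin v cs) -> incc k u (v :: cs).
Proof.
move=> K /andP[P S] A; rewrite /incc /= K P /=.
by rewrite (path_sortedE ltn_trans) A.
Qed.

(** If every label exceeds [x], so do both values exchanged at each step; smaller entries never
    move. *)
Lemma path_fixlow n k x u cs : is_perm n u -> path (kcover k) u cs ->
  all (ltn x) (pairmap swapmin u cs) ->
  forall p, 1 <= p -> pat u p <= x -> pat (last u cs) p = pat u p.
Proof.
elim: cs u => //= v cs IH u Hu /andP[K P] /andP[L A] p p1 px.
have Hv := kcover_perm Hu K.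
case/(kcoverP _ _ Hu): K => a [b [T ?]].
rewrite (tstep_swapmin T) /= in L.
case: T => _ _ /and4P[a1 ab bn fab] _ [Ea Eb Eo].
have E : pat v p = pat u p.
  by apply: Eo => //; apply/eqP => E; subst p; lia.
by rewrite IH // E.
Qed.

(** If the second chain began with the larger label, it would leave the value [pat u a] at position
    [a] forever, while the first chain puts it at [b] and never touches it again. *)
Lemma incc_label_le n k u v cs a b v' cs' a' b' : is_perm n u ->
  tstep n u v a b -> incc k u (v :: cs) ->
  tstep n u v' a' b' -> incc k u (v' :: cs') ->
  last v cs = last v' cs' -> pat u a' <= pat u a.
Proof.
move=> Hu T I T' I' El.
have [K /andP[P _] A] := incc_cons I; have [K' /andP[P' _] A'] := incc_cons I'.
have Hv := kcover_perm Hu K; have Hv' := kcover_perm Hu K'.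
rewrite (tstep_swapmin T) in A; rewrite (tstep_swapmin T') in A'.
have F := path_fixlow Hv P A; have F' := path_fixlow Hv' P' A'.
have Hw : is_perm n (last v' cs') by apply: path_perm Hv' P'.
have [_ _ /and4P[a1 ab bn fab] _ [Ea Eb Eo]] := T.
have [_ _ /and4P[a1' ab' bn' fab'] _ [Ea' Eb' Eo']] := T'.
rewrite leqNgt; apply/negP => lt.
have E1 : pat v' a = pat u a.
  apply: Eo' => //; apply/eqP => E; subst a; clear -lt fab'; lia.
have E2 : pat (last v' cs') a = pat u a by rewrite F' // E1 // ltnW.
have E3 : pat (last v' cs') b = pat u a.
  by rewrite -El F ?Eb //; clear -a1 ab; lia.
have := @perm_inj n _ a b Hw; rewrite E2 E3; clear -a1 ab bn; lia.
Qed.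

Lemma incc_uniq n k u cs cs' : is_perm n u -> incc k u cs -> incc k u cs' ->
  last u cs = last u cs' -> cs = cs'.
Proof.
elim: cs u cs' => [|v cs IH] u [|v' cs'] // Hu I I' El.
- by move: (path_ell Hu (proj1 (andP I'))); rewrite -El /=; lia.
- by move: (path_ell Hu (proj1 (andP I))); rewrite El /=; lia.
have [K Iv A] := incc_cons I; have [K' Iv' A'] := incc_cons I'.
have Hv := kcover_perm Hu K; have Hv' := kcover_perm Hu K'.
case/(kcoverP _ _ Hu): (K) => a [b [T _]].
case/(kcoverP _ _ Hu): (K') => a' [b' [T' _]].
have le1 := incc_label_le Hu T I T' I' El.
have le2 := incc_label_le Hu T' I' T I (esym El).
rewrite (tstep_swapmin T) in A; rewrite (tstep_swapmin T') in A'.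
have F := path_fixlow Hv (proj1 (andP Iv)) A.
have F' := path_fixlow Hv' (proj1 (andP Iv')) A'.
have Hw : is_perm n (last v' cs') by apply: path_perm Hv' (proj1 (andP Iv')).
have [_ _ /and4P[a1 ab bn fab] _ [Ea Eb Eo]] := T.
have [_ _ /and4P[a1' ab' bn' fab'] _ [Ea' Eb' Eo']] := T'.
have Eaa : a = a' by apply: (perm_inj Hu); clear -a1 ab bn a1' ab' bn' le1 le2; lia.
subst a'.
have Ebb : b = b'.
  apply: (perm_inj Hw); [clear -a1 ab bn; lia|clear -a1 ab' bn'; lia|].
  have -> : pat (last v' cs') b' = pat u a.
    by rewrite F' ?Eb' //; clear -a1 ab'; lia.
  move: El => /= <-; have := F b; rewrite Eb => -> //; clear -a1 ab; lia.
subst b'.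
have Evv : v = v' by rewrite (tstep_swap T) (tstep_swap T').
by subst v'; congr cons; apply: (IH v).
Qed.

Lemma incc_dom n k i u cs : is_perm n u -> incc k u cs -> 1 <= i -> i <= k ->
  dom n i (last u cs) ->
  (forall p, k < p -> p <= n -> pat (last u cs) p < pat (last u cs) k) ->
  dom n i u.
Proof.
move=> + + i1 ik; elim: cs u => //= v cs IH u Hu /incc_cons[K Iv A] D M.
have Hv := kcover_perm Hu K; have Dv := IH v Hv Iv D M.
case/(kcoverP _ _ Hu): (K) => a [b [T kb]].
apply: (dom_back T) => //.
(* A step at [a < i] leaves [pat u a] at [b] for good. The hypothesis on position [k] then forces
   [pat u k] above [pat u a], dominance of [v] puts it below [pat u b], and the step is no cover. *)
rewrite leqNgt; apply/negP => ai.
rewrite (tstep_swapmin T) in A.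
have F := path_fixlow Hv (proj1 (andP Iv)) A.
have [_ _ /and4P[a1 ab bn fab] H [Ea Eb Eo]] := T.
have := M b; have := F b; have := F k; have := Eo k; have := H k.
have := Dv a k; have := @perm_inj n u k a Hu.
have [?|?] := eqVneq k b; first by lia.
have [?|?] := eqVneq k a; lia.
Qed.

Lemma mem_kcovers k u v : (v \in kcovers k u) = kcover k u v.
Proof.
rewrite mem_filter andb_idr // => /andP[/hasP [p Hp /andP[_ /eqP ->]] _].
by apply/mapP; exists p.
Qed.

Lemma mem_kchains k m u c : c \in kchains_from k m u <->
  exists cs, [/\ c = u :: cs, size cs = m & path (kcover k) u cs].
Proof.
elim: m u c => [|m IH] u c /=.
  rewrite inE; split=> [/eqP ->|[[|x cs] [-> //=]]]; first by exists [::].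
split.
- case/flattenP=> s /mapP[v]; rewrite mem_kcovers => K -> /mapP[c' /IH [cs [-> Sc P]] ->].
  by exists (v :: cs); rewrite /= K P Sc.
- case=> -[|v cs] [-> //= [Sc] /andP[K P]]; apply/flattenP.
  exists [seq u :: c | c <- kchains_from k m v].
    by apply/mapP; exists v; rewrite ?mem_kcovers.
  by apply/mapP; exists (v :: cs) => //; apply/IH; exists cs.
Qed.

Lemma inc_chainE n k u cs : is_perm n u -> incc k u cs ->
  inc_chain k u (last u cs) = u :: cs.
Proof.
move=> Hu I; have [P _] := andP I.
rewrite /inc_chain (path_ell Hu P) addKn.
set s := filter _ _.
have M c : c \in s -> c = u :: cs.
  rewrite mem_filter => /andP[/andP[Ic /eqP lc]] /mem_kchains [cs' [Ec _ _]].
  by subst c; congr cons; apply: (incc_uniq Hu Ic I).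
have : u :: cs \in s.
  rewrite mem_filter /= eqxx andbT; apply/andP; split; first exact: I.
  by apply/mem_kchains; exists cs.
by case: s M => //= c s M _; apply: M; rewrite inE eqxx.
Qed.

(** * Local moves *)

(* [spec h] discharges the premises of an instantiated hypothesis, or drops it
   when a premise does not follow from the positions in the current case. *)
Ltac forget_values := repeat match goal with H : context [pat] |- _ => clear H end.
Ltac spec h := lazymatch type of h with
  | ?P -> _ =>
    tryif (let hp := fresh in assert (hp : P) by (forget_values; lia); specialize (h hp); clear hp)
    then spec h else clear h
  | _ => idtac end.
Ltac use H x := let h := fresh "h" in pose proof (H x) as h; spec h.
Ltac use2 H x y := let h := fresh "h" in pose proof (H x y) as h; spec h.
Ltac useall x := match goal with
  | H : forall _ : nat, _ |- _ => use H x; revert H; useall x; intro H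
  | _ => idtac end.

Lemma tstep_inj n u v a b c d : tstep n u v a b -> tstep n u v c d -> a = c /\ b = d.
Proof.
move=> [Hu Hv /and4P[a1 ab bn fab] _ [Ea Eb Eo]] [_ _ /and4P[c1 cd dn fcd] _ [Ec Ed Eo']].
have [?|ac] := eqVneq a c; have [?|bd] := eqVneq b d => //.
- subst c; have [?|bc] := eqVneq b a; first lia.
  by use Eo' b; lia.
- subst d; have [?|bc] := eqVneq a b; first lia.
  by use Eo' a; lia.
have [ad|ad] := eqVneq a d; first by subst d; use Eo' b; lia.
by use Eo' a; lia.
Qed.

(** * Exchanging two consecutive covers *)

Lemma pat_neq n u x y : is_perm n u -> 1 <= x <= n -> 1 <= y <= n -> x != y ->
  pat u x != pat u y.
Proof. by move=> Hu Hx Hy; apply: contra => /eqP /(perm_inj Hu Hx Hy) ->. Qed.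

(** The transpositions commute; what needs proof is that they are still covers. [K1] to [K4] say
    that no entry moved by one step falls strictly between the positions and values of the other in
    the new order: it would already obstruct one of the given covers. *)
Lemma exch_disj n u v w a b c d : tstep n u v a b -> tstep n v w c d ->
  a != c -> a != d -> b != c -> b != d ->
  let m := swap u c d in tstep n u m c d /\ tstep n m w a b.
Proof.
move=> [Hu Hv /and4P[a1 ab bn fab] Ha [Ea Eb Eo]] [_ Hw /and4P[c1 cd dn fcd] Hc [Ec Ed Eo']].
move=> ac ad bc bd m.
have Wc : pat v c = pat u c by apply: Eo; lia.
have Wd : pat v d = pat u d by apply: Eo; lia.
have Wa : pat w a = pat v a by apply: Eo'; lia.
have Wb : pat w b = pat v b by apply: Eo'; lia.
have Nac : pat u a != pat u c by apply: (pat_neq Hu) => //; clear -a1 ab bn c1 cd dn; lia.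
have Nbd : pat u b != pat u d by apply: (pat_neq Hu) => //; clear -a1 ab bn c1 cd dn; lia.
have Nad : pat u a != pat u d by apply: (pat_neq Hu) => //; clear -a1 ab bn c1 cd dn; lia.
have Nbc : pat u b != pat u c by apply: (pat_neq Hu) => //; clear -a1 ab bn c1 cd dn; lia.
have K1 : c < a < d -> ~~ (pat u c < pat u a < pat u d).
  by move=> ?; case: (ltnP b d) => ?; useall a; useall b; useall c; useall d; lia.
have K2 : c < b < d -> ~~ (pat u c < pat u b < pat u d).
  by move=> ?; case: (ltngtP a c) => ?; useall a; useall b; useall c; useall d; lia.
have K3 : a < c < b -> ~~ (pat u a < pat u d < pat u b).
  by clear K1 K2; move=> ?; case: (ltngtP b d) => ?; useall a; useall b; useall c; useall d; lia.
have K4 : a < d < b -> ~~ (pat u a < pat u c < pat u b).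
  by clear K1 K2 K3; move=> ?; case: (ltngtP a c) => ?; useall a; useall b; useall c; useall d; lia.
clear Nac Nbd Nad Nbc.
have T : tstep n u m c d.
  clear K3 K4; apply: tstepI => //; split; [lia..|] => p Hp.
  have [?|?] := eqVneq p a; first by subst p; apply: K1.
  have [?|?] := eqVneq p b; first by subst p; apply: K2.
  by have := Hc p Hp; rewrite Wc Wd Eo //; lia.
split=> //; case: T => _ Hm _ _ [Fc Fd Fo].
have Va : pat m a = pat u a by apply: Fo; forget_values; lia.
have Vb : pat m b = pat u b by apply: Fo; forget_values; lia.
clear K1 K2; split=> //; first lia.
  rewrite Va Vb => p Hp.
  have [?|?] := eqVneq p c; first by subst p; rewrite Fc; apply: K3.
  have [?|?] := eqVneq p d; first by subst p; rewrite Fd; apply: K4.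
  by rewrite Fo //; [apply: Ha | forget_values; lia].
split; [congruence..|] => p p1 pa pb.
have [->|?] := eqVneq p c; first congruence.
have [->|?] := eqVneq p d; first congruence.
by rewrite Eo' ?Eo ?Fo.
Qed.

Section ThreeCycle.
Variables (n : nat) (u v w : seq nat) (p q r : nat).
Hypotheses (pq : p < q) (qr : q < r).

Ltac cases x := have [?|?] := eqVneq x p; [subst x; lia|];
  have [?|?] := eqVneq x q; [subst x; lia|];
  have [?|?] := eqVneq x r; [subst x; lia|];
  have := leqVgt x q => /orP[?|?]; useall x.

Ltac mid :=
  let x := fresh "x" in
  apply: tstepI => //; [lia..|]; split; [lia|lia|] => x Hx;
  cases x; lia.

Ltac fin T :=
  split=> //; case: T => _ Hm _ _ [? ? ?];
  useall p; useall q; useall r;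
  split=> //; [lia | let x := fresh "x" in move=> x Hx; cases x; lia
  | split; [lia..|]; let x := fresh "x" in move=> x x1 xa xb; cases x; congruence].

Ltac exch y :=
  let Hu := fresh in let m := fresh "m" in let T := fresh in
  move=> [Hu ? /and4P[? ? ? ?] ? [? ? ?]] [_ ? /and4P[? ? ? ?] ? [? ? ?]];
  lazymatch goal with |- let _ := _ in _ => idtac | _ => move=> ? end; move=> m;
  useall p; useall q; useall r;
  have ? := fun x => @pat_neq n u x y Hu;
  lazymatch goal with |- tstep _ _ _ ?a ?b /\ _ => have T : tstep n u m a b by mid end;
  fin T.

(** By the relative order of the entries at [p], [q], [r], the cases A, B, C, D are the length-two
    intervals $[123,231]$, $[123,312]$, $[132,321]$, $[213,321]$ of $S_3$. A primed lemma starts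
    from the other middle element. *)
Lemma exch_A : tstep n u v p q -> tstep n v w q r -> pat u q < pat u r ->
  let m := swap u q r in tstep n u m q r /\ tstep n m w p r.
Proof. exch q. Qed.

Lemma exch_A' : tstep n u v q r -> tstep n v w p r ->
  let m := swap u p q in tstep n u m p q /\ tstep n m w q r.
Proof. exch q. Qed.

Lemma exch_B : tstep n u v q r -> tstep n v w p q -> pat u p < pat u q ->
  let m := swap u p q in tstep n u m p q /\ tstep n m w p r.
Proof. exch q. Qed.

Lemma exch_B' : tstep n u v p q -> tstep n v w p r ->
  let m := swap u q r in tstep n u m q r /\ tstep n m w p q.
Proof. exch q. Qed.

Lemma exch_C : tstep n u v p r -> tstep n v w p q ->
  let m := swap u p q in tstep n u m p q /\ tstep n m w q r.
Proof. exch r. Qed.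

Lemma exch_C' : tstep n u v p q -> tstep n v w q r -> pat u r < pat u q ->
  let m := swap u p r in tstep n u m p r /\ tstep n m w p q.
Proof. exch r. Qed.

Lemma exch_D : tstep n u v q r -> tstep n v w p q -> pat u q < pat u p ->
  let m := swap u p r in tstep n u m p r /\ tstep n m w q r.
Proof. exch p. Qed.

Lemma exch_D' : tstep n u v p r -> tstep n v w q r ->
  let m := swap u q r in tstep n u m q r /\ tstep n m w p q.
Proof. exch p. Qed.
End ThreeCycle.

(** This restricts the first step towards [w] to positions where [u] and [w] differ, so that only
    three or four positions are left in the search for middle elements. *)
Lemma two_steps_moved n u y w p q p' q' : tstep n u y p q -> tstep n y w p' q' ->
  pat w p <> pat u p /\ pat w q <> pat u q.
Proof.
move=> [Hu Hy /and4P[p1 pq qn fpq] _ [Ep Eq Eo]] [_ _ /and4P[p1' pq' qn' fpq'] _ [Ep' Eq' Eo']].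
have N := @pat_neq n u _ _ Hu.
split.
- have [?|n1] := eqVneq p p'; first by subst p'; lia.
  have [?|n2] := eqVneq p q'.
    by subst q'; use Eo p'; use2 N p p'; lia.
  by rewrite Eo' // Ep; lia.
- have [?|n1] := eqVneq q p'.
    by subst p'; use Eo q'; use2 N q q'; lia.
  have [?|n2] := eqVneq q q'.
    subst q'; have [?|n3] := eqVneq p p'; first by subst p'; lia.
    by use Eo p'; use2 N q p'; lia.
  by rewrite Eo' // ?Eq; lia.
Qed.

(** * Length-two intervals and their two middle elements *)

Definition diamond u v m w := 
  [/\ v != m, (Defs.cover u v /\ Defs.cover v w), (Defs.cover u m /\ Defs.cover m w) &
   forall y, Defs.cover u y -> Defs.cover y w -> y = v \/ y = m].

Lemma diamond_sym u v m w : diamond u v m w -> diamond u m v w.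
Proof.
case=> ne A B H; split=> //; first by rewrite eq_sym.
by move=> y C D; case: (H y C D); [right|left].
Qed.

Lemma mem_covers u v : (v \in covers u) = Defs.cover u v.
Proof.
rewrite mem_filter andb_idr // => /andP[/hasP [p Hp /eqP ->] _].
by apply/mapP; exists p.
Qed.

Lemma diamond_other u v m w : diamond u v m w -> other_mid u v w = m.
Proof.
case=> ne _ [A B] H; rewrite /other_mid; set s := filter _ _.
have M x : x \in s -> x = m.
  rewrite mem_filter mem_covers => /andP[/andP[xv C] D].
  by case: (H x D C) xv => // ->; rewrite eqxx.
have : m \in s by rewrite mem_filter mem_covers A B eq_sym ne.
by case: s M => //= x s M _; apply: M; rewrite inE eqxx.
Qed.

Definition mv k1 k2 a b c :=
  let b' := other_mid a b c in if kcover k2 a b' && kcover k1 b' c then b' else b.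

Lemma tstep_cover n u v a b : tstep n u v a b -> Defs.cover u v.
Proof. by move=> T; have [Hu _ _ _ _] := T; apply/(coverP _ Hu); exists a, b. Qed.

Lemma tstep_kcover n k u v a b : tstep n u v a b -> kcover k u v = (a <= k < b).
Proof.
move=> T; have [Hu _ _ _ _] := T; apply/idP/idP => [/(kcoverP _ _ Hu)|H].
  by case=> c [d [T' H]]; have [-> ->] := tstep_inj T T'.
by apply/(kcoverP _ _ Hu); exists a, b.
Qed.

Lemma tstep_no n u v a b x : tstep n u v a b -> a < x -> x < b ->
  pat u a < pat u x -> pat u x < pat u b -> False.
Proof. by case=> _ _ _ H _ xt ty A B; have := H x; rewrite xt ty A B => /(_ isT). Qed.

Section Diamonds.
Variables (n : nat) (u v w : seq nat).

Lemma diam_disj a b c d : tstep n u v a b -> tstep n v w c d ->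
  a != c -> a != d -> b != c -> b != d ->
  let m := swap u c d in [/\ tstep n u m c d, tstep n m w a b & diamond u v m w].
Proof.
move=> T1 T2 ac ad bc bd m; have [T3 T4] := exch_disj T1 T2 ac ad bc bd.
have [Hu Hv /and4P[a1 ab bn fab] _ [Ea Eb Eo]] := T1.
have [_ _ /and4P[c1 cd dn fcd] _ [Ec Ed Eo']] := T2.
split=> //; split; last 1 first.
- move=> y /(coverP _ Hu) [p [q T5]].
  have [_ Hy /and4P[p1 pq qn fpq] _ [Ep Eq Eo5]] := T5.
  move=> /(coverP _ Hy) [p' [q' T6]].
  have [_ _ /and4P[p1' pq' qn' fpq'] _ [Ep' Eq' Eo6]] := T6.
  have [M1 M2] := two_steps_moved T5 T6.
  have wa : pat w a = pat u b by rewrite Eo' // Ea.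
  have wb : pat w b = pat u a by rewrite Eo' ?Eb //; clear -a1 ab; lia.
  have wc : pat w c = pat u d.
    by rewrite Ec Eo //; [clear -c1 cd; lia|rewrite eq_sym|rewrite eq_sym].
  have wd : pat w d = pat u c by rewrite Ed Eo // eq_sym.
  have out x : 1 <= x -> pat w x <> pat u x -> x \in [:: a; b; c; d].
    move=> x1 H; rewrite !inE; apply/negPn/negP; rewrite !negb_or => /and4P[xa xb xc xd].
    by apply: H; rewrite Eo' ?Eo.
  have sw x z : x != z -> 1 <= x <= n -> 1 <= z <= n -> pat w x <> pat u z -> 
    pat y x = pat u z -> x = p' \/ x = q'.
    move=> xz Hx Hz M E; case: (eqVneq x p') => [|n1]; first by left.
    by case: (eqVneq x q') => [|n2]; [right|case: M; rewrite Eo6 //; lia].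
  (* If the first step joins one position of each pair, neither position receives its final value.
     The second step would have to exchange the same two positions again, which lowers the
     length. *)
  have cross : pat w p <> pat u q -> pat w q <> pat u p -> False.
    move=> N1 N2.
    have S1 : p = p' \/ p = q' by apply: (sw p q) => //; clear -p1 pq qn; lia.
    have S2 : q = p' \/ q = q' by apply: (sw q p) => //; clear -p1 pq qn; lia.
    have [? ?] : p = p' /\ q = q' by clear -S1 S2 pq pq'; lia.
    by subst p' q'; clear -fpq' Ep Eq fpq; lia.
  have N := @pat_neq n u _ _ Hu.
  have pin := out _ p1 M1; have qin := out q (ltn_trans p1 pq) M2.
  rewrite !inE in pin qin.
  have neq x z : x != z -> 1 <= x <= n -> 1 <= z <= n -> pat u x <> pat u z.
    by move=> A B C; apply/eqP; apply: N.
  have bs x : x \in [:: a; b; c; d] -> 1 <= x <= n.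
    rewrite !inE; clear -a1 ab bn c1 cd dn; lia.
  have [[? ?]|[[? ?]|NO]] : (p = a /\ q = b) \/ ((p = c /\ q = d) \/ 
      ((p \in [:: a; b]) && (q \in [:: c; d]) || (p \in [:: c; d]) && (q \in [:: a; b]))).
    by rewrite !inE; clear -pin qin pq ab cd; lia.
  + by left; subst p q; rewrite (tstep_swap T1) (tstep_swap T5).
  + by right; subst p q; rewrite (tstep_swap T5).
  + exfalso; apply: cross.
      case/orP: NO; rewrite !inE => /andP[] /orP[] /eqP ? /orP[] /eqP ?; subst p q;
        rewrite ?wa ?wb ?wc ?wd; apply: neq; rewrite // 1?eq_sym //; apply: bs; rewrite !inE eqxx ?orbT //.
    case/orP: NO; rewrite !inE => /andP[] /orP[] /eqP ? /orP[] /eqP ?; subst p q;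
        rewrite ?wa ?wb ?wc ?wd; apply: neq; rewrite // 1?eq_sym //; apply: bs; rewrite !inE eqxx ?orbT //.
- apply/eqP => E; move: T3; rewrite -/m -E => T3; have [? _] := tstep_inj T1 T3.
  by subst c; rewrite eqxx in ac.
- by split; [apply: tstep_cover T1 | apply: tstep_cover T2].
- by split; [apply: tstep_cover T3 | apply: tstep_cover T4].
Qed.

Section Three.
Variables p q r : nat.
Hypotheses (pq : p < q) (qr : q < r).

(** The last hypothesis is the only input that depends on the pattern: among the transpositions of
    the three positions, only the two given ones are covers of [u]. *)
Lemma diam3 m a b c d a' b' c' d' :
  tstep n u v a b -> tstep n v w c d -> tstep n u m a' b' -> tstep n m w c' d' ->
  ((a, b) != (a', b')) ->
  {subset [:: a; b; c; d] <= [:: p; q; r]} ->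
  (forall x y z, x \in [:: p; q; r] -> y \in [:: p; q; r] -> tstep n u z x y ->
     (x, y) = (a, b) \/ (x, y) = (a', b')) ->
  diamond u v m w.
Proof.
move=> T1 T2 T3 T4 ne sub third.
have [Hu Hv /and4P[a1 ab bn fab] _ [Ea Eb Eo]] := T1.
have [_ _ /and4P[c1 cd dn fcd] _ [Ec Ed Eo']] := T2.
split; last 1 first.
- move=> y /(coverP _ Hu) [x [z T5]].
  have [_ Hy /and4P[x1 xz zn fxz] _ _] := T5.
  move=> /(coverP _ Hy) [x' [z' T6]].
  have [M1 M2] := two_steps_moved T5 T6.
  have out s : 1 <= s -> pat w s <> pat u s -> s \in [:: p; q; r].
    move=> s1 H; apply/negPn/negP => ns; apply: H.
    have ns' t : t \in [:: a; b; c; d] -> s != t.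
      by move=> /sub ti; apply: contraNneq ns => ->.
    by rewrite Eo' ?Eo //; apply: ns'; rewrite !inE eqxx ?orbT.
  case: (third x z y _ _ T5); [exact: out|by apply: out=> //; lia|..] => -[? ?]; subst x z.
  + by left; rewrite (tstep_swap T1) (tstep_swap T5).
  + by right; rewrite (tstep_swap T5) (tstep_swap T3).
- apply/eqP => E; rewrite -E in T3; have [? ?] := tstep_inj T1 T3.
  by subst a' b'; rewrite eqxx in ne.
- by split; [apply: tstep_cover T1 | apply: tstep_cover T2].
- by split; [apply: tstep_cover T3 | apply: tstep_cover T4].
Qed.

Lemma tstep_gt z x y : tstep n u z x y -> pat u x < pat u y.
Proof. by case=> _ _ /and4P[]. Qed.

Lemma tstep_lt z x y : tstep n u z x y -> x < y.
Proof. by case=> _ _ /and4P[]. Qed.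

Ltac sub3 := let x := fresh in move=> x; rewrite !inE => /or4P[] /eqP ->; rewrite eqxx ?orbT //.
Ltac third := let T := fresh "T" in
  move=> x y z; rewrite !inE => /or3P[] /eqP -> /or3P[] /eqP -> T; have := tstep_lt T; have := tstep_gt T; try lia; auto;
  try (by case: (tstep_no T pq qr); lia).

Lemma diam_A : tstep n u v p q -> tstep n v w q r -> pat u q < pat u r ->
  let m := swap u q r in [/\ tstep n u m q r, tstep n m w p r & diamond u v m w].
Proof.
move=> T1 T2 lt m; have [T3 T4] := exch_A pq qr T1 T2 lt; split=> //.
apply: (diam3 T1 T2 T3 T4); [by rewrite xpair_eqE; lia | sub3 |].
have lt1 := tstep_gt T1; third.
Qed.

Lemma diam_B : tstep n u v q r -> tstep n v w p q -> pat u p < pat u q ->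
  let m := swap u p q in [/\ tstep n u m p q, tstep n m w p r & diamond u v m w].
Proof.
move=> T1 T2 lt m; have [T3 T4] := exch_B pq qr T1 T2 lt; split=> //.
apply: (diam3 T1 T2 T3 T4); [by rewrite xpair_eqE; lia | sub3 |].
have lt1 := tstep_gt T1; third.
Qed.

Lemma diam_C : tstep n u v p r -> tstep n v w p q ->
  let m := swap u p q in [/\ tstep n u m p q, tstep n m w q r & diamond u v m w].
Proof.
move=> T1 T2 m; have [T3 T4] := exch_C pq qr T1 T2; split=> //.
have lt : pat u r < pat u q.
  case: T1 T2 => _ _ /and4P[? ? ? ?] _ [E1 _ Eo] [_ _ /and4P[? ? ? F] _ _].
  by move: F; rewrite E1 Eo //; lia.
apply: (diam3 T1 T2 T3 T4); [by rewrite xpair_eqE; lia | sub3 |].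
third.
Qed.

Lemma diam_D : tstep n u v q r -> tstep n v w p q -> pat u q < pat u p ->
  let m := swap u p r in [/\ tstep n u m p r, tstep n m w q r & diamond u v m w].
Proof.
move=> T1 T2 lt m; have [T3 T4] := exch_D pq qr T1 T2 lt; split=> //.
apply: (diam3 T1 T2 T3 T4); [by rewrite xpair_eqE; lia | sub3 |].
third.
Qed.
End Three.
End Diamonds.

Lemma mv_switch n k i u v m w a b c d : diamond u v m w ->
  kcover k u v -> kcover i v w -> tstep n u m a b -> a <= i < b ->
  tstep n m w c d -> c <= k < d ->
  mv k i u v w = m /\ mv i k u m w = v.
Proof.
move=> D A B T1 H1 T2 H2.
by rewrite /mv (diamond_other D) (diamond_other (diamond_sym D)) A B (tstep_kcover _ T1) H1
  (tstep_kcover _ T2) H2.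
Qed.

Lemma mv_stay k i u v m w : diamond u v m w ->
  ~~ kcover k m w -> ~~ kcover i m w ->
  mv k i u v w = v /\ mv i k u v w = v.
Proof.
move=> D A B; rewrite /mv (diamond_other D).
by rewrite (negbTE A) (negbTE B) !andbF.
Qed.

(** * Local moves between a $k$-step and an $i$-step *)

Section Moves.
Variables (n k i : nat) (u v w : seq nat).
Hypotheses (i1 : 1 <= i) (ik : i < k) (Du : dom n i u) (Dw : dec n k w).

(* The i-step always moves position i, because the first i-1 entries are
   maximal; the tail condition on w leaves a single pattern in which the move
   only relabels the two steps. *)
Lemma mv_fwd a b i0 d : tstep n u v a b -> a <= k < b ->
  tstep n v w i0 d -> i0 <= i < d ->
  exists m a' b' d', [/\ mv k i u v w = m /\ mv i k u m w = v,
     tstep n u m i d' /\ i <= i < d', tstep n m w a' b' /\ a' <= k < b' &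
     b' = b \/ [/\ a = i, d < b, k < d, b' = d & d' = b]].
Proof.
move=> T1 kab T2 id; have ia := dom_ge T1 Du.
have Dv := dom_fwd T1 Du; have ii0 := dom_ge T2 Dv.
have Ei : i0 = i by move: ii0 id; clia.
subst i0.
have Kv : kcover k u v by rewrite (tstep_kcover k T1).
have Kw : kcover i v w by rewrite (tstep_kcover i T2).
have [E|ai] := eqVneq a i.
  subst a; have [lt|gt|E] := ltngtP d b; last first.
  - subst d; case: T1 T2 => _ _ /and4P[_ _ _ F] _ [E1 E2 _] [_ _ /and4P[_ _ _ F'] _ _].
    by move: F'; rewrite E1 E2; clear -F; lia.
  (* With [b < d] the permutation [w] would have a rise beyond position [k]. *)
  - exfalso; have := Dw (p := b) (q := d); case: T1 T2 => _ _ /and4P[B1 B2 B3 F] _ [E1 E2 _] [_ _ /and4P[B4 B5 B6 F'] _ [E3 E4 Eo]].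
    rewrite E4 Eo ?E1 ?E2 //; [clear -kab gt B6 F| clear -B1 B2|clear -B1 B2| clear -gt]; lia.
  have id' : i < d by clear -id; lia.
  have [T3 T4 Dm] := diam_C id' lt T1 T2.
  set m := swap u i d in T3 T4 Dm.
  case: (leqP d k) => dk.
    have kdb : d <= k < b by rewrite dk; clear -kab; lia.
    exists m, d, b, d; split; [|by []|by []|by left].
    exact: (mv_switch Dm Kv Kw T3 id T4 kdb).
  (* For [d > k] the other middle element is followed by a step with both positions beyond [k],
     which neither label admits. The move keeps [v], and the two labels change places. *)
  have [S1 S2] : mv k i u v w = v /\ mv i k u v w = v.
    apply: (mv_stay Dm); rewrite (tstep_kcover _ T4); clear -dk ik; lia.
  exists v, i, d, b; split; [by split| | |by right].
    by split=> //; clear -ik kab; lia.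
  by split=> //; clear -ik dk; lia.
have lt_ia : i < a by clear -ia ai; lia.
have lt_ab : a < b by clear -kab; lia.
have iia : i <= i < a by rewrite leqnn.
have [E|nda] := eqVneq d a.
  subst d; have [lt|gt|E] := ltngtP (pat u i) (pat u a); last first.
  - have [Hu _ /and4P[_ _ bn _] _ _] := T1.
    have := @perm_inj n u i a Hu _ _ E; clear -i1 lt_ia lt_ab bn; lia.
  - have [T3 T4 Dm] := diam_D lt_ia lt_ab T1 T2 gt.
    set m := swap u i b in T3 T4 Dm.
    have iib : i <= i < b by clear -lt_ia lt_ab; lia.
    exists m, a, b, b; split; [|by []|by []|by left].
    exact: (mv_switch Dm Kv Kw T3 iib T4 kab).
  - have [T3 T4 Dm] := diam_B lt_ia lt_ab T1 T2 lt.
    set m := swap u i a in T3 T4 Dm.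
    have kib : i <= k < b by clear -ik kab; lia.
    exists m, i, b, a; split; [|by []|by []|by left].
    exact: (mv_switch Dm Kv Kw T3 iia T4 kib).
have [E|ndb] := eqVneq d b.
  subst d; have [T3 T4] := exch_A' lt_ia lt_ab T1 T2.
  set m := swap u i a in T3 T4.
  have lt : pat m a < pat m b by case: T4 => _ _ /and4P[].
  have lt2 : pat u a < pat u b by case: T1 => _ _ /and4P[].
  have [T5 T6 Dm] := diam_A lt_ia lt_ab T3 T4 lt2.
  rewrite -(tstep_swap T1) in T5 T6 Dm.
  exists m, a, b, a; split; [|by []|by []|by left].
  exact: (mv_switch (diamond_sym Dm) Kv Kw T3 iia T4 kab).
rewrite eq_sym in nda; rewrite eq_sym in ndb.
have nbi : b != i by clear -lt_ia lt_ab; lia.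
have [T3 T4 Dm] := diam_disj T1 T2 ai nda nbi ndb.
set m := swap u i d in T3 T4 Dm.
exists m, a, b, d; split; [|by []|by []|by left].
exact: (mv_switch Dm Kv Kw T3 id T4 kab).
Qed.

(** The case where the $i$-step comes first, needed to invert growth. The cases mirror those of
    [mv_fwd]; again the upper positions trade places in the exceptional one. *)
Lemma mv_bwd a b i0 d : tstep n u v i0 d -> i0 <= i < d ->
  tstep n v w a b -> a <= k < b ->
  exists m a' b' d', [/\ mv i k u v w = m /\ mv k i u m w = v,
     tstep n u m a' b' /\ a' <= k < b', tstep n m w i d' /\ i <= i < d' &
     b' = b \/ [/\ a = i, b < d, b' = d & d' = b]].
Proof.
move=> T1 id T2 kab; have ii0 := dom_ge T1 Du.
have Dv := dom_fwd T1 Du; have ia := dom_ge T2 Dv.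
have Ei : i0 = i by move: ii0 id; clia.
subst i0.
have Kv : kcover i u v by rewrite (tstep_kcover i T1).
have Kw : kcover k v w by rewrite (tstep_kcover k T2).
have id' : i < d by clear -id; lia.
have lt_ab : a < b by clear -kab; lia.
have [E|ai] := eqVneq a i.
  subst a; have [lt|gt|E] := ltngtP b d; last first.
  - subst d; case: T1 T2 => _ _ /and4P[_ _ _ F] _ [E1 E2 _] [_ _ /and4P[_ _ _ F'] _ _].
    by move: F'; rewrite E1 E2; clear -F; lia.
  - have [T3 T4] := exch_B' id' gt T1 T2.
    set m := swap u d b in T3 T4.
    have lt1 : pat u i < pat u d by case: T1 => _ _ /and4P[].
    have [T5 T6 Dm] := diam_B id' gt T3 T4 lt1.
    rewrite -(tstep_swap T1) in T5 T6 Dm.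
    case: (leqP d k) => dk; last first.
      exfalso; have := Dw (p := d) (q := b); case: T1 T2 => _ _ /and4P[B1 B2 B3 F] _ [E1 E2 _] [_ _ /and4P[B4 B5 B6 F'] _ [E3 E4 Eo]].
      rewrite E4 Eo ?E1 ?E2 //; [clear -dk gt B6 F| clear -B1 B2|clear -B1 B2| clear -gt]; lia.
    have kdb : d <= k < b by clear -dk kab; lia.
    exists m, d, b, d; split; [|by []|by []|by left].
    exact: (mv_switch (diamond_sym Dm) Kv Kw T3 kdb T4 id).
  - have [T3 T4 Dm] := diam_C lt_ab lt T1 T2.
    have [S1 S2] : mv i k u v w = v /\ mv k i u v w = v.
      apply: (mv_stay Dm); rewrite (tstep_kcover _ T4); clear -kab ik; lia.
    exists v, i, d, b; split; [by split| | |by right].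
      by split=> //; clear -ik kab lt; lia.
    by rewrite leqnn.
have lt_ia : i < a by clear -ia ai; lia.
have iia : i <= i < a by rewrite leqnn.
have [E|nda] := eqVneq d a.
  subst d; have [lt|gt|E] := ltngtP (pat u a) (pat u b); last first.
  - have [Hu _ _ _ _] := T1; have [_ _ /and4P[_ _ bn _] _ _] := T2.
    have := @perm_inj n u a b Hu _ _ E; clear -i1 lt_ia lt_ab bn; lia.
  - have [T3 T4] := exch_C' lt_ia lt_ab T1 T2 gt.
    have [T5 T6 Dm] := diam_C lt_ia lt_ab T3 T4.
    set m := swap u i b in T3 T4 Dm.
    rewrite -(tstep_swap T1) in T5 T6 Dm.
    have kib : i <= k < b by clear -ik kab; lia.
    exists m, i, b, a; split; [|by []|by []|by left].
    exact: (mv_switch (diamond_sym Dm) Kv Kw T3 kib T4 iia).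
  - have [T3 T4 Dm] := diam_A lt_ia lt_ab T1 T2 lt.
    set m := swap u a b in T3 T4 Dm.
    have iib : i <= i < b by clear -lt_ia lt_ab; lia.
    exists m, a, b, b; split; [|by []|by []|by left].
    exact: (mv_switch Dm Kv Kw T3 kab T4 iib).
have [E|ndb] := eqVneq d b.
  subst d; have [T3 T4] := exch_D' lt_ia lt_ab T1 T2.
  set m := swap u a b in T3 T4.
  have gt : pat u a < pat u i.
    have F : pat m i < pat m a by case: T4 => _ _ /and4P[].
    have F1 : pat u i < pat u b by case: T1 => _ _ /and4P[].
    case: T2 => _ _ /and4P[_ _ _ F2] _ _.
    case: T1 F2 => _ _ _ _ [_ -> Eo]; rewrite Eo //; clear -lt_ia lt_ab; lia.
  have [T5 T6 Dm] := diam_D lt_ia lt_ab T3 T4 gt.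
  rewrite -(tstep_swap T1) in T5 T6 Dm.
  exists m, a, b, a; split; [|by []|by []|by left].
  exact: (mv_switch (diamond_sym Dm) Kv Kw T3 kab T4 iia).
have nib : i != b by clear -lt_ia lt_ab; lia.
rewrite eq_sym in ai.
have [T3 T4 Dm] := diam_disj T1 T2 ai nib nda ndb.
set m := swap u a b in T3 T4 Dm.
exists m, a, b, d; split; [|by []|by []|by left].
exact: (mv_switch Dm Kv Kw T3 kab T4 id).
Qed.
End Moves.

Lemma tstep_vals n u v a b : tstep n u v a b ->
  [/\ 1 <= a, a < b <= n, pat u a < pat u b, pat v a = pat u b & pat v b = pat u a].
Proof. by case=> _ _ /and4P[a1 ab bn F] _ [E1 E2 _]; split=> //; rewrite ab. Qed.

Lemma tstep_out n u v a b x : tstep n u v a b -> 1 <= x -> x != a -> x != b -> pat v x = pat u x.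
Proof. by case=> _ _ _ _ [_ _ Eo]; apply: Eo. Qed.

(** A step leaves its label at its upper position, and the entries of [w] beyond [k] decrease; so
    the labels increase exactly when the upper positions decrease. *)
Lemma swapmin_lt n k u v w a b a' b' : tstep n u v a b -> a <= k < b ->
  tstep n v w a' b' -> a' <= k < b' -> dec n k w ->
  (swapmin u v < swapmin v w) = (b' < b).
Proof.
move=> T1 k1 T2 k2 D; rewrite (tstep_swapmin T1) (tstep_swapmin T2).
have [a1 ab F E1 E2] := tstep_vals T1; have [a1' ab' F' E1' E2'] := tstep_vals T2.
have [E|ne] := eqVneq b b'; first by subst b'; move: F' F E2; clia.
have E3 : pat w b = pat v b by apply: (tstep_out T2); move: k1 k2 ne; clia.
have := D b b'; have := D b' b.
move: k1 k2 ne ab ab' E3 E2 E2'; clia.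
Qed.

(** * Order of two $k$-labels when an $i$-step passes them *)

Section ThreeSteps.
Variables (n k i : nat) (u v w z : seq nat).
Hypotheses (i1 : 1 <= i) (ik : i < k) (Du : dom n i u) (Dz : dec n k z).

Lemma three_fwd a1 b1 a2 b2 i0 d :
  tstep n u v a1 b1 -> a1 <= k < b1 -> tstep n v w a2 b2 -> a2 <= k < b2 ->
  tstep n w z i0 d -> i0 <= i < d -> swapmin u v < swapmin v w ->
  let m2 := mv k i v w z in let m1 := mv k i u v m2 in
  swapmin m1 m2 < swapmin m2 z.
Proof.
move=> T1 k1 T2 k2 T3 id.
have Dv := dom_fwd T1 Du; have Dw := dom_fwd T2 Dv.
have ii := dom_ge T3 Dw.
have Dcw : dec n k w by apply: (dec_back T3) Dz; move: id ik; clia.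
rewrite (swapmin_lt T1 k1 T2 k2 Dcw) => lt.
cbv zeta.
have [m2 [a2' [b2' [d2 [[-> _] [U1 id2] [U2 k2'] tr2]]]]] := mv_fwd i1 ik Dv Dz T2 k2 T3 id.
have ak2' : a2' <= k by case/andP: k2'.
have Dm2 : dec n k m2 by apply: (dec_back U2 ak2') Dz.
have [m1 [a1' [b1' [d1 [[-> _] [U3 id1] [U4 k1'] tr1]]]]] := mv_fwd i1 ik Du Dm2 T1 k1 U1 id2.
rewrite (swapmin_lt U4 k1' U2 k2' Dz).
case: tr1 => [->|[E1 dlt kd -> Ed1]].
  by case: tr2 => [->|[]] //; move: lt; clia.
case: tr2 => [E2|[E2 dlt' kd' -> -> //]].
(* The remaining case: the first $k$-step was only relabelled, the second kept its upper position.
   If the order failed, the entry of [u] at [a2'] would lie between those at [i] and [b1], and the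
   first step would be no cover. *)
subst a1 b2'; rewrite ltnNge; apply/negP => le.
have Dm1 := dom_fwd U3 Du; have Dm2' := dom_fwd U4 Dm1; have ia2 := dom_ge U2 Dm2'.
have [p1 ab1 F1 Ea1 Eb1] := tstep_vals T1.
have [_ ab2 F2 Ea2 Eb2] := tstep_vals U1.
have [p3 ab3 F3 Ea3 Eb3] := tstep_vals U2.
have X1 : pat m2 b1 = pat v b1 by apply: (tstep_out U1); move: dlt ab1; clia.
have X2 : pat z b1 = pat m2 b1 by apply: (tstep_out U2); move: lt k1 k2'; clia.
have Y1 : pat z b1 < pat z b2 by apply: Dz => //; move: k1 k2' k2 ab1; clia.
have Y2 : pat m2 a2' < pat v i.
  have [E|ne] := eqVneq d2 b2; first by subst d2; move: F3 Eb2; clia.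
  have X3 : pat z d2 = pat m2 d2.
    by apply: (tstep_out U2); move: id2 kd ak2' ne; clia.
  have : pat z b2 < pat z d2 by apply: Dz => //; move: ab3 le ne; clia.
  by move: X3 Eb2 Eb3; clia.
have [E|nai] := eqVneq a2' i; first by subst a2'; move: Y2 Ea2 F2; clia.
have X4 : pat m2 a2' = pat v a2'.
  by apply: (tstep_out U1) => //; move: ak2' kd; clia.
have X5 : pat v a2' = pat u a2'.
  by apply: (tstep_out T1) => //; move: ak2' k1; clia.
apply: (tstep_no (x := a2') T1); move: ia2 nai ak2' k1 X4 X5 Y1 Y2 X1 X2 Eb1 Eb3 Ea1; clia.
Qed.

Lemma three_bwd i0 d a1 b1 a2 b2 :
  tstep n u v i0 d -> i0 <= i < d -> tstep n v w a1 b1 -> a1 <= k < b1 ->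
  tstep n w z a2 b2 -> a2 <= k < b2 -> swapmin v w < swapmin w z ->
  let m1 := mv i k u v w in let m2 := mv i k m1 w z in
  swapmin u m1 < swapmin m1 m2.
Proof.
move=> T1 id T2 k1 T3 k2.
have Dv := dom_fwd T1 Du; have Dw := dom_fwd T2 Dv.
rewrite (swapmin_lt T2 k1 T3 k2 Dz) => lt.
have ak2 : a2 <= k by case/andP: k2.
have Dcw : dec n k w by apply: (dec_back T3 ak2) Dz.
cbv zeta.
have [m1 [a1' [b1' [d1 [[-> _] [U1 k1'] [U2 id1] tr1]]]]] := mv_bwd i1 ik Du Dcw T1 id T2 k1.
have Dm1 := dom_fwd U1 Du.
have [m2 [a2' [b2' [d2 [[-> _] [U3 k2'] [U4 id2] tr2]]]]] := mv_bwd i1 ik Dm1 Dz U2 id1 T3 k2.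
have Dcm2 : dec n k m2 by apply: (dec_back U4) Dz; exact: ltnW.
rewrite (swapmin_lt U1 k1' U3 k2' Dcm2).
case: tr2 => [->|[E2 dlt -> Ed2]].
  by case: tr1 => [->|[]] //; move: lt; clia.
case: tr1 => [E1|[E1 dlt' -> -> //]].
(* Only the second move was a relabelling here. If the order failed, the entry at [b1] would
   obstruct the step [U2] when [b1] differs from [d1]; otherwise [b2] obstructs [U1] or [a1']
   obstructs [T3]. *)
subst a2 b1'; rewrite ltnNge; apply/negP => le.
have ia1 := dom_ge U1 Du.
have [p1 ab1 F1 Ea1 Eb1] := tstep_vals U1.
have [_ ab2 F2 Ea2 Eb2] := tstep_vals U2.
have [_ ab3 F3 Ea3 Eb3] := tstep_vals T3.
have X1 : pat z d1 = pat w d1 by apply: (tstep_out T3); move: dlt id1; clia.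
have X2 : pat w b2 = pat m1 b2.
  by apply: (tstep_out U2); move: dlt ab3; clia.
have [E|ne] := eqVneq b1 d1; last first.
  have X3 : pat z b1 = pat w b1 by apply: (tstep_out T3); move: lt ab3; clia.
  have X4 : pat w b1 = pat m1 b1 by apply: (tstep_out U2) => //; move: lt ab3; clia.
  have Y1 : pat z d1 < pat z b1.
    by apply: Dz; move: k1 le ne ab2; clia.
  have Y2 : pat z b1 < pat z b2.
    by apply: Dz => //; move: k2 ab1; clia.
  apply: (tstep_no (x := b1) U2); move: lt le ne ab3 X1 X3 X4 Y1 Y2 Eb2 Eb3 Ea2; clia.
subst d1.
have [E|nai] := eqVneq a1' i; first by subst a1'; move: F1 F2 Ea1 Eb1; clia.
have X5 : pat w a1' = pat m1 a1'.
  by apply: (tstep_out U2) => //; move: k1'; clia.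
have X6 : pat m1 b2 = pat u b2.
  by apply: (tstep_out U1); move: k1' k2 lt; clia.
have [_ Hm1 _ _ _] := U1.
have X7 : pat m1 b2 != pat m1 a1'.
  by apply: (pat_neq Hm1); move: p1 ab1 ab3 k1' k2; clia.
have [ltC|geC] := ltnP (pat u b2) (pat u b1).
  by apply: (tstep_no (x := b2) U1); move: k1' k2 lt F3 ltC Ea2 Eb1 X2 X6; clia.
apply: (tstep_no (x := a1') T3); move: ia1 nai k1' k2 X2 X5 X6 X7 geC Ea1 Eb1 Ea2 F1; clia.
Qed.
End ThreeSteps.

(** * Growth *)

(* Moves the i-step [last u cs -> z] to the front of the k-chain [u :: cs]. *)
Fixpoint slide k i u cs z :=
  if cs is v :: cs1 then
    let r := slide k i v cs1 z in (mv k i u v r.1, r.1 :: r.2)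
  else (z, [::]).

(** The $i$-step from [u] to [x] is pushed back behind the chain. Only the new $k$-chain is
    returned, because the $i$-step has to end where [x :: cs] ends. *)
Fixpoint unslide k i u x cs :=
  if cs is y :: cs1 then
    let m := mv i k u x y in m :: unslide k i m y cs1
  else [::].

(** The $i$-steps are slid to the front one at a time, in their order. Always moving the leftmost
    admissible segment performs the moves in exactly this order. *)
Fixpoint grow k i u cs ds :=
  if ds is d :: ds1 then
    let r := slide k i u cs d in
    let s := grow k i r.1 r.2 ds1 in (r.1 :: s.1, s.2)
  else ([::], cs).

Fixpoint ungrow k i u es cs :=
  if es is e :: es1 then
    let r := ungrow k i e es1 cs in
    (unslide k i u e r.1, last e r.1 :: r.2)
  else (cs, [::]).

Lemma size_slide k i u cs z : size (slide k i u cs z).2 = size cs.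
Proof. by elim: cs u => //= v cs IH u; rewrite IH. Qed.

Lemma size_grow k i u cs ds :
  size (grow k i u cs ds).1 = size ds /\ size (grow k i u cs ds).2 = size cs.
Proof.
elim: ds u cs => //= d ds IH u cs.
by case: (IH (slide k i u cs d).1 (slide k i u cs d).2) => -> ->; rewrite size_slide.
Qed.

Section Slide.
Variables (n k i : nat).
Hypotheses (i1 : 1 <= i) (ik : i < k).

Lemma slide_spec u cs z : is_perm n u -> dom n i u -> dec n k z ->
  path (kcover k) u cs -> kcover i (last u cs) z ->
  let r := slide k i u cs z in
  [/\ kcover i u r.1, path (kcover k) r.1 r.2, last r.1 r.2 = z &
      unslide k i u r.1 r.2 = cs].
Proof.
move=> + + Dz; elim: cs u => [|v cs IH] u Hu Du //=.
case/andP=> K P Kz; have Hv := kcover_perm Hu K.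
have [a [b [T kab]]] := (proj1 (kcoverP _ _ Hu) K).
have Dv := dom_fwd T Du.
have [] := IH v Hv Dv P Kz.
case: (slide k i v cs z) => [m cs'] /= Km Pm Lm Um.
have Hm := kcover_perm Hv Km.
have [i0 [d [T2 id]]] := (proj1 (kcoverP _ _ Hv) Km).
have Dm : dec n k m by apply: (path_dec Hm Pm) => //; rewrite Lm.
have [x [a' [b' [d' [[Ex Ev] [U1 id'] [U2 kab'] _]]]]] := mv_fwd i1 ik Du Dm T kab T2 id.
have Kx : kcover i u x by rewrite (tstep_kcover i U1).
have Kxm : kcover k x m by rewrite (tstep_kcover k U2).
by rewrite Ex; split=> //; rewrite ?Kxm ?Pm // Ev Um.
Qed.

(** Being increasing is a condition on consecutive labels, so [three_fwd] applies to each pair of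
    neighbouring $k$-steps and the $i$-step that arrives behind them. *)
Lemma slide_incc u cs z : is_perm n u -> dom n i u -> dec n k z ->
  incc k u cs -> kcover i (last u cs) z ->
  incc k (slide k i u cs z).1 (slide k i u cs z).2.
Proof.
move=> Hu Du Dz /andP[P S] Kz; rewrite /incc.
have [_ -> _ _] := slide_spec Hu Du Dz P Kz; rewrite /=.
elim: cs u Hu Du P S Kz => //= v cs IH u Hu Du /andP[K P] S Kz.
have Hv := kcover_perm Hu K.
have [a [b [T kab]]] := (proj1 (kcoverP _ _ Hu) K).
have Dv := dom_fwd T Du.
case: cs IH P S Kz => [|v2 cs] // IH P /= /andP[lt S] Kz.
have := IH v Hv Dv P S Kz; rewrite /=.
have [K2 P2] := andP P.
have [a2 [b2 [T3 kab2]]] := (proj1 (kcoverP _ _ Hv) K2).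
have Hv2 := kcover_perm Hv K2; have Dv2 := dom_fwd T3 Dv.
have [] := slide_spec Hv2 Dv2 Dz P2 Kz.
case: (slide k i v2 cs z) => [m2 cs'] /= Km Pm Lm _ S'.
apply/andP; split=> //.
have Hm2 := kcover_perm Hv2 Km.
have [i0 [d [T4 id]]] := (proj1 (kcoverP _ _ Hv2) Km).
have Dm : dec n k m2 by apply: (path_dec Hm2 Pm) => //; rewrite Lm.
exact: (three_fwd i1 ik Du Dm T kab T3 kab2 T4 id lt).
Qed.

Lemma unslide_spec u x cs : is_perm n u -> dom n i u -> dec n k (last x cs) ->
  kcover i u x -> path (kcover k) x cs ->
  let cs' := unslide k i u x cs in
  [/\ path (kcover k) u cs', kcover i (last u cs') (last x cs) &
      slide k i u cs' (last x cs) = (x, cs)].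
Proof.
elim: cs u x => [|y cs IH] u x Hu Du Dz Kx //= /andP[K P].
have Hx := kcover_perm Hu Kx; have Hy := kcover_perm Hx K.
have [i0 [d [T id]]] := (proj1 (kcoverP _ _ Hu) Kx).
have [a [b [T2 kab]]] := (proj1 (kcoverP _ _ Hx) K).
have Dy : dec n k y by apply: (path_dec Hy P).
have [m [a' [b' [d' [[Em Ex] [U1 kab'] [U2 id'] _]]]]] := mv_bwd i1 ik Du Dy T id T2 kab.
have [Hm _ _ _ _] := U2; have Dm := dom_fwd U1 Du.
have Km : kcover k u m by rewrite (tstep_kcover k U1).
have Kmy : kcover i m y by rewrite (tstep_kcover i U2).
rewrite Em; have [Q1 Q2 Q3] := IH m y Hm Dm Dz Kmy P.
by rewrite Km Q1 Q2 Q3 /= Ex.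
Qed.

Lemma unslide_incc u x cs : is_perm n u -> dom n i u -> dec n k (last x cs) ->
  kcover i u x -> incc k x cs -> incc k u (unslide k i u x cs).
Proof.
move=> Hu Du Dz Kx /andP[P S]; rewrite /incc.
have [-> _ _] := unslide_spec Hu Du Dz Kx P; rewrite /=.
elim: cs u x Hu Du Dz Kx P S => //= y cs IH u x Hu Du Dz Kx /andP[K P] S.
have Hx := kcover_perm Hu Kx; have Hy := kcover_perm Hx K.
have [i0 [d [T id]]] := (proj1 (kcoverP _ _ Hu) Kx).
have [a [b [T2 kab]]] := (proj1 (kcoverP _ _ Hx) K).
have Dy : dec n k y by apply: (path_dec Hy P).
case: cs IH P S Dz => [|y2 cs] // IH P /= /andP[lt S] Dz.
have [m [a' [b' [d' [[Em Ex] [U1 kab'] [U2 id'] _]]]]] := mv_bwd i1 ik Du Dy T id T2 kab.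
have [Hm _ _ _ _] := U2; have Dm := dom_fwd U1 Du.
have Kmy : kcover i m y by rewrite (tstep_kcover i U2).
have := IH m y Hm Dm Dz Kmy P S; rewrite /= Em => S'.
apply/andP; split=> //.
have [K2 P2] := andP P; have Hy2 := kcover_perm Hy K2.
have [a2 [b2 [T3 kab2]]] := (proj1 (kcoverP _ _ Hy) K2).
have Dy2 : dec n k y2 by apply: (path_dec Hy2 P2).
by have := three_bwd i1 ik Du Dy2 T id T2 kab T3 kab2 lt; rewrite /= Em.
Qed.

(** Each step has lower position exactly [i], so the labels are the successive entries there, and
    these increase. *)
Lemma path_dom_incc u cs : is_perm n u -> dom n i u -> path (kcover i) u cs -> incc i u cs.
Proof.
move=> Hu Du P; rewrite /incc P /=.
elim: cs u Hu Du P => //= v cs IH u Hu Du /andP[K P].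
have Hv := kcover_perm Hu K.
have [a [b [T iab]]] := (proj1 (kcoverP _ _ Hu) K).
have Dv := dom_fwd T Du; have := IH v Hv Dv P.
case: cs P {IH} => //= v2 cs /andP[K2 _] ->; rewrite andbT.
have [a2 [b2 [T2 iab2]]] := (proj1 (kcoverP _ _ Hv) K2).
rewrite (tstep_swapmin T) (tstep_swapmin T2).
have ia := dom_ge T Du; have ia2 := dom_ge T2 Dv.
have -> : a2 = a by move: iab iab2 ia ia2; clia.
by have [_ _ F -> _] := tstep_vals T.
Qed.

Lemma grow_spec u cs ds : is_perm n u -> dom n i u -> dec n k (last (last u cs) ds) ->
  incc k u cs -> path (kcover i) (last u cs) ds ->
  let r := grow k i u cs ds in
  [/\ path (kcover i) u r.1, incc k (last u r.1) r.2,
      last (last u r.1) r.2 = last (last u cs) ds & ungrow k i u r.1 r.2 = (cs, ds)].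
Proof.
elim: ds u cs => [|d ds IH] u cs Hu Du Dz I //= /andP[K P].
have [Pc _] := andP I; have Hl := path_perm Hu Pc; have Hd := kcover_perm Hl K.
have Dd : dec n k d by apply: (path_dec Hd P) => //; exact: ltnW.
have := slide_incc Hu Du Dd I K; have [] := slide_spec Hu Du Dd Pc K.
case: (slide k i u cs d) => [x cs'] /= Kx Px Lx Ux Ix.
have Hx := kcover_perm Hu Kx.
have Dx : dom n i x.
  by have [a [b [T _]]] := (proj1 (kcoverP _ _ Hu) Kx); apply: dom_fwd T Du.
have [||Q1 Q2 Q3 Q4] := IH x cs' Hx Dx _ Ix; rewrite ?Lx //.
by rewrite Kx Q1 Q2 Q3 Q4 /= Lx Ux.
Qed.

Lemma ungrow_spec u es cs : is_perm n u -> dom n i u -> dec n k (last (last u es) cs) ->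
  path (kcover i) u es -> incc k (last u es) cs ->
  let r := ungrow k i u es cs in
  [/\ incc k u r.1, path (kcover i) (last u r.1) r.2,
      last (last u r.1) r.2 = last (last u es) cs & grow k i u r.1 r.2 = (es, cs)].
Proof.
elim: es u => [|e es IH] u Hu Du Dz //= /andP[K P] I.
have He := kcover_perm Hu K.
have De : dom n i e.
  by have [a [b [T _]]] := (proj1 (kcoverP _ _ Hu) K); apply: dom_fwd T Du.
have [] := IH e He De Dz P I.
case: (ungrow k i e es cs) => [cs1 ds1] /= I1 P1 L1 G1.
have [Pc1 _] := andP I1; have Hl := path_perm He Pc1.
have Dl : dec n k (last e cs1).
  by apply: (path_dec Hl P1); [exact: ltnW|rewrite L1].
have [_ Q2 Q3] := unslide_spec Hu Du Dl K Pc1.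
by rewrite (unslide_incc Hu Du Dl K I1) Q2 P1 L1 Q3 /= G1.
Qed.
End Slide.

(** * The iterated local moves compute [grow] *)

Lemma find_iota (P : pred nat) m p N : P (m + p) -> p < N ->
  (forall q, q < p -> ~~ P (m + q)) -> find P (iota m N) = p.
Proof.
move=> Pp pN nP; rewrite -(subnKC (ltnW pN)) iotaD find_cat.
have -> : has P (iota m p) = false.
  apply/negbTE/hasPn => q; rewrite mem_iota => /andP[mq qp].
  by rewrite -(subnKC mq); apply: nP; rewrite ltn_subLR.
have : 0 < N - p by rewrite subn_gt0.
by case: (N - p) => //= d _; rewrite Pp size_iota addn0.
Qed.

Lemma set_nth_at (T : Type) (d : T) pre x y post p : size pre = p ->
  set_nth d (pre ++ x :: post) p y = pre ++ y :: post.
Proof. by elim: pre p => [|z pre IH] [|p] //= [/IH ->]. Qed.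

(** After [a] labels already in front and [b] waiting ones, the leftmost segment to move is at index
    [a + b]; the [a + b] permutations of [pre] precede it. *)
Lemma grow_stepE k i pre a b u v x post rest : size pre = a + b ->
  grow_step k i (pre ++ u :: v :: x :: post,
      nseq a true ++ nseq b false ++ false :: true :: rest) =
  (pre ++ u :: mv k i u v x :: x :: post,
      nseq a true ++ nseq b false ++ true :: false :: rest).
Proof.
move=> Sp; rewrite /grow_step.
set ts := nseq a true ++ _.
have Nts d q : nth d ts q = if q < a then true else if q < a + b then false else
   nth d [:: false, true & rest] (q - (a + b)).
  rewrite /ts !nth_cat !size_nseq !nth_nseq.
  case: (ltnP q a) => // qa; rewrite subnDA.
  have -> : (q < a + b) = (q - a < b) by move: qa; clia.
  by case: (q - a < b).
have -> : find (fun q => ~~ nth true ts q && nth false ts q.+1) (iota 0 (size ts)) = a + b.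
  apply: find_iota.
  - rewrite !Nts subnn subSnn; case: ifP; first by clia.
    case: ifP; first by clia.
    case: ifP; first by clia.
    by case: ifP => //; clia.
  - by rewrite !size_cat !size_nseq /=; clia.
  - move=> q qab; rewrite !Nts; case: ltnP => //= qa.
    rewrite qab /=; case: ltnP => [|_]; first by move: qa; clia.
    by case: ltnP => // le; have -> : q.+1 - (a + b) = 0 by move: qab; clia.
have -> : (a + b == size ts) = false.
  by rewrite !size_cat !size_nseq /=; clia.
have Nw j : nth [::] (pre ++ u :: v :: x :: post) (a + b + j) = nth [::] [:: u, v, x & post] j.
  by rewrite nth_cat Sp ltnNge leq_addr /= addKn.
have := Nw 0; have := Nw 1; have := Nw 2; rewrite addn0 addn1 addn2 => -> -> -> /=.
rewrite -/(mv k i u v x); congr pair.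
  by rewrite -cat_rcons set_nth_at ?size_rcons ?Sp // cat_rcons.
rewrite /ts catA set_nth_at ?size_cat ?size_nseq // -cat_rcons set_nth_at.
  by rewrite cat_rcons -catA.
by rewrite size_rcons size_cat !size_nseq.
Qed.

Lemma nseqSr (T : Type) m (x : T) s : nseq m.+1 x ++ s = nseq m x ++ x :: s.
Proof. by elim: m => //= m ->. Qed.

Lemma slide_iter k i u cs z pre a b post rest : size pre = a + b ->
  iter (size cs) (grow_step k i) (pre ++ u :: cs ++ z :: post,
     nseq a true ++ nseq (b + size cs) false ++ true :: rest) =
  (pre ++ u :: (slide k i u cs z).1 :: (slide k i u cs z).2 ++ post,
     nseq a true ++ nseq b false ++ true :: nseq (size cs) false ++ rest).
Proof.
elim: cs u pre b => [|v cs IH] u pre b Sp /=; first by rewrite addn0.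
have := IH v (rcons pre u) b.+1; rewrite size_rcons Sp addnS => /(_ erefl).
rewrite !cat_rcons addSn [b + (size cs).+1]addnS => ->.
by rewrite nseqSr grow_stepE.
Qed.

Lemma grow_iter k i u cs ds pre a : size pre = a ->
  iter (size cs * size ds) (grow_step k i) (pre ++ u :: cs ++ ds,
     nseq a true ++ nseq (size cs) false ++ nseq (size ds) true) =
  (pre ++ u :: (grow k i u cs ds).1 ++ (grow k i u cs ds).2,
     nseq (a + size ds) true ++ nseq (size cs) false).
Proof.
elim: ds u cs pre a => [|d ds IH] u cs pre a Sp.
  by rewrite muln0 /= addn0 !cats0.
rewrite mulnSr iterD /=.
have := @slide_iter k i u cs d pre a 0 ds (nseq (size ds) true).
rewrite addn0 add0n => -> //=.
have := IH (slide k i u cs d).1 (slide k i u cs d).2 (rcons pre u) a.+1.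
rewrite size_rcons Sp size_slide => /(_ erefl); rewrite !cat_rcons.
by rewrite nseqSr => ->; rewrite addnS.
Qed.

Lemma grow_step_fix k i ws a b :
  grow_step k i (ws, nseq a true ++ nseq b false) = (ws, nseq a true ++ nseq b false).
Proof.
rewrite /grow_step; set ts := nseq a true ++ _.
have -> : find (fun q => ~~ nth true ts q && nth false ts q.+1) (iota 0 (size ts)) = size ts.
  rewrite -[RHS](size_iota 0); apply: hasNfind; apply/hasPn => q _.
  rewrite /ts !nth_cat !size_nseq !nth_nseq.
  case: (ltnP q a) => //= qa; case: (ltnP q.+1 a) => [|_]; first by move: qa; clia.
  by do 2 case: ifP.
by rewrite eqxx.
Qed.

Lemma growthE n k i u cs ds : is_perm n u -> k != i -> incc k u cs ->
  incc i (last u cs) ds ->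
  growth k i u (last u cs) (last (last u cs) ds) = last u (grow k i u cs ds).1.
Proof.
move=> Hu ki I J; have [P _] := andP I; have Hl := path_perm Hu P.
rewrite /growth (negbTE ki) (inc_chainE Hu I) (inc_chainE Hl J) /=.
set ts := nseq _ _ ++ _.
(* Every $i$-step passes every $k$-step once; the remaining iterations find nothing to move. *)
have le : size cs * size ds <= size ts * size ts.
  by rewrite /ts size_cat !size_nseq leq_mul // ?leq_addr ?leq_addl.
rewrite -(subnK le) iterD.
have := @grow_iter k i u cs ds [::] 0 erefl; rewrite /= -/ts => ->.
have -> m ws : iter m (grow_step k i) (ws, nseq (0 + size ds) true ++ nseq (size cs) false)
    = (ws, nseq (0 + size ds) true ++ nseq (size cs) false).
  by elim: m => //= m ->; rewrite grow_step_fix.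
rewrite /= -cat_cons nth_cat /= (proj1 (size_grow _ _ _ _ _)) ltnS leqnn.
by rewrite -[size ds](proj1 (size_grow k i u cs ds)) nth_last.
Qed.

(** * Growth as a bijection for fixed end points *)

Lemma has_inc_perm n k u v : is_perm n u -> has_inc_chain k u v -> is_perm n v.
Proof. by move=> Hu /has_incP [cs /andP[P _] <-]; apply: path_perm P. Qed.

Section Growth.
Variables (n k i : nat) (u w : seq nat).
Hypotheses (i1 : 1 <= i) (ik : i < k).
Hypotheses (Hu : is_perm n u) (Du : dom n i u) (Dw : dec n k w).

Let ki : k != i. Proof. by rewrite neq_ltn ik orbT. Qed.

Lemma growth_grow v : has_inc_chain k u v -> has_inc_chain i v w ->
  exists cs ds, let r := grow k i u cs ds in
  [/\ last u cs = v, growth k i u v w = last u r.1,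
     incc i u r.1 /\ incc k (last u r.1) r.2, last (last u r.1) r.2 = w &
     [/\ ungrow k i u r.1 r.2 = (cs, ds), size cs = ell v - ell u, size ds = ell w - ell v,
        size r.1 = size ds & size r.2 = size cs]].
Proof.
case/has_incP=> cs I Ev /has_incP[ds J Ew]; exists cs, ds; subst v w.
have [Pc _] := andP I; have [Pd _] := andP J; have Hv := path_perm Hu Pc.
have [Q1 Q2 Q3 Q4] := grow_spec i1 ik Hu Du Dw I Pd.
rewrite /= (growthE Hu ki I J); have [-> ->] := size_grow k i u cs ds.
have E1 := path_ell Hu Pc; have E2 := path_ell Hv Pd.
split=> //; last by rewrite Q4 E2 E1 !addKn.
by split=> //; apply: (path_dom_incc Hu Du Q1).
Qed.

Lemma growth_ok v : has_inc_chain k u v -> has_inc_chain i v w ->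
  let v' := growth k i u v w in
  [/\ has_inc_chain i u v', has_inc_chain k v' w, 
      ell v' - ell u = ell w - ell v & ell w - ell v' = ell v - ell u].
Proof.
move=> A B; have [cs [ds]] := growth_grow A B.
case: (grow k i u cs ds) => es cs' /= [E1 -> [I J] E2 [_ S1 S2 S3 S4]].
have [P1 _] := andP I; have [P2 _] := andP J; have H := path_perm Hu P1.
split; [by apply/has_incP; exists es | by apply/has_incP; exists cs' | |].
  by rewrite (path_ell Hu P1) addKn S3 S2.
by rewrite -E2 (path_ell H P2) addKn S4 S1.
Qed.

(** By uniqueness of increasing chains the common value of growth determines both grown chains, and
    [ungrow] recovers the original ones from them. *)
Lemma growth_inj v1 v2 : has_inc_chain k u v1 -> has_inc_chain i v1 w ->
  has_inc_chain k u v2 -> has_inc_chain i v2 w ->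
  growth k i u v1 w = growth k i u v2 w -> v1 = v2.
Proof.
move=> A1 B1 A2 B2; have [cs1 [ds1]] := growth_grow A1 B1.
have [cs2 [ds2]] := growth_grow A2 B2.
case: (grow k i u cs1 ds1) (grow k i u cs2 ds2) => [es1 cs1'] [es2 cs2'] /=.
case=> [<- -> [I2 J2] E2 [U2 _ _ _ _]] [<- -> [I1 J1] E1 [U1 _ _ _ _]] E.
have Ee := incc_uniq Hu I1 I2 E; subst es2.
have [P1 _] := andP I1; have H := path_perm Hu P1.
have Ec := incc_uniq H J1 J2 (etrans E1 (esym E2)); subst cs2'.
by move: U1; rewrite U2 => -[->].
Qed.

Lemma growth_surj v' : has_inc_chain i u v' -> has_inc_chain k v' w ->
  exists v, [/\ has_inc_chain k u v, has_inc_chain i v w & growth k i u v w = v'].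
Proof.
case/has_incP=> es I Ev /has_incP[cs J Ew]; subst v' w.
have [Pe _] := andP I.
have [Q1 Q2 Q3 Q4] := ungrow_spec i1 ik Hu Du Dw Pe J.
case: (ungrow k i u es cs) Q1 Q2 Q3 Q4 => [cs0 ds0] /= Q1 Q2 Q3 Q4.
have [P0 _] := andP Q1; have H0 := path_perm Hu P0.
have D0 := path_dom Hu P0 Du.
have J0 := path_dom_incc H0 D0 Q2.
exists (last u cs0); split; first by apply/has_incP; exists cs0.
  by apply/has_incP; exists ds0.
by rewrite -Q3 (growthE Hu ki Q1 J0) Q4.
Qed.
End Growth.

(** * The flip *)

Lemma pat_w0 n p : 1 <= p <= n -> pat (w0 n) p = n.+1 - p.
Proof.
case: p => // p pn; rewrite /pat /w0 /= nth_rev ?size_iota // nth_iota; lia.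
Qed.

Lemma w0_dec n k : dec n k (w0 n).
Proof. by move=> p q kp pq qn; rewrite !pat_w0; lia. Qed.

Lemma w0_dom n i : dom n i (w0 n).
Proof. by move=> p q p1 pi pq qn; rewrite !pat_w0; lia. Qed.

(** * Decrease and dominance along compatible chains *)

Section Chains.
Variables (n : nat) (w : seq nat).
Hypothesis Hw : is_perm n w.

Lemma compat_perm C g t : compatible C g -> head [::] C = w -> t <= size g ->
  is_perm n (nth [::] C t).
Proof.
case=> _ H Hh; elim: t => [|t IH] tg; first by rewrite nth0 Hh.
by apply: (has_inc_perm (IH (ltnW tg))); apply: H.
Qed.

Lemma last_nth_compat C g : compatible C g -> last [::] C = nth [::] C (size g).
Proof. by case=> S _; rewrite -nth_last S. Qed.

Lemma compat_dec C g k t : chain_from_to n w g C ->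
  (forall s, t <= s -> s < size g -> nth 0 g s <= k) -> t <= size g ->
  dec n k (nth [::] C t).
Proof.
case=> Cc Hh Hl Hk tg; rewrite -(subKn tg).
have : size g - t <= size g - t by [].
elim: {-2}(size g - t) => [|m IH] le.
  by rewrite subn0 -last_nth_compat // Hl; apply: w0_dec.
have lt : size g - m.+1 < size g by move: le; clia.
have [Cs Ci] := Cc.
have := Ci _ lt; have -> : (size g - m.+1).+1 = size g - m by move: le; clia.
case/has_incP => cs /andP[P _] E.
apply: (path_dec (compat_perm Cc Hh (ltnW lt)) P).
  by apply: Hk => //; move: le tg; clia.
by rewrite E; apply: IH; exact: ltnW.
Qed.

Lemma compat_dom C g i s t : compatible C g -> head [::] C = w -> s <= t -> t <= size g ->
  dom n i (nth [::] C s) -> dom n i (nth [::] C t).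
Proof.
move=> Cc Hh st tg D; elim: t st tg => [|t IH]; first by rewrite leqn0 => /eqP <-.
rewrite leq_eqVlt => /orP[/eqP <- //|st tg].
have [_ Ci] := Cc; case/has_incP: (Ci _ tg) => cs /andP[P _] <-.
by apply: (path_dom (compat_perm Cc Hh (ltnW tg)) P); apply: IH => //; exact: ltnW.
Qed.

(** Each descending label [k] exceeds all later ones, so after its link the entries beyond position
    [k - 1] decrease and position [k] carries the maximum that [incc_dom] asks for. The link
    labelled [i] is treated last, with the dominance just obtained. *)
Lemma compat_dom_desc C i : chain_from_to n w (iota 1 i ++ rev (iota i.+1 (n.-1 - i))) C ->
  i < n -> dom n i.+1 (nth [::] C i) /\ dom n i (nth [::] C i.-1).
Proof.
move=> H lt_in; have [Cc Hh Hl] := H.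
set g := iota 1 i ++ _ in H Cc.
have Sg : size g = n.-1 by rewrite size_cat size_rev !size_iota; move: lt_in; clia.
have Ng s : i <= s < n.-1 -> nth 0 g s = n.-1 - (s - i).
  move=> Hs; rewrite nth_cat size_iota ltnNge (proj1 (andP Hs)) /= nth_rev ?size_iota; last first.
    by move: Hs; clia.
  by rewrite nth_iota; move: Hs; clia.
have Dj t : i <= t -> t <= n.-1 -> dom n i.+1 (nth [::] C t).
  move=> it tn; rewrite -(subKn tn).
  have : n.-1 - t <= n.-1 - t by [].
  elim: {-2}(n.-1 - t) => [|m IH] le.
    by rewrite subn0 -Sg -last_nth_compat // Hl; apply: w0_dom.
  set s := n.-1 - m.+1.
  have lt : s < size g by rewrite Sg /s; move: le; clia.
  have [Cs Ci] := Cc.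
  have Es : s.+1 = n.-1 - m by rewrite /s; move: le; clia.
  have := Ci _ lt; rewrite Es Ng; last by rewrite /s; move: le it tn; clia.
  set k := n.-1 - (s - i).
  have kb : i.+1 <= k by rewrite /k /s; move: le it tn lt_in; clia.
  case/has_incP => cs I E; have [P _] := andP I.
  apply: (incc_dom (compat_perm Cc Hh (ltnW lt)) I) => //.
    by rewrite E; apply: IH; exact: ltnW.
  rewrite E => p kp pn.
  have D : dec n k.-1 (nth [::] C (n.-1 - m)).
    apply: (compat_dec H); last by rewrite Sg leq_subr.
    move=> s' ls ss; rewrite Ng; last by move: ss; rewrite Sg; move: ls le it tn; clia.
    by rewrite /k /s; move: ss ls; rewrite Sg; move: le it tn; clia.
  by apply: D => //; move: kb; clia.
have D1 : dom n i.+1 (nth [::] C i) by apply: Dj => //; move: lt_in; clia.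
split=> //; case: (posnP i) => [i0|ip].
  by move=> p q p1; rewrite i0 ltnNge (ltnW p1).
have lt : i.-1 < size g by rewrite Sg; move: ip lt_in; clia.
have [_ Ci] := Cc; move: (Ci _ lt); rewrite prednK //.
have -> : nth 0 g i.-1 = i.
  by rewrite nth_cat size_iota ltn_predL ip nth_iota ?ltn_predL // add1n prednK.
case/has_incP=> cs I E.
apply: (incc_dom (compat_perm Cc Hh (ltnW lt)) I) => //; rewrite E.
  by move=> p q p1 pi pq qn; apply: D1 => //; apply: ltnW.
by move=> p ip' pn; apply: D1.
Qed.
End Chains.

(* The labels while stage i of the flip moves i to its place: A is still to be
   passed. *)
Definition gamma i A B := iota 1 i.-1 ++ A ++ i :: B.

Lemma flip_stepE i A k B C : 1 <= i -> i \notin rcons A k ->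
  let j := (i.-1 + size A) in
  flip_step (gamma i (rcons A k) B, C) =
  (gamma i A (k :: B),
   set_nth [::] C j.+1 (growth k i (nth [::] C j) (nth [::] C j.+1) (nth [::] C j.+2))).
Proof.
move=> i1 iA j; set g := gamma _ _ _.
set G := iota 1 i.-1 ++ A.
have Eg : g = G ++ k :: i :: B by rewrite /g /gamma /G -cats1 -!catA.
have SG : size G = j by rewrite size_cat size_iota.
have Sg : size g = (j + size B).+2 by rewrite Eg size_cat SG /= !addnS.
have iG : i \notin G.
  rewrite mem_cat negb_or mem_iota; apply/andP; split; first by move: i1; clia.
  by apply: contra iA; rewrite mem_rcons inE => ->; rewrite orbT.
have ik : i != k by apply: contra iA => /eqP ->; rewrite mem_rcons inE eqxx.
have find_i : find (fun q => pat g q != q) (iota 1 (size g)) = i.-1.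
  apply: find_iota.
  - rewrite add1n prednK // /pat /g /gamma nth_cat size_iota ltnn subnn.
    apply: contra iA => /eqP {1}<-.
    have lt : 0 < size (rcons A k) by rewrite size_rcons.
    by rewrite nth_cat lt mem_nth.
  - by rewrite Sg /j; clia.
  - move=> q qi; rewrite negbK add1n /pat /= /g /gamma nth_cat size_iota qi.
    by rewrite nth_iota // add1n.
rewrite /flip_step find_i prednK //.
have -> : (size g < i) = false by rewrite Sg /j; clia.
have Ei : index i g = j.+1.
  by rewrite Eg index_cat (negbTE iG) /= eq_sym (negbTE ik) eqxx SG addn1.
have Ek : pat g j.+1 = k by rewrite /pat /= Eg nth_cat SG ltnn subnn.
rewrite Ei /= Ek; congr pair.
apply: (@eq_from_nth _ 0).
  by rewrite size_swap Sg /gamma catA -/G size_cat SG /= !addnS.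
rewrite size_swap Sg => p pg.
rewrite -[LHS]/(pat (swap g j.+1 j.+2) p.+1) pat_swap ?Sg //.
rewrite /pat /= !eqSS Eg /gamma catA -/G !nth_cat SG.
rewrite ltnn subnn ltnNge leqnSn /= subSnn /=.
case: (ltngtP p j) => [lt|lt|->]; last by rewrite subnn.
  by have -> : (p == j.+1) = false by move: lt; clia.
case: eqP => [->|ne]; first by rewrite subSnn.
by have -> : p - j = (p - j).-2.+2 by move: lt ne; clia.
Qed.

Lemma iota_rcons m k : iota m k.+1 = rcons (iota m k) (m + k).
Proof. by rewrite -addn1 iotaD cats1. Qed.

Lemma iota1_rcons i : 1 <= i -> iota 1 i = rcons (iota 1 i.-1) i.
Proof. by case: i => // i _; rewrite [LHS]iota_rcons. Qed.

Lemma nth_wt C s : s.+1 < size C -> nth 0 (wt C) s = ell (nth [::] C s.+1) - ell (nth [::] C s).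
Proof.
case: C => // u C lt; rewrite /wt /= (nth_pairmap [::]) //.
Qed.

Lemma size_wt C : size (wt C) = (size C).-1.
Proof. by case: C => // u C; rewrite /wt size_pairmap. Qed.

Lemma compat_step C G k i B v : compatible C (G ++ k :: i :: B) ->
  let j := size G in
  has_inc_chain i (nth [::] C j) v -> has_inc_chain k v (nth [::] C j.+2) ->
  compatible (set_nth [::] C j.+1 v) (G ++ i :: k :: B).
Proof.
case=> S H j A1 A2; split.
  rewrite size_set_nth S !size_cat /= (maxn_idPr _) // -/j; clia.
move=> s; rewrite size_cat /= -/j => lt; rewrite !nth_set_nth /= nth_cat -/j.
have := H s; rewrite size_cat /= -/j => /(_ lt); rewrite nth_cat -/j.
case: (ltngtP s j) => [sj|sj|->].
- have -> : (s == j.+1) = false by move: sj; clia.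
  by have -> : (s.+1 == j.+1) = false by move: sj; clia.
- have -> : (s.+1 == j.+1) = false by move: sj; clia.
  case: (eqVneq s j.+1) => [->|ne]; first by rewrite subSnn.
  by have -> : s - j = (s - j).-2.+2 by move: sj ne; clia.
- rewrite subnn eqxx; have -> // : (j == j.+1) = false by clia.
Qed.

Lemma head_set_nth C j (v : seq nat) : head [::] (set_nth [::] C j.+1 v) = head [::] C.
Proof. by case: C. Qed.

Lemma set_nthK (C : seq (seq nat)) j x y : j < size C -> nth [::] C j = x ->
  set_nth [::] (set_nth [::] C j y) j x = C.
Proof.
move=> lt <-; apply: (@eq_from_nth _ [::]).
  by rewrite !size_set_nth !(maxn_idPr _) ?maxn_idPr.
by move=> s _; rewrite !nth_set_nth /= nth_set_nth /=; case: eqP => [->|].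
Qed.

Lemma zip_step (G B : seq nat) k i (s t : seq nat) : let j := size G in
  size s = (j + size B).+2 -> size t = size s ->
  nth 0 t j = nth 0 s j.+1 -> nth 0 t j.+1 = nth 0 s j ->
  (forall q, q != j -> q != j.+1 -> nth 0 t q = nth 0 s q) ->
  perm_eq (zip (G ++ k :: i :: B) s) (zip (G ++ i :: k :: B) t).
Proof.
move=> j Ss St E1 E2 Eo.
have cut r : size r = (j + size B).+2 -> exists r1 r2, size r1 = j /\ r = r1 ++ nth 0 r j :: nth 0 r j.+1 :: r2.
  move=> Sr; exists (take j r), (drop j.+2 r); rewrite size_takel; last by rewrite Sr; clia.
  split=> //; rewrite -{1}(cat_take_drop j r) (drop_nth 0) ?(drop_nth 0 (n := j.+1)) // Sr; clia.
have [s1 [s2 [Ss1 Es]]] := cut s Ss.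
have [|t1 [t2 [St1 Et]]] := cut t; first by rewrite St.
have E3 : t1 = s1.
  apply: (@eq_from_nth _ 0); first by rewrite St1 Ss1.
  move=> q; rewrite St1 => qj; have := Eo q; rewrite {1}Es {1}Et !nth_cat St1 Ss1 qj.
  by apply; move: qj; clia.
have E4 : t2 = s2.
  have Z : size t2 = size s2.
    by move: St; rewrite {1}Es {1}Et !size_cat /= St1 Ss1; clia.
  apply: (@eq_from_nth _ 0) => // q _; have := Eo (j + q.+2).
  rewrite {1}Es {1}Et !nth_cat St1 Ss1.
  have -> : (j + q.+2 < j) = false by clia.
  by rewrite addKn /=; apply; clia.
rewrite Es Et E1 E2 E3 E4 !zip_cat ?Ss1 //= perm_cat2l.
set x := (_, _); set y := (_, _); set z := zip _ _.
by rewrite -(cat1s x) -[y :: x :: z](cat1s y) -(cat1s y) -(cat1s x z) perm_catCA.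
Qed.

Section Bij.
Variables (n : nat) (w : seq nat).
Hypothesis Hw : is_perm n w.
Hypothesis n1 : 1 <= n.

(** Dominance is asked for only at the left end of the link that [i] will finally label; it persists
    along the chain from there. *)
Definition Sg i A B (C : seq (seq nat)) : Prop :=
  chain_from_to n w (gamma i A B) C /\ dom n i (nth [::] C i.-1).

(* The multiset of (label, weight) pairs is invariant; as the labels are
   distinct, it determines the final weight. *)
Definition flips N g (P : seq (seq nat) -> Prop) g' (P' : seq (seq nat) -> Prop) : Prop :=
  [/\ forall C, P C -> exists C', [/\ iter N flip_step (g, C) = (g', C'), P' C' &
         perm_eq (zip g (wt C)) (zip g' (wt C'))],
      forall C1 C2, P C1 -> P C2 ->
         iter N flip_step (g, C1) = iter N flip_step (g, C2) -> C1 = C2 &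
      forall C', P' C' -> exists2 C, P C & iter N flip_step (g, C) = (g', C')].

Lemma flips_trans N1 N2 g1 P1 g2 P2 g3 P3 :
  flips N1 g1 P1 g2 P2 -> flips N2 g2 P2 g3 P3 -> flips (N1 + N2) g1 P1 g3 P3.
Proof.
move=> [A1 B1 C1] [A2 B2 C2]; split.
- move=> C /A1 [C' [E1 /A2 [C'' [E2 H W2]] W1]]; exists C''.
  by rewrite addnC iterD E1 E2; split=> //; apply: perm_trans W1 W2.
- move=> C D HC HD; rewrite addnC !iterD.
  have [C' [E1 HC' _]] := A1 _ HC; have [D' [E2 HD' _]] := A1 _ HD.
  rewrite E1 E2 => /(B2 _ _ HC' HD') E.
  by apply: B1 => //; rewrite E1 E2 E.
- move=> C /C2 [C' /C1 [C'' H E1] E2]; exists C'' => //.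
  by rewrite addnC iterD E1.
Qed.

Lemma flips0 g P : flips 0 g P g P.
Proof.
split=> [C HC|C D _ _ [->] //|C HC]; first by exists C.
by exists C.
Qed.

Lemma flips_eq N g P g' P' Q Q' : (forall C, P C <-> Q C) -> (forall C, P' C <-> Q' C) ->
  flips N g P g' P' -> flips N g Q g' Q'.
Proof.
move=> E E' [A B C]; split.
- by move=> D /E /A [D' [? /E' ? ?]]; exists D'.
- by move=> D D' /E HD /E HD'; apply: B.
- by move=> D /E' /C [D' /E ? ?]; exists D'.
Qed.

Lemma flips_one i A k B : 1 <= i ->
  rcons A k ++ B = rev (iota i.+1 (n.-1 - i)) -> 
  flips 1 (gamma i (rcons A k) B) (Sg i (rcons A k) B) (gamma i A (k :: B)) (Sg i A (k :: B)).
Proof.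
move=> i1 Erev.
have mem x : x \in rcons A k ++ B -> i < x by rewrite Erev mem_rev mem_iota => /andP[].
have iA : i \notin rcons A k.
  by apply/negP => H; have := mem i; rewrite mem_cat H ltnn => /(_ isT).
have ik : i < k by apply: mem; rewrite mem_cat mem_rcons inE eqxx.
(* The labels behind the pair are smaller than [k], which yields the decreasing tail at the end of
   the segment. *)
have kB s : s \in B -> s < k.
  have : sorted gtn (rcons A k ++ B).
    by rewrite Erev rev_sorted; apply: iota_ltn_sorted.
  move=> S sB; move: S; rewrite cat_rcons => /cat_sorted2 [_] /=.
  by rewrite path_sortedE; [case/andP=> /allP /(_ s sB)|move=> x y z; rewrite /= => a b; apply: ltn_trans b a].
pose G := iota 1 i.-1 ++ A; pose j := size G.
have Ej : j = i.-1 + size A by rewrite /j /G size_cat size_iota.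
have Eg : gamma i (rcons A k) B = G ++ k :: i :: B by rewrite /gamma /G -cats1 -!catA.
have Eg' : gamma i A (k :: B) = G ++ i :: k :: B by rewrite /gamma /G -!catA.
have info g C : g = G ++ k :: i :: B \/ g = G ++ i :: k :: B -> 
   chain_from_to n w g C -> dom n i (nth [::] C i.-1) ->
   [/\ size C = (j + size B).+3, is_perm n (nth [::] C j), dom n i (nth [::] C j) & dec n k (nth [::] C j.+2)].
  move=> Hg H D; have [Cc Hh Hl] := H; have [SC _] := Cc.
  have SSg : size g = (j + size B).+2 by case: Hg => ->; rewrite size_cat /= !addnS.
  split; first by rewrite SC SSg.
  - by apply: (compat_perm Hw Cc Hh); rewrite SSg; clia.
  - by apply: (compat_dom Hw Cc Hh _ _ D); rewrite ?SSg Ej; clia.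
  - apply: (compat_dec Hw H); last by rewrite SSg; clia.
    move=> s js ss; apply/ltnW/kB.
    have E : nth 0 g s = nth 0 B (s - j.+2).
      have E1 : (s < j) = false by move: js; clia.
      have E2 : s - j = (s - j.+2).+2 by move: js; clia.
      by case: Hg => ->; rewrite nth_cat -/j E1 E2.
    have lt : s - j.+2 < size B by move: ss js; rewrite SSg; clia.
    by rewrite E; apply: (mem_nth 0 lt).
have st C : iter 1 flip_step (gamma i (rcons A k) B, C) = (gamma i A (k :: B),
   set_nth [::] C j.+1 (growth k i (nth [::] C j) (nth [::] C j.+1) (nth [::] C j.+2))).
  by rewrite -[LHS]/(flip_step _) flip_stepE // -Ej.
have jj : (j.+1 < j) = false by clia.
have inc1 C : chain_from_to n w (gamma i (rcons A k) B) C ->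
   has_inc_chain k (nth [::] C j) (nth [::] C j.+1) /\
   has_inc_chain i (nth [::] C j.+1) (nth [::] C j.+2).
  case=> -[_ H] _ _; have := H j; have := H j.+1; rewrite Eg !nth_cat -/j size_cat /=.
  rewrite ltnn subnn jj subSnn /= => H1 H2; split; [apply: H2|apply: H1]; clia.
have inc2 C : chain_from_to n w (gamma i A (k :: B)) C ->
   has_inc_chain i (nth [::] C j) (nth [::] C j.+1) /\
   has_inc_chain k (nth [::] C j.+1) (nth [::] C j.+2).
  case=> -[_ H] _ _; have := H j; have := H j.+1; rewrite Eg' !nth_cat -/j size_cat /=.
  rewrite ltnn subnn jj subSnn /= => H1 H2; split; [apply: H2|apply: H1]; clia.
have lastC C v : size C = (j + size B).+3 -> last [::] (set_nth [::] C j.+1 v) = last [::] C.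
  move=> SC; rewrite -!nth_last size_set_nth (maxn_idPr _); last by rewrite SC; clia.
  by rewrite nth_set_nth /=; have -> : ((size C).-1 == j.+1) = false by rewrite SC; clia.
have domC C v : dom n i (nth [::] C i.-1) -> dom n i (nth [::] (set_nth [::] C j.+1 v) i.-1).
  by rewrite nth_set_nth /=; have -> : (i.-1 == j.+1) = false by rewrite Ej; clia.
split.
- move=> C [H D]; rewrite st.
  have [SC Hu Du Dw] := info _ _ (or_introl Eg) H D.
  have [I1 I2] := inc1 C H.
  have [J1 J2 W1 W2] := growth_ok i1 ik Hu Du Dw I1 I2.
  set v' := growth _ _ _ _ _ in J1 J2 W1 W2 *.
  have [Cc Hh Hl] := H; eexists; split; first by [].
    split; last exact: domC.
    split; [|by rewrite head_set_nth|by rewrite lastC].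
    by rewrite Eg'; apply: compat_step => //; rewrite -Eg.
  rewrite Eg Eg'; have SC' : size (set_nth [::] C j.+1 v') = size C.
    by rewrite size_set_nth (maxn_idPr _) // SC; clia.
  apply: zip_step; rewrite -/j.
  + by rewrite size_wt SC.
  + by rewrite !size_wt SC'.
  + rewrite !nth_wt ?SC' ?SC ?nth_set_nth /= ?eqxx; try clia.
    by have -> : (j == j.+1) = false by clia.
  + rewrite !nth_wt ?SC' ?SC ?nth_set_nth /= ?eqxx; try clia.
    by have -> : (j.+2 == j.+1) = false by clia.
  + move=> q q1 q2; case: (ltnP q.+1 (size C)) => lt; last first.
      by rewrite !nth_default ?size_wt ?SC' //; move: lt; clia.
    rewrite !nth_wt ?SC' // !nth_set_nth /=.
    by rewrite eqSS (negbTE q1) (negbTE q2).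
- move=> C1 C2 [H1 D1] [H2 D2]; rewrite !st => -[E].
  have [SC1 Hu1 Du1 Dw1] := info _ _ (or_introl Eg) H1 D1.
  have [SC2 Hu2 Du2 Dw2] := info _ _ (or_introl Eg) H2 D2.
  have [I1 I2] := inc1 C1 H1; have [J1 J2] := inc1 C2 H2.
  have En s : s != j.+1 -> nth [::] C1 s = nth [::] C2 s.
    by move=> ne; move/(congr1 (fun C => nth [::] C s)): E; rewrite !nth_set_nth /= (negbTE ne).
  have Ej0 : nth [::] C1 j = nth [::] C2 j by apply: En; clia.
  have Ej2 : nth [::] C1 j.+2 = nth [::] C2 j.+2 by apply: En; clia.
  move/(congr1 (fun C => nth [::] C j.+1)): E; rewrite !nth_set_nth /= eqxx -Ej0 -Ej2 => E.
  rewrite -Ej0 -?Ej2 in J1 J2.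
  have Ej1 := growth_inj i1 ik Hu1 Du1 Dw1 I1 I2 J1 J2 E.
  apply: (@eq_from_nth _ [::]); first by rewrite SC1 SC2.
  by move=> s _; case: (eqVneq s j.+1) => [->//|]; apply: En.
- move=> C' [H D]; have [SC Hu Du Dw] := info _ _ (or_intror Eg') H D.
  have [I1 I2] := inc2 C' H.
  have [v [J1 J2 Ev]] := growth_surj i1 ik Hu Du Dw I1 I2.
  have [Cc Hh Hl] := H.
  have S' : size (set_nth [::] C' j.+1 v) = size C'.
    by rewrite size_set_nth (maxn_idPr _) // SC; clia.
  exists (set_nth [::] C' j.+1 v); last first.
    rewrite st !nth_set_nth /= eqxx.
    have -> : (j == j.+1) = false by clia.
    have -> : (j.+2 == j.+1) = false by clia.
    by rewrite Ev set_nthK // SC; clia.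
  split; last exact: domC.
  split; [|by rewrite head_set_nth|by rewrite lastC].
  by rewrite Eg; apply: compat_step => //; rewrite -Eg'.
Qed.

Lemma flips_stage i A B : 1 <= i -> A ++ B = rev (iota i.+1 (n.-1 - i)) ->
  flips (size A) (gamma i A B) (Sg i A B) (gamma i [::] (A ++ B)) (Sg i [::] (A ++ B)).
Proof.
move=> i1; elim/last_ind: A B => [|A k IH] B E; first exact: flips0.
rewrite size_rcons -add1n; apply: (flips_trans (flips_one i1 E)).
by move: E; rewrite cat_rcons => E; apply: IH.
Qed.

(** At the end of a stage dominance follows from compatibility alone. The invariant thus excludes no
    chain, and surjectivity is not lost between stages. *)
Lemma Sg_chain i C : 1 <= i -> i < n ->
  Sg i [::] (rev (iota i.+1 (n.-1 - i))) C <->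
  chain_from_to n w (iota 1 i ++ rev (iota i.+1 (n.-1 - i))) C.
Proof.
move=> i1 lt.
have E : gamma i [::] (rev (iota i.+1 (n.-1 - i))) = iota 1 i ++ rev (iota i.+1 (n.-1 - i)).
  by rewrite (iota1_rcons i1) cat_rcons.
rewrite /Sg E; split=> [[] //|H]; split=> //.
by case: (compat_dom_desc Hw H lt).
Qed.

Lemma Sg_next i C : 1 <= i -> i.+1 < n ->
  Sg i [::] (rev (iota i.+1 (n.-1 - i))) C <-> Sg i.+1 (rev (iota i.+2 (n.-1 - i.+1))) [::] C.
Proof.
move=> i1 lt; rewrite Sg_chain //; last exact: ltnW.
have E : gamma i.+1 (rev (iota i.+2 (n.-1 - i.+1))) [::] = iota 1 i ++ rev (iota i.+1 (n.-1 - i)).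
  rewrite /gamma /=; have -> : n.-1 - i = (n.-1 - i.+1).+1 by move: lt; clia.
  by rewrite /= rev_cons -cats1.
rewrite /Sg E; split=> [H|[] //]; split=> //.
by case: (compat_dom_desc Hw H (ltnW lt)).
Qed.

Lemma flips_all i : 1 <= i -> i < n ->
  exists2 N, N <= (n - i) * n &
   flips N (gamma i (rev (iota i.+1 (n.-1 - i))) [::]) (Sg i (rev (iota i.+1 (n.-1 - i))) [::])
     (iota 1 n.-1) (chain_from_to n w (iota 1 n.-1)).
Proof.
move=> i1 lt; have [d Ed] : exists d, d = n.-1 - i by exists (n.-1 - i).
elim: d i i1 lt Ed => [|d IH] i i1 lt Ed.
  have Ei : i = n.-1 by move: lt Ed; clia.
  exists 0 => //; rewrite -Ed /=.
  have Eg : gamma i [::] [::] = iota 1 n.-1.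
    by rewrite -Ei (iota1_rcons i1) -cats1.
  rewrite Eg; apply: (flips_eq _ (fun C => iff_refl _) (flips0 _ _)).
  move=> C; have := @Sg_chain i C i1 lt; rewrite -Ed /= cats0 Ei.
  by case=> H1 H2; split.
have lt' : i.+1 < n by move: Ed; clia.
have [//|N le F] := IH i.+1 isT lt'; first by move: Ed; clia.
have E0 : rev (iota i.+1 (n.-1 - i)) ++ [::] = rev (iota i.+1 (n.-1 - i)) by rewrite cats0.
have F1 := flips_stage i1 E0; rewrite E0 in F1.
have Eg : gamma i [::] (rev (iota i.+1 (n.-1 - i))) = gamma i.+1 (rev (iota i.+2 (n.-1 - i.+1))) [::].
  rewrite /gamma /=; have -> : n.-1 - i = (n.-1 - i.+1).+1 by move: lt'; clia.
  by rewrite (iota1_rcons i1) cat_rcons /= rev_cons cats1.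
exists (size (rev (iota i.+1 (n.-1 - i))) + N).
  rewrite size_rev size_iota; have -> : n - i = (n - i.+1).+1 by move: lt; clia.
  by rewrite mulSn; move: le; clia.
apply: (flips_trans F1); rewrite Eg.
apply: (flips_eq _ (fun C => iff_refl _) F) => C.
by case: (@Sg_next i C i1 lt') => H1 H2; split.
Qed.

Lemma flip_step_fix C : flip_step (iota 1 n.-1, C) = (iota 1 n.-1, C).
Proof.
rewrite /flip_step size_iota.
have -> : find (fun q => pat (iota 1 n.-1) q != q) (iota 1 n.-1) = size (iota 1 n.-1).
  apply: hasNfind; apply/hasPn => q; rewrite mem_iota negbK => /andP[q1 qn].
  by rewrite /pat nth_iota ?add1n ?prednK //; move: q1 qn; clia.
by rewrite size_iota ltnSn.
Qed.

Lemma flip_flips : exists2 N, N <= n * n &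
   flips N (rev (iota 1 n.-1)) (chain_from_to n w (rev (iota 1 n.-1)))
     (iota 1 n.-1) (chain_from_to n w (iota 1 n.-1)).
Proof.
case: (ltnP 1 n) => n2; last first.
  have -> : n = 1 by move: n2 n1; clia.
  by exists 0 => //; apply: flips0.
have [N le F] := flips_all (leqnn 1) n2.
exists N; first by move: le; rewrite mulnBl; clia.
have Eg : gamma 1 (rev (iota 2 (n.-1 - 1))) [::] = rev (iota 1 n.-1).
  by case: n n2 => [|[|m]] // _; rewrite /gamma /= subn1 /= rev_cons -cats1.
rewrite Eg in F; apply: (flips_eq _ (fun C => iff_refl _) F) => C.
rewrite /Sg Eg; split=> [[] //|H]; split=> //.
by move=> p q p1; rewrite ltnNge p1.
Qed.

Lemma flip_iter N C C' : N <= n * n ->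
  iter N flip_step (rev (iota 1 n.-1), C) = (iota 1 n.-1, C') -> flip n C = C'.
Proof.
move=> le E; rewrite /flip -(subnK le) iterD E.
have -> m : iter m flip_step (iota 1 n.-1, C') = (iota 1 n.-1, C').
  by elim: m => //= m ->; apply: flip_step_fix.
by [].
Qed.

Lemma zip_keys (s t t' : seq nat) : uniq s -> size t = size s -> size t' = size s ->
  perm_eq (zip s t) (zip s t') -> t = t'.
Proof.
move=> U S S' P; apply: (@eq_from_nth _ 0); first by rewrite S S'.
move=> j; rewrite S => lt.
have Z r : size r = size s -> size (zip s r) = size s by move=> E; rewrite size_zip E minnn.
have : nth (0, 0) (zip s t) j \in zip s t' by rewrite -(perm_mem P) mem_nth // Z.
case/(nthP (0, 0)) => j'; rewrite Z // => lt'; rewrite !nth_zip // => -[E1 <-].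
by move/eqP: E1; rewrite nth_uniq // => /eqP ->.
Qed.

Theorem flip_bijection :
  [/\ (forall C, chain_from_to n w (rev (iota 1 n.-1)) C ->
                 chain_from_to n w (iota 1 n.-1) (flip n C)),
      (forall C C', chain_from_to n w (rev (iota 1 n.-1)) C ->
                    chain_from_to n w (rev (iota 1 n.-1)) C' ->
                    flip n C = flip n C' -> C = C'),
      (forall C', chain_from_to n w (iota 1 n.-1) C' ->
                  exists C, chain_from_to n w (rev (iota 1 n.-1)) C /\
                            flip n C = C') &
      (forall C, chain_from_to n w (rev (iota 1 n.-1)) C ->
                 wt (flip n C) = rev (wt C))].
Proof.
have [N le [F1 F2 F3]] := flip_flips; split.
- by move=> C /F1 [C' [E H _]]; rewrite (flip_iter le E).
- move=> C D HC HD E; apply: F2 => //.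
  have [C' [E1 _ _]] := F1 _ HC; have [D' [E2 _ _]] := F1 _ HD.
  by rewrite E1 E2 -(flip_iter le E1) -(flip_iter le E2) E.
- by move=> C' /F3 [C HC E]; exists C; rewrite (flip_iter le E).
- move=> C HC; have [C' [E H W]] := F1 _ HC; rewrite (flip_iter le E).
  have [[S _] _ _] := HC; have [[S' _] _ _] := H.
  rewrite size_rev size_iota in S; rewrite size_iota in S'.
  apply: (@zip_keys (iota 1 n.-1)); rewrite ?iota_uniq ?size_rev ?size_wt ?S ?S' ?size_iota //.
  rewrite perm_sym; apply: perm_trans W.
  (* Reversing labels and weights together only permutes the pairs. *)
  rewrite -[X in perm_eq (zip X _)]revK -rev_zip ?size_rev ?size_wt ?size_iota ?S //.
  by rewrite perm_rev.
Qed.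
End Bij.

(** * Pipe dreams *)

(* The pipe entering a row from below at column c exits it at column [exc rw c];
   the one entering from the left exits at [nxt rw 1], the first bump. *)
Definition crs (rw : seq bool) c := nth false rw c.-1.
Definition nxt (rw : seq bool) c := c + find negb (drop c.-1 rw).
Definition exc (rw : seq bool) c := if crs rw c then c else nxt rw c.+1.
Definition rowact rw (u : seq nat) := nxt rw 1 :: [seq exc rw x | x <- u].
(** An inversion of [u] is a pair of pipes that have crossed below the row; the row must not reverse
    their order again. *)
Definition nocross rw (u : seq nat) := forall i j, 1 <= i -> i < j -> j <= size u ->
  pat u j < pat u i -> exc rw (pat u j) < exc rw (pat u i).

Lemma pat_cons x (u : seq nat) p : pat (x :: u) p.+1 = if p is q.+1 then pat u p else x.
Proof. by case: p. Qed.

Lemma pat_consS x (u : seq nat) p : 1 <= p -> pat (x :: u) p.+1 = pat u p.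
Proof. by case: p. Qed.

Lemma pat_map (f : nat -> nat) u p : 1 <= p <= size u -> pat (map f u) p = f (pat u p).
Proof. by case: p => // p lt; rewrite /pat /= (nth_map 0). Qed.

Lemma nxt_ge rw c : c <= nxt rw c.
Proof. exact: leq_addr. Qed.

Lemma nxt_bump rw c : 1 <= c -> ~~ crs rw (nxt rw c).
Proof.
case: c => // c _; rewrite /crs /nxt /= -nth_drop.
case: (boolP (has negb (drop c rw))) => [H|H]; first exact: (nth_find false H).
by rewrite (hasNfind H) nth_default.
Qed.

Lemma nxt_crs rw c x : 1 <= c -> c <= x -> x < nxt rw c -> crs rw x.
Proof.
case: c => // c _ cx; rewrite /crs /nxt /= => lt.
have -> : x.-1 = c + (x.-1 - c) by move: cx; clia.
rewrite -nth_drop; apply/negbNE/negbT.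
by rewrite (before_find false) //; move: lt cx; clia.
Qed.

Lemma nxt_uniq rw c d : 1 <= c -> c <= d -> ~~ crs rw d ->
  (forall x, c <= x -> x < d -> crs rw x) -> nxt rw c = d.
Proof.
move=> c1 cd nd H; have [lt|gt|//] := ltngtP (nxt rw c) d.
  by have := H _ (nxt_ge rw c) lt; rewrite (negbTE (nxt_bump rw c1)).
by have := nxt_crs c1 cd gt; rewrite (negbTE nd).
Qed.

Lemma nxt_le rw c : 1 <= c <= (size rw).+1 -> nxt rw c <= (size rw).+1.
Proof.
case: c => // c /= le; rewrite /nxt /=.
have := find_size negb (drop c rw); rewrite size_drop; move: le; clia.
Qed.

Lemma nxt_of_crs rw c : 1 <= c -> crs rw c -> nxt rw c = nxt rw c.+1.
Proof.
move=> c1 cc; apply: nxt_uniq => //; first by apply: ltnW; exact: nxt_ge.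
  exact: nxt_bump.
move=> x cx xd; move: cx; rewrite leq_eqVlt => /orP[/eqP <- //|lt].
by apply: nxt_crs xd.
Qed.

Lemma nxt_of_bump rw c : 1 <= c -> ~~ crs rw c -> nxt rw c = c.
Proof. by move=> c1 cc; apply: nxt_uniq => // x a b; move: (leq_trans b a); rewrite ltnn. Qed.

Lemma exc_ge rw c : c <= exc rw c.
Proof. by rewrite /exc; case: ifP => // _; apply: ltnW; apply: nxt_ge. Qed.

Lemma exc_bump rw c : ~~ crs rw c -> exc rw c = nxt rw c.+1.
Proof. by rewrite /exc => /negbTE ->. Qed.

Lemma exc_crs rw c : crs rw c -> exc rw c = c.
Proof. by rewrite /exc => ->. Qed.

Lemma exc_crsE rw c : crs rw c = (exc rw c == c).
Proof.
rewrite /exc; case: ifP => [_|_]; first by rewrite eqxx.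
by rewrite gtn_eqF // nxt_ge.
Qed.

Lemma dom1 n u : dom n 1 u.
Proof. by move=> p q p1; rewrite ltnNge p1. Qed.

(** * A row of a pipe dream as an increasing 1-chain *)

Section Row.
Variables (m : nat) (u' : seq nat).
Hypothesis Hu' : is_perm m u'.

Let Su' : size u' = m. Proof. exact: is_perm_size Hu'. Qed.

Lemma top_perm : is_perm m.+1 (m.+1 :: u').
Proof.
rewrite /is_perm iota_rcons add1n perm_sym perm_rcons perm_cons perm_sym.
exact: Hu'.
Qed.

(* The row acts by one step for each bump, so [partrow rw 0], ...,
   [partrow rw m] interpolate between [rowact rw u'] and [m.+1 :: u']. *)
Definition partrow rw c := nxt rw c.+1 :: [seq (if c < x then exc rw x else x) | x <- u'].

(** At the bump the pipe running along the row is exchanged with pipe [q], which arrives at column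
    [c]. An entry obstructing the cover would belong to a pipe before [q] that goes straight up
    through a cross, and pipe [q] would cross it a second time. *)
Lemma partrow_bump rw c : size rw = m -> nocross rw u' -> 1 <= c <= m -> ~~ crs rw c ->
  is_perm m.+1 (partrow rw c) -> 
  is_perm m.+1 (partrow rw c.-1) /\ kcover 1 (partrow rw c.-1) (partrow rw c).
Proof.
move=> Srw NC Hc bc Hy.
have [q Hq Eq] := perm_surj Hu' Hc.
have c1 : 1 <= c by case/andP: Hc.
have Sy c' : size (partrow rw c') = m.+1 by rewrite /= size_map Su'.
have P1 c' : pat (partrow rw c') 1 = nxt rw c'.+1 by [].
have PS c' p : 1 <= p <= m -> pat (partrow rw c') p.+1 = if c' < pat u' p then exc rw (pat u' p) else pat u' p.
  by move=> Hp; rewrite pat_consS ?pat_map ?Su' //; case/andP: Hp.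
have Esw : partrow rw c.-1 = swap (partrow rw c) 1 q.+1.
  apply: (@eq_pat m.+1); rewrite ?size_swap ?Sy // => p Hp.
  rewrite pat_swap ?Sy //; case: p Hp => // p Hp.
  rewrite eqSS; case: (posnP p) => [->|p0].
    rewrite P1 prednK // nxt_of_bump // PS // Eq ltnn //.
  have Hp' : 1 <= p <= m by move: p0 Hp; clia.
  rewrite eqSS P1 !PS //.
  case: (eqVneq p q) => [->|pq].
    by rewrite Eq ltn_predL c1 exc_bump.
  have nc : pat u' p != c by rewrite -Eq; apply: (pat_neq Hu').
  by have -> : (c.-1 < pat u' p) = (c < pat u' p) by move: nc c1; clia.
have Hq1 : 1 <= q.+1 <= m.+1 by move: Hq; clia.
have Hz : is_perm m.+1 (partrow rw c.-1) by rewrite Esw; apply: swap_perm.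
split=> //; apply/(kcoverP _ _ Hz); exists 1, q.+1; split; last by move: Hq; clia.
have Eq' : pat (partrow rw c.-1) q.+1 = nxt rw c.+1.
  by rewrite PS // Eq ltn_predL c1 exc_bump.
have E1 : pat (partrow rw c.-1) 1 = c by rewrite P1 prednK // nxt_of_bump.
have -> : partrow rw c = swap (partrow rw c.-1) 1 q.+1.
  by rewrite Esw (@swapK m.+1) ?Sy.
apply: tstepI => //.
split; [by move: Hq; clia|by rewrite E1 Eq'; apply: nxt_ge|].
rewrite E1 Eq' => -[//|p] Hp.
have Hp' : 1 <= p <= m by move: Hp Hq; clia.
rewrite PS //; apply/negP; case: ifP => [lt|ge]; last by move: ge; clia.
case/andP=> l1 l2.
have ltc : c < pat u' p.
  have nc : pat u' p != c by rewrite -Eq; apply: (pat_neq Hu') => //; move: Hp; clia.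
  by move: nc lt; clia.
have l3 : pat u' p < nxt rw c.+1 := leq_ltn_trans (exc_ge _ _) l2.
have cp : crs rw (pat u' p) by apply: nxt_crs l3.
have := NC p q; rewrite Eq exc_bump // (exc_crs cp) Su' => H.
have : nxt rw c.+1 < pat u' p by apply: H => //; move: Hp Hq; clia.
by move: l3; clia.
Qed.

Lemma partrow_crs rw c : 1 <= c -> crs rw c -> partrow rw c.-1 = partrow rw c.
Proof.
move=> c1 cc; rewrite /partrow prednK // nxt_of_crs //; congr cons.
apply: eq_map => x; have [->|ne] := eqVneq x c.
  by rewrite exc_crs // !if_same.
by have -> : (c <= x) = (c < x) by move: ne; clia.
Qed.

Lemma partrow_path rw c : size rw = m -> nocross rw u' -> c <= m ->
  is_perm m.+1 (partrow rw c) /\ 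
  exists2 cs, path (kcover 1) (partrow rw c) cs & last (partrow rw c) cs = m.+1 :: u'.
Proof.
move=> Srw NC cm; rewrite -(subKn cm).
have : m - c <= m by apply: leq_subr.
elim: (m - c) => [|d IH] dm.
  have -> : partrow rw (m - 0) = m.+1 :: u'.
    rewrite subn0 /partrow; congr cons.
      by apply: nxt_uniq => //; [rewrite /crs nth_default // Srw|move=> x a b; move: (leq_trans b a); rewrite ltnn].
    rewrite -[RHS]map_id; apply/eq_in_map => x; rewrite (is_perm_mem _ Hu') => /andP[_ le].
    by rewrite ltnNge le.
  by split; [exact: top_perm|exists [::]].
have [|Hy [cs P L]] := IH; first exact: ltnW.
have E : m - d.+1 = (m - d).-1 by rewrite subnS.
have Hd : 1 <= m - d <= m by move: dm; clia.
rewrite E; case: (boolP (crs rw (m - d))) => [cc|bc].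
  by rewrite partrow_crs //; [split=> //; exists cs|case/andP: Hd].
have [Hz K] := partrow_bump Srw NC Hd bc Hy.
by split=> //; exists (partrow rw (m - d) :: cs) => //=; rewrite K P.
Qed.

Lemma partrow0 rw : partrow rw 0 = rowact rw u'.
Proof.
congr cons; apply/eq_in_map => x; rewrite (is_perm_mem _ Hu') => /andP[-> //].
Qed.

Lemma rowact_perm rw : size rw = m -> nocross rw u' -> is_perm m.+1 (rowact rw u').
Proof. by move=> S N; rewrite -partrow0; have [] := partrow_path S N (leq0n m). Qed.

Lemma rowact_chain rw : size rw = m -> nocross rw u' ->
  has_inc_chain 1 (rowact rw u') (m.+1 :: u').
Proof.
move=> S N; rewrite -partrow0; have [H [cs P L]] := partrow_path S N (leq0n m).
apply/has_incP; exists cs => //; apply: (path_dom_incc H _ P); exact: dom1.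
Qed.

Lemma chain_row u : is_perm m.+1 u -> has_inc_chain 1 u (m.+1 :: u') ->
  exists rw, [/\ size rw = m, u = rowact rw u' & nocross rw u'].
Proof.
move=> + /has_incP[cs /andP[P _]]; elim: cs u P => [|v cs IH] u /=.
  move=> _ _ ->; exists (nseq m true).
  have C x : 1 <= x <= m -> crs (nseq m true) x.
    by case: x => // x /andP[_ xm]; rewrite /crs nth_nseq xm.
  split; first by rewrite size_nseq.
  - rewrite /rowact; congr cons.
      symmetry; apply: nxt_uniq => //; first by rewrite /crs nth_default ?size_nseq.
      by move=> x x1 xm; apply: C; rewrite x1.
    rewrite -[LHS]map_id; apply/eq_in_map => x; rewrite (is_perm_mem _ Hu') => Hx.
    by rewrite exc_crs // C.
  - move=> i j i1 ij jm lt; have R := @perm_range m u' _ Hu'.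
    by rewrite !exc_crs //; apply: C; apply: R; move: i1 ij jm; rewrite Su'; clia.
case/andP=> K P Hu L; have Hv := kcover_perm Hu K.
have [rw [Srw Ev NC]] := IH v P Hv L.
have [a [b [T ab]]] := (proj1 (kcoverP _ _ Hu) K).
have [a1 ab1 F Ea Eb] := tstep_vals T.
have Ea1 : a = 1 by move: a1 ab; clia.
subst a; set c := pat u 1 in F Eb *; set d := pat u b in F Ea *.
have Ed : nxt rw 1 = d by rewrite -Ea Ev.
have c1 : 1 <= c by have := @perm_range _ u 1 Hu; rewrite -/c; move: ab1; clia.
have dm : d <= m.+1 by have := @perm_range _ u b Hu; rewrite -/d; move: ab1; clia.
have cc : crs rw c by apply: (@nxt_crs _ 1) => //; rewrite Ed.
(* The first entry of [u] is [c], so the pipe from the left now has to leave at column [c]: the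
   cross there becomes a bump, and nothing else changes. *)
pose rw' := set_nth false rw c.-1 false.
have Srw' : size rw' = m.
  by rewrite size_set_nth Srw; apply/maxn_idPr; move: c1 F dm; clia.
have C' x : 1 <= x -> crs rw' x = (x != c) && crs rw x.
  move=> x1; rewrite /crs nth_set_nth /=.
  have -> : (x.-1 == c.-1) = (x == c) by move: x1 c1; clia.
  by case: eqP.
have N1 : nxt rw' 1 = c.
  apply: nxt_uniq => //; first by rewrite C' // eqxx.
  by move=> x x1 xc; rewrite C' // neq_ltn xc /=; apply: (@nxt_crs _ 1) => //; rewrite Ed; apply: ltn_trans F.
have Nc : nxt rw' c.+1 = d.
  apply: nxt_uniq => //.
    by rewrite C'; [rewrite -Ed (negbTE (nxt_bump _ _)) // andbF|move: F; clia].
  move=> x cx xd; rewrite C'; last by move: cx; clia.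
  rewrite (gtn_eqF cx) /=; apply: (@nxt_crs _ 1); rewrite ?Ed //; move: cx; clia.
have Xc : exc rw' c = d by rewrite exc_bump // C' // eqxx.
have Xo x : 1 <= x -> x != c -> exc rw' x = exc rw x.
  move=> x1 xc; rewrite /exc C' // xc /=; case: ifP => // bx.
  have dx : d <= x.
    by rewrite leqNgt; apply/negP => xd; rewrite (@nxt_crs _ 1) // Ed in bx.
  apply: nxt_uniq => //; first exact: nxt_ge.
    by rewrite C' ?(negbTE (nxt_bump _ _)) ?andbF //; apply: leq_trans (nxt_ge _ _).
  move=> y xy yn; have := nxt_crs (isT : 1 <= x.+1) xy yn.
  rewrite C'; last by move: xy; clia.
  by rewrite andbC andb_idr // => _; move: F dx xy; clia.
have low x : 1 <= x -> x < d -> exc rw x = x.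
  by move=> x1 xd; rewrite exc_crs // (@nxt_crs _ 1) // Ed.
have PS p : 1 <= p <= m -> pat v p.+1 = exc rw (pat u' p).
  by move=> Hp; rewrite Ev pat_consS ?pat_map ?Su' //; case/andP: Hp.
have Hb : 1 <= b.-1 <= m by move: ab1; clia.
have Eb' : b = b.-1.+1 by move: ab1; clia.
have Ec : pat u' b.-1 = c.
  have := PS _ Hb; rewrite -Eb' Eb => E.
  have [R1 _] := andP (perm_range Hu' Hb).
  have lt : pat u' b.-1 < d by apply: leq_ltn_trans F; rewrite E exc_ge.
  by move: E; rewrite low.
exists rw'; split=> //.
- apply: (@eq_pat m.+1); rewrite ?(is_perm_size Hu) //= ?size_map ?Su' // => -[//|p] Hp.
  rewrite pat_cons; case: p Hp => [|p] Hp; first by rewrite N1.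
  rewrite pat_map ?Su' //.
  have Hp1 : 1 <= p.+1 <= m by [].
  case: (eqVneq p.+1 b.-1) => [->|ne].
    by rewrite -Eb' Ec Xc.
  have [R1 _] := andP (perm_range Hu' Hp1).
  rewrite Xo //; last by rewrite -Ec; apply: (pat_neq Hu').
  rewrite -PS //; symmetry; apply: (tstep_out T) => //.
  by apply: contra ne => /eqP <-.
- move=> i j i1 ij jm; rewrite Su' in jm.
  have Hi : 1 <= i <= m by move: i1 ij jm; clia.
  have Hj : 1 <= j <= m by move: i1 ij jm; clia.
  have [Ri _] := andP (perm_range Hu' Hi); have [Rj _] := andP (perm_range Hu' Hj).
  have nij : pat u' i != pat u' j by apply: (pat_neq Hu') => //; move: ij; clia.
  move=> lt; case: (eqVneq (pat u' j) c) => [Ej|nj].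
    rewrite Ej Xc Xo //; last by rewrite -Ej.
    have Ejb : j = b.-1 by apply: (perm_inj Hu') => //; rewrite Ej Ec.
    have [xd|xd|xd] := ltngtP (pat u' i) d.
    (* Pipe [i] goes straight up between columns [c] and [d], so its entry obstructs the first step
       of the chain. *)
    + exfalso; have Ei : pat u i.+1 = pat u' i.
        have ne1 : i.+1 != 1 by move: i1; clia.
        have ne2 : i.+1 != b by move: ij Ejb ab1; clia.
        by rewrite -(tstep_out T _ ne1 ne2) // PS // low.
      apply: (tstep_no (x := i.+1) T); rewrite ?Ei //.
        by move: ij Ejb ab1; clia.
      by rewrite -/c -Ej.
    + by apply: leq_trans xd (exc_ge _ _).
    + rewrite xd exc_bump; first exact: nxt_ge.
      by rewrite -Ed nxt_bump.
  case: (eqVneq (pat u' i) c) => [Ei|ni].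
    rewrite Ei Xc Xo //; rewrite Ei in lt.
    by rewrite low // (ltn_trans lt F).
  by rewrite !Xo //; apply: NC; rewrite ?Su'.
Qed.

(** A column is a cross exactly if [exc] fixes it, and every column is an entry of [u']. *)
Lemma rowact_inj rw1 rw2 : size rw1 = m -> size rw2 = m ->
  rowact rw1 u' = rowact rw2 u' -> rw1 = rw2.
Proof.
move=> S1 S2 [_ E]; apply: (@eq_from_nth _ false); rewrite ?S1 ?S2 // => c cm.
rewrite -[LHS]/(crs rw1 c.+1) -[RHS]/(crs rw2 c.+1) !exc_crsE.
have [|p Hp <-] := @perm_surj m u' c.+1 Hu'; first by [].
by have := congr1 (fun s => pat s p) E; rewrite !pat_map ?Su' // => ->.
Qed.
End Row.

(** * Prepending the largest value *)

Section Shift.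
Variable m : nat.
Notation top := (cons m.+1).

Lemma tstep_cons a b p q : tstep m a b p q -> tstep m.+1 (top a) (top b) p.+1 q.+1.
Proof.
move=> [Ha Hb /and4P[p1 pq qm F] H [Ep Eq Eo]].
split; [exact: top_perm|exact: top_perm| | |].
- by rewrite /= ltnS pq ltnS qm !pat_consS // (leq_trans p1 (ltnW pq)).
- case=> // x Hx; have Hx' : p < x < q by [].
  rewrite !pat_consS ?(leq_trans p1 (ltnW pq)) //; first exact: H.
  by case/andP: Hx' => px _; apply: leq_trans px.
- have q1 := leq_trans p1 (ltnW pq); rewrite !pat_consS //; split=> //.
  case=> // -[|x] _ //; rewrite !eqSS !pat_consS //; exact: Eo.
Qed.

(** Position 1 holds the maximum, so it cannot be the lower position of a step. *)
Lemma tstep_uncons a y p q : is_perm m a -> tstep m.+1 (top a) y p q ->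
  exists b, [/\ y = top b, tstep m a b p.-1 q.-1, 2 <= p & p.-1 < q.-1].
Proof.
move=> Ha T; have [p1 pq F Ep Eq] := tstep_vals T.
have p2 : 2 <= p.
  rewrite leqNgt; apply/negP => lt; have E : p = 1 by move: lt p1; clia.
  have := @perm_range _ _ q (top_perm Ha); move: F; rewrite E /=; move: pq; clear.
  rewrite [pat _ 1]/pat /=; lia.
have C : covf (pat a) p.-1 q.-1.
  have [_ lt H] := tstep_cov T.
  have Ex x : 1 <= x -> pat (top a) x.+1 = pat a x by apply: pat_consS.
  have Hp : p = p.-1.+1 by move: p2; clia.
  have Hq : q = q.-1.+1 by move: pq; clia.
  have Hp1 : 1 <= p.-1 by move: p2; clia.
  have Hq1 : 1 <= q.-1 by move: p2 pq; clia.
  have Pp : pat (top a) p = pat a p.-1 by rewrite {1}Hp Ex.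
  have Pq : pat (top a) q = pat a q.-1 by rewrite {1}Hq Ex.
  rewrite Pp Pq in lt.
  split=> //; first by move: p2 pq; clia.
  move=> x Hx; have := H x.+1; rewrite Pp Pq !Ex //.
    by apply; move: Hx p2 pq; clia.
  by move: Hx; clia.
have T2 : tstep m a (swap a p.-1 q.-1) p.-1 q.-1.
  by apply: tstepI => //; move: p2 pq; clia.
exists (swap a p.-1 q.-1); split=> //; last by move: p2 pq; clia.
have := tstep_cons T2; rewrite !prednK; [|by move: pq; clia|exact: ltnW].
by move=> T3; rewrite (tstep_swap T3) -(tstep_swap T).
Qed.

Lemma kcover_cons k a b : is_perm m a -> kcover k a b -> 
  kcover k.+1 (top a) (top b) /\ swapmin (top a) (top b) = swapmin a b.
Proof.
move=> Ha /(kcoverP _ _ Ha) [p [q [T K]]]; have T2 := tstep_cons T.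
rewrite (tstep_kcover _ T2) !ltnS K (tstep_swapmin T) (tstep_swapmin T2) pat_consS //.
by have [] := tstep_vals T.
Qed.

Lemma kcover_uncons k a y : is_perm m a -> kcover k.+1 (top a) y ->
  exists2 b, y = top b & kcover k a b.
Proof.
move=> Ha /(kcoverP _ _ (top_perm Ha)) [p [q [T K]]].
have [b [-> T2 p2 pq]] := tstep_uncons Ha T; exists b => //.
by rewrite (tstep_kcover k T2); move: K p2 pq; clia.
Qed.

Lemma incc_lift k a cs : is_perm m a -> path (kcover k) a cs ->
  path (kcover k.+1) (top a) (map top cs) /\
  pairmap swapmin (top a) (map top cs) = pairmap swapmin a cs.
Proof.
elim: cs a => //= b cs IH a Ha /andP[K P].
have [K2 ->] := kcover_cons Ha K.
by have [-> ->] := IH b (kcover_perm Ha K) P; rewrite K2.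
Qed.

Lemma path_unlift k a cs : is_perm m a -> path (kcover k.+1) (top a) cs ->
  exists2 cs', cs = map top cs' & path (kcover k) a cs'.
Proof.
elim: cs a => [|y cs IH] a Ha /=; first by exists [::].
case/andP=> /(kcover_uncons Ha) [b -> K] /IH [|cs' -> P]; first exact: kcover_perm K.
by exists (b :: cs') => //=; rewrite K P.
Qed.

Lemma has_inc_cons k a b : is_perm m a ->
  has_inc_chain k.+1 (top a) (top b) <-> has_inc_chain k a b.
Proof.
move=> Ha; split=> /has_incP [cs /andP[P S] L].
- have [cs' Ecs P'] := path_unlift Ha P; subst cs.
  have [_ E] := incc_lift Ha P'; rewrite E in S.
  apply/has_incP; exists cs'; first by rewrite /incc P' S.
  by move: L; rewrite last_map => -[].
- have [P' E] := incc_lift Ha P; apply/has_incP; exists (map top cs).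
    by rewrite /incc P' E S.
  by rewrite last_map L.
Qed.
End Shift.

Lemma compat_cons k ks u v C : 
  compatible [:: u, v & C] (k :: ks) <-> has_inc_chain k u v /\ compatible (v :: C) ks.
Proof.
split.
- case=> S H; split; first exact: (H 0).
  by split=> [|s lt]; [move: S => /= [->]|apply: (H s.+1)].
- case=> I [S H]; split=> [|[|s] lt] //; first by rewrite /= -S.
  exact: H.
Qed.

Lemma compat_lift m C : all (is_perm m) C ->
  forall l, compatible (map (cons m.+1) C) (map S l) <-> compatible C l.
Proof.
elim: C => [|a C IH] /= A l; first by split=> -[].
case/andP: A => Ha A; case: l => [|k ks]; case: C IH A => [|b C] IH A.
- by split=> -[].
- by split=> -[].
- by split=> -[].
rewrite /= compat_cons compat_cons (has_inc_cons k b Ha).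
by have := IH A ks => /=; tauto.
Qed.

(** Going back over the link labelled [s.+1], dominance at its right end says that position [s.+1]
    holds the maximum from there on, as [incc_dom] requires. The use: all members after the first
    begin with [n], which can be stripped. *)
Lemma chain_dom n w C : is_perm n w -> chain_from_to n w (iota 1 n.-1) C ->
  forall t, t <= n.-1 -> dom n t.+1 (nth [::] C t).
Proof.
move=> Hw [Cc Hh Hl] t tn; rewrite -(subKn tn).
have [Cs Ci] := Cc; rewrite size_iota in Cs Ci.
have := leq_subr t n.-1; elim: (n.-1 - t) => [|d IH] dn.
  have := last_nth_compat Cc; rewrite size_iota subn0 => <-.
  rewrite Hl; exact: w0_dom.
set s := n.-1 - d.+1.
have Es : n.-1 - d = s.+1 by rewrite /s; move: dn; clia.
have sn : s < n.-1 by rewrite /s; move: dn; clia.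
have Ds := IH (ltnW dn); rewrite Es in Ds.
have := Ci _ sn; rewrite nth_iota // add1n => /has_incP [cs I E].
have Hs : is_perm n (nth [::] C s).
  by apply: (compat_perm Hw Cc Hh); rewrite size_iota ltnW.
apply: (incc_dom Hs I) => //; rewrite E.
  by move=> p q p1 ps; apply: Ds => //; exact: ltnW.
by move=> p sp pn; apply: Ds.
Qed.

Lemma dom2_top m a : is_perm m.+1 a -> dom m.+1 2 a -> exists2 b, is_perm m b & a = m.+1 :: b.
Proof.
move=> Ha D; have Sa := is_perm_size Ha.
case: a Ha Sa D => // x b Ha [Sb] D; have [p Hp Ep] := perm_surj Ha (leqnn m.+1 : 1 <= m.+1 <= m.+1).
have Hx : x = m.+1.
  have [E|ne] := eqVneq p 1; first by rewrite -Ep E.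
  have := @perm_range _ _ 1 Ha; have := D 1 p; rewrite Ep [pat _ 1]/pat /=.
  by move: Hp ne; clia.
exists b; last by rewrite Hx.
move: Ha; rewrite /is_perm iota_rcons add1n Hx perm_sym perm_rcons perm_cons.
by rewrite perm_sym.
Qed.

(* The fuel-free form of [pd_trace]: a pipe turns right exactly when it enters
   a cross from the left or a bump from below. *)
Inductive pdrun P : nat -> nat -> bool -> seq (nat * nat) -> nat -> Prop :=
| PdStop c : pdrun P 0 c false [::] c
| PdRight r c fl l e : pd_cross P r.+1 c = fl -> pdrun P r.+1 c.+1 true l e ->
    pdrun P r.+1 c fl ((r.+1, c) :: l) e
| PdUp r c fl l e : pd_cross P r.+1 c = ~~ fl -> pdrun P r c false l e ->
    pdrun P r.+1 c fl ((r.+1, c) :: l) e.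

Lemma pdrun_trace P r c fl l e : pdrun P r c fl l e ->
  forall f, size l < f -> pd_trace P f r c fl = (l, e).
Proof.
elim=> {r c fl l e} [c|r c fl l e E _ IH|r c fl l e E _ IH] [|f] //= lf.
- by rewrite E; case: fl E => E; rewrite IH.
- by rewrite E; case: fl E => E; rewrite IH.
Qed.

Arguments pd_pipe : simpl never.
Arguments pd_trace : simpl never.

Lemma pdrun_size P r c fl l e : pdrun P r c fl l e -> c <= e /\ size l = r + (e - c).
Proof.
elim=> {r c fl l e} [c|r c fl l e E _ [IH1 IH2]|r c fl l e E _ [IH1 IH2]] /=.
- by rewrite subnn.
- by rewrite IH2; split; [exact: ltnW|move: IH1; clia].
- by rewrite IH2.
Qed.

Lemma pdrun_row P r c fl l e x : pdrun P r c fl l e -> x \in l -> 1 <= x.1.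
Proof.
elim=> {r c fl l e} [c|r c fl l e E _ IH|r c fl l e E _ IH] //=;
by rewrite inE => /orP[/eqP -> //|/IH].
Qed.

(** * Adding a top row: pipes and crossings *)

Definition below (x : nat * nat) := (x.1.+1, x.2).
Definition topcells c e := [seq (1, x) | x <- iota c (e - c).+1].

Lemma pdrun_below rw P r c fl l e l2 e2 : pdrun P r c fl l e ->
  pdrun (rw :: P) 1 e false l2 e2 -> pdrun (rw :: P) r.+1 c fl (map below l ++ l2) e2.
Proof.
move=> R R2; elim: R R2 => {r c fl l e} [c|r c fl l e E _ IH|r c fl l e E _ IH] //= R2.
- exact/PdRight/IH.
- exact/PdUp/IH.
Qed.

Lemma pdrun_left rw P c : 1 <= c ->
  pdrun (rw :: P) 1 c true (topcells c (nxt rw c)) (nxt rw c).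
Proof.
move=> c1; have [d Ed] : exists d, d = nxt rw c - c by eexists.
elim: d c c1 Ed => [|d IH] c c1 Ed.
  have E : nxt rw c = c by have := nxt_ge rw c; move: Ed; clia.
  have := nxt_bump rw c1; rewrite /topcells E subnn /= => b.
  by apply: PdUp (PdStop _ _); apply: negbTE.
have lt : c < nxt rw c by move: Ed; clia.
have cc : crs rw c by apply: nxt_crs lt.
rewrite /topcells -Ed /=; apply: PdRight => //.
have := IH c.+1 isT; rewrite -(nxt_of_crs c1 cc) /topcells => {}IH.
have E : nxt rw c - c.+1 = d by move: Ed; clia.
by rewrite E in IH; apply: IH.
Qed.

Lemma pdrun_bottom rw P c : 1 <= c ->
  pdrun (rw :: P) 1 c false (topcells c (exc rw c)) (exc rw c).
Proof.
move=> c1; case: (boolP (crs rw c)) => cc.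
  by rewrite exc_crs // /topcells subnn /=; apply: PdUp (PdStop _ _).
rewrite exc_bump // /topcells.
have -> : nxt rw c.+1 - c = (nxt rw c.+1 - c.+1).+1 by have := nxt_ge rw c.+1; clia.
by apply: PdRight; [apply: negbTE|apply: pdrun_left].
Qed.

Lemma pd_shape_cons m rw P : pd_shape m.+1 (rw :: P) <-> size rw = m /\ pd_shape m P.
Proof.
split.
- case=> -[S] H; split; first by have := H 0 isT; rewrite /= subSS subn0.
  by split=> // r rm; have := H r.+1 rm.
- by case=> Sr [S H]; split=> [|[|r] rm] /=; rewrite ?S ?subSS ?subn0 //; apply: H.
Qed.

Lemma pd_shape_pos m P : pd_shape m.+1 P -> exists rw P', P = rw :: P'.
Proof. by case=> + _; case: P => // rw P _; exists rw, P. Qed.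

Lemma exc_le rw c : 1 <= c <= size rw -> exc rw c <= (size rw).+1.
Proof.
move=> Hc; rewrite /exc; case: ifP => _; first by move: Hc; clia.
by apply: nxt_le; move: Hc; clia.
Qed.

Lemma pd_run m P i : pd_shape m P -> 1 <= i <= m ->
  exists l e, pdrun P i 1 true l e /\ 1 <= e <= m.
Proof.
elim: m P i => [|m IH] P i; first by case: i.
move=> S; have [rw [P' E]] := pd_shape_pos S; subst P.
have [Sr S'] := (proj1 (pd_shape_cons _ _ _) S).
case: i => [|[|i]] // Hi.
  exists (topcells 1 (nxt rw 1)), (nxt rw 1); split; first exact: pdrun_left.
  by rewrite nxt_ge -Sr nxt_le.
have [l [e [R He]]] := IH P' i.+1 S' Hi.
have e1 : 1 <= e by case/andP: He.
exists (map below l ++ topcells e (exc rw e)), (exc rw e); split.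
  by apply: pdrun_below R _; apply: pdrun_bottom.
by rewrite (leq_trans e1 (exc_ge _ _)) -Sr exc_le // Sr.
Qed.

Lemma pd_run_pipe m P i l e : i <= m -> e <= m -> pdrun P i 1 true l e -> pd_pipe m P i = (l, e).
Proof.
move=> im em R; apply: (pdrun_trace R); have [e1 ->] := pdrun_size R.
by move: im em; clia.
Qed.

Section Cons.
Variables (m : nat) (rw : seq bool) (P : seq (seq bool)).
Hypothesis S : pd_shape m.+1 (rw :: P).
Let Sr : size rw = m. Proof. by case: (proj1 (pd_shape_cons _ _ _) S). Qed.
Let SP : pd_shape m P. Proof. by case: (proj1 (pd_shape_cons _ _ _) S). Qed.

Lemma pipe_first : pd_pipe m.+1 (rw :: P) 1 = (topcells 1 (nxt rw 1), nxt rw 1).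
Proof. by apply: pd_run_pipe => //; [rewrite -Sr nxt_le|apply: pdrun_left]. Qed.

Lemma pipe_next i : 1 <= i <= m -> let: (l, e) := pd_pipe m P i in
  [/\ pdrun P i 1 true l e, 1 <= e <= m &
   pd_pipe m.+1 (rw :: P) i.+1 = (map below l ++ topcells e (exc rw e), exc rw e)].
Proof.
move=> Hi; have [l [e [R He]]] := pd_run SP Hi; have [i1 im] := andP Hi; have [e1 em] := andP He.
rewrite (pd_run_pipe im em R); split=> //.
by apply: pd_run_pipe; rewrite ?ltnS -?Sr ?exc_le ?Sr //; apply: pdrun_below R _; apply: pdrun_bottom.
Qed.

Lemma pd_perm_cons : pd_perm m.+1 (rw :: P) = rowact rw (pd_perm m P).
Proof.
rewrite /pd_perm -[iota 1 m.+1]/(1 :: iota (1 + 1) m) map_cons pipe_first; congr cons.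
rewrite iotaDl -!map_comp; apply/eq_in_map => i.
rewrite mem_iota add1n ltnS => Hi; have := pipe_next Hi.
rewrite -[LHS]/(pd_pipe m.+1 (rw :: P) i.+1).2 -[RHS]/(exc rw (pd_pipe m P i).2).
by case: (pd_pipe m P i) => l e [_ _ ->].
Qed.

Lemma pat_pd_perm k Q i : 1 <= i <= k -> pat (pd_perm k Q) i = (pd_pipe k Q i).2.
Proof.
case: i => // i Hi; rewrite /pat /pd_perm /= (nth_map 0) ?size_iota //.
by rewrite nth_iota // add1n.
Qed.

Lemma count_one (p : pred nat) s k x : (forall y, p y -> y = x) ->
  count p (iota s k) = (s <= x < s + k) && p x.
Proof.
move=> H; case: (boolP (p x)) => px; last first.
  rewrite andbF; transitivity (count pred0 (iota s k)); last exact: count_pred0.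
  apply: eq_count => y /=.
  by apply/negbTE/negP => py; move: px; rewrite -(H y py) py.
rewrite andbT -mem_iota -(count_uniq_mem _ (iota_uniq _ _)).
by apply: eq_count => y /=; apply/idP/eqP => [/H|->].
Qed.

Definition cnt k Q i j := count (fun x => (x \in (pd_pipe k Q j).1) && pd_cross Q x.1 x.2) (pd_pipe k Q i).1.

(** The contribution of the top row to [cnt], for pipes occupying the columns [s] to [e] and [c] to
    [exc rw c] of it. *)
Definition topcnt s e c := count (fun y => (c <= y <= exc rw c) && crs rw y) (iota s (e - s).+1).

Lemma mem_topcells c e y : c <= e -> ((1, y) \in topcells c e) = (c <= y <= e).
Proof.
move=> ce; rewrite mem_map; last by move=> ? ? [].
by rewrite mem_iota; move: ce; clia.
Qed.

Lemma count_top s e j : 1 <= j <= m ->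
  count (fun x => (x \in (pd_pipe m.+1 (rw :: P) j.+1).1) && pd_cross (rw :: P) x.1 x.2) (topcells s e)
  = topcnt s e (pd_pipe m P j).2.
Proof.
move=> Hj; rewrite [topcells s e]/topcells count_map /topcnt; apply: eq_count => y.
have := pipe_next Hj; case: (pd_pipe m P j) => l c [R Hc ->] /=.
rewrite mem_cat mem_topcells ?exc_ge //; congr (_ && _).
rewrite (_ : (1, y) \in map below l = false) //.
by apply/negbTE/mapP => -[x /(pdrun_row R)]; case: x => [[|a] b].
Qed.

Lemma cnt_first j : 1 <= j <= m ->
  cnt m.+1 (rw :: P) 1 j.+1 = topcnt 1 (nxt rw 1) (pat (pd_perm m P) j).
Proof. by move=> Hj; rewrite /cnt pipe_first count_top // pat_pd_perm. Qed.

Lemma cnt_next i j : 1 <= i <= m -> 1 <= j <= m ->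
  cnt m.+1 (rw :: P) i.+1 j.+1 = cnt m P i j +
   topcnt (pat (pd_perm m P) i) (exc rw (pat (pd_perm m P) i)) (pat (pd_perm m P) j).
Proof.
move=> Hi Hj; rewrite {1}/cnt; have := pipe_next Hi; rewrite !pat_pd_perm //.
case E : (pd_pipe m P i) => [l c] [R Hc ->].
rewrite count_cat count_top //; congr (_ + _).
rewrite /cnt E count_map; have := pipe_next Hj; case: (pd_pipe m P j) => l' c' [R' Hc' ->].
apply: eq_in_count => x xl /=.
rewrite mem_cat mem_map; last by move=> [? ?] [? ?] [-> ->].
rewrite [_ \in topcells _ _](_ : _ = false) ?orbF; last first.
  by apply/negbTE/mapP => -[y _ [E1]]; have := pdrun_row R xl; rewrite E1.
by case: x xl => [[|a] b] xl; first by have := pdrun_row R xl.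
Qed.

Lemma topcnt_first c : 1 <= c -> topcnt 1 (nxt rw 1) c = (exc rw c < nxt rw 1).
Proof.
move=> c1; have n1 := nxt_ge rw 1.
case: (ltngtP c (nxt rw 1)) => lt.
- have cc : crs rw c by apply: (@nxt_crs _ 1).
  rewrite exc_crs // lt /topcnt exc_crs // (@count_one _ _ _ c).
    by rewrite cc leqnn; move: c1 lt; clia.
  by move=> y; move: (crs rw y); clia.
- rewrite ltnNge (leq_trans (ltnW lt) (exc_ge _ _)) /topcnt.
  apply/eqP; rewrite eqn0Ngt -has_count; apply/hasPn => y; rewrite mem_iota.
  by move: lt n1; move: (crs rw y); clia.
- have b : ~~ crs rw c by rewrite lt nxt_bump.
  rewrite -lt ltnNge exc_ge /topcnt.
  apply/eqP; rewrite eqn0Ngt -has_count; apply/hasPn => y; rewrite mem_iota => Hy.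
  apply/negP => /andP[Hy2 cy]; have Ey : y = c by move: Hy Hy2 lt n1; clia.
  by rewrite Ey (negbTE b) in cy.
Qed.

Lemma exc_inj c c' : 1 <= c -> c < c' -> exc rw c != exc rw c'.
Proof.
move=> c1 lt; case: (boolP (crs rw c)) => cc.
  by rewrite exc_crs // neq_ltn (leq_trans lt (exc_ge _ _)).
rewrite exc_bump //; case: (boolP (crs rw c')) => cc'.
  rewrite (exc_crs cc'); apply/eqP => E.
  by have := nxt_bump rw (isT : 1 <= c.+1); rewrite E cc'.
rewrite exc_bump // neq_ltn; apply/orP; left; apply: leq_ltn_trans (nxt_ge _ _).
rewrite leqNgt; apply/negP => lt2.
by have := nxt_crs (isT : 1 <= c.+1) lt lt2; rewrite (negbTE cc').
Qed.

(** Two pipes arriving from below share a cross exactly if the row reverses their order: the left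
    one then runs through the column in which the right one goes straight up. Hence only the larger
    of the two columns can carry the common cross. *)
Lemma topcntE c c' : 1 <= c -> 1 <= c' -> c != c' ->
  topcnt c (exc rw c) c' = (c < c') && (exc rw c' < exc rw c) || (c' < c) && (exc rw c < exc rw c').
Proof.
have one a b y : 1 <= a -> a < b -> b <= y -> y <= exc rw a -> y <= exc rw b -> crs rw y -> y = b /\ crs rw b.
  move=> a1 ab by' ya yb cy; move: by'; rewrite leq_eqVlt => /orP[/eqP E|lt].
    by split=> //; rewrite E.
  have bb : ~~ crs rw b by apply/negP => cb; move: yb lt; rewrite exc_crs //; clia.
  have ba : ~~ crs rw a by apply/negP => ca; move: ya ab lt; rewrite exc_crs //; clia.
  rewrite exc_bump // in ya.
  by have := nxt_crs (isT : 1 <= a.+1) ab (leq_trans lt ya); rewrite (negbTE bb).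
have inv a b : 1 <= a -> a < b -> (exc rw b < exc rw a) = crs rw b && (b <= exc rw a).
  move=> a1 ab; case: (boolP (crs rw b)) => cb /=.
    rewrite exc_crs // ltn_neqAle andb_idl // => le; apply/eqP => E.
    have ba : ~~ crs rw a by apply/negP => ca; move: E ab; rewrite exc_crs //; clia.
    have := nxt_bump rw (isT : 1 <= a.+1); move: E; rewrite exc_bump // => <-.
    by rewrite cb.
  apply/negbTE; rewrite -leqNgt; case: (boolP (crs rw a)) => ca.
    by rewrite exc_crs // (leq_trans (ltnW ab) (exc_ge _ _)).
  rewrite exc_bump //; apply: leq_trans (exc_ge _ _).
  rewrite leqNgt; apply/negP => lt2.
  by have := nxt_crs (isT : 1 <= a.+1) ab lt2; rewrite (negbTE cb).
move=> c1 c1'; case: (ltngtP c c') => // lt _ /=; rewrite ?orbF.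
- rewrite (inv _ _ c1 lt) /topcnt.
  rewrite (eq_in_count (a2 := fun y => (y == c') && (crs rw c'))); last first.
    move=> y; rewrite mem_iota => Hy; apply/andP/andP => -[].
      move=> Hy2 cy; have [|||| -> ->] // := one c c' y c1 lt; move: Hy Hy2 (exc_ge rw c); clia.
    by move=> /eqP -> cc; rewrite leqnn exc_ge.
  rewrite (@count_one _ _ _ c'); last by move=> y /andP[/eqP].
  by rewrite eqxx; move: (crs rw c') (exc_ge rw c) lt; clia.
- rewrite (inv _ _ c1' lt) /topcnt.
  rewrite (eq_in_count (a2 := fun y => (y == c) && (crs rw c) && (c <= exc rw c'))); last first.
    move=> y; rewrite mem_iota => Hy; apply/andP/andP => -[].
      move=> Hy2 cy; have [|||| E ->] // := one c' c y c1' lt; try (move: Hy Hy2 (exc_ge rw c); clia).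
      by move: Hy2; rewrite E eqxx => /andP[_ ->].
    by case/andP=> /eqP -> cc ->; rewrite cc (ltnW lt).
  rewrite (@count_one _ _ _ c); last by move=> y /andP[/andP[/eqP]].
  by rewrite eqxx; move: (crs rw c) (exc_ge rw c) lt; clia.
Qed.
End Cons.

Lemma pd_reducedE m P : pd_reduced m P <-> forall i j, 1 <= i -> i < j -> j <= m -> cnt m P i j <= 1.
Proof. by []. Qed.

Lemma size_pd_perm m P : size (pd_perm m P) = m.
Proof. by rewrite size_map size_iota. Qed.

Lemma cnt_next_val m rw P i j : pd_shape m.+1 (rw :: P) ->
  is_perm m (pd_perm m P) -> 1 <= i -> i < j -> j <= m ->
  cnt m P i j = (pat (pd_perm m P) j < pat (pd_perm m P) i) ->
  let c := pat (pd_perm m P) i in let c' := pat (pd_perm m P) j in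
  cnt m.+1 (rw :: P) i.+1 j.+1 = (c' < c) +
   ((c < c') && (exc rw c' < exc rw c) || (c' < c) && (exc rw c < exc rw c')).
Proof.
move=> S Hu i1 ij jm E c c'.
have Hi : 1 <= i <= m by move: i1 ij jm; clia.
have Hj : 1 <= j <= m by move: i1 ij jm; clia.
have [c1 _] := andP (perm_range Hu Hi); have [c1' _] := andP (perm_range Hu Hj).
rewrite (cnt_next S Hi Hj) E topcntE //.
by apply: (pat_neq Hu) => //; move: ij; clia.
Qed.

(** Below the row two pipes cross once if they form an inversion and not at all otherwise, so a
    reversal in the row is harmless exactly for pairs not yet inverted. *)
Lemma pd_reduced_cons m rw P : pd_shape m.+1 (rw :: P) ->
  (pd_reduced m P -> is_perm m (pd_perm m P) /\
    forall i j, 1 <= i -> i < j -> j <= m ->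
      cnt m P i j = (pat (pd_perm m P) j < pat (pd_perm m P) i)) ->
  pd_reduced m.+1 (rw :: P) <-> pd_reduced m P /\ nocross rw (pd_perm m P).
Proof.
move=> S IH; split.
- move=> R.
  have RP : pd_reduced m P.
    move=> i j i1 ij jm; have := R i.+1 j.+1 isT ij jm.
    rewrite -/(cnt m.+1 (rw :: P) i.+1 j.+1) (cnt_next S); first by apply: leq_trans; rewrite leq_addr.
      by move: i1 ij jm; clia.
    by move: i1 ij jm; clia.
  split=> //; have [Hu Hc] := IH RP.
  move=> i j i1 ij; rewrite size_pd_perm => jm lt.
  have := R i.+1 j.+1 isT ij jm.
  rewrite -/(cnt m.+1 (rw :: P) i.+1 j.+1) (cnt_next_val S Hu i1 ij jm (Hc i j i1 ij jm)) lt.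
  have Hj : 1 <= j <= m by move: i1 ij jm; clia.
  have [c1' _] := andP (perm_range Hu Hj).
  by have := exc_inj rw c1' lt; move: lt; clia.
- case=> RP NC; have [Hu Hc] := IH RP; apply/pd_reducedE => -[|[|i]] // [|j] // _ ij jm.
    have Hj : 1 <= j <= m by move: ij jm; clia.
    have [c1 _] := andP (perm_range Hu Hj).
    by rewrite (cnt_first S Hj) topcnt_first // leq_b1.
  rewrite (cnt_next_val S Hu _ _ _ (Hc i.+1 j _ _ _)) //.
  have := NC i.+1 j isT ij; rewrite size_pd_perm => /(_ jm).
  by move: (pat _ j) (pat _ i.+1) (exc rw _) (exc rw _); clia.
Qed.

Lemma pd_facts m P : pd_shape m P -> pd_reduced m P -> is_perm m (pd_perm m P) /\
    forall i j, 1 <= i -> i < j -> j <= m ->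
      cnt m P i j = (pat (pd_perm m P) j < pat (pd_perm m P) i).
Proof.
elim: m P => [|m IH] P S R.
  by split=> // i j i1 ij; rewrite leqNgt (ltn_trans i1 ij).
have [rw [P' E]] := pd_shape_pos S; subst P.
have [Sr S'] := (proj1 (pd_shape_cons _ _ _) S).
have [R' NC] := (proj1 (pd_reduced_cons S (IH P' S')) R).
have [Hu Hc] := IH P' S' R'.
rewrite (pd_perm_cons S); split; first exact: rowact_perm.
have E i : 1 <= i <= m -> pat (rowact rw (pd_perm m P')) i.+1 = exc rw (pat (pd_perm m P') i).
  by move=> Hi; have [i1 _] := andP Hi; rewrite /rowact pat_consS // pat_map // size_pd_perm.
move=> [|[|i]] // [|j] // _ ij jm; have Hj : 1 <= j <= m by move: ij jm; clia.
  rewrite (cnt_first S Hj) E // topcnt_first //.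
  by have [] := andP (perm_range Hu Hj).
have Hi : 1 <= i.+1 <= m by move: ij jm; clia.
rewrite (cnt_next_val S Hu _ _ _ (Hc i.+1 j _ _ _)) // !E //.
have := NC i.+1 j isT ij; rewrite size_pd_perm => /(_ jm).
have : pat (pd_perm m P') i.+1 != pat (pd_perm m P') j.
  by apply: (pat_neq Hu) => //; move: ij; clia.
by move: (pat _ j) (pat _ i.+1) (exc rw _) (exc rw _); clia.
Qed.

(** * Chains of pipe dreams *)

Lemma chain_PD_cons m rw P : 
  chain_PD m.+1 (rw :: P) = pd_perm m.+1 (rw :: P) :: map (cons m.+1) (chain_PD m P).
Proof.
rewrite /chain_PD iota_rcons rev_rcons map_cons add1n subnn /=.
congr cons; rewrite -map_comp; apply/eq_in_map => i.
rewrite mem_rev mem_iota add1n ltnS => /andP[i1 im].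
rewrite subSn // iota_rcons rev_rcons.
by have -> : i.+1 + (m - i) = m.+1 by move: im; clia.
Qed.

Lemma size_chain_PD m P : size (chain_PD m P) = m.
Proof. by rewrite size_map size_rev size_iota. Qed.

Lemma is_PD_perm m w P : is_PD m w P -> is_perm m w.
Proof. by case=> S R <-; case: (pd_facts S R). Qed.

Lemma w0S m : w0 m.+1 = m.+1 :: w0 m.
Proof. by rewrite /w0 iota_rcons rev_rcons add1n. Qed.

Lemma chain_perms n w g C : is_perm n w -> chain_from_to n w g C -> all (is_perm n) C.
Proof.
move=> Hw [Cc Hh _]; have [Cs _] := Cc; apply/(all_nthP [::]) => i; rewrite Cs ltnS => ig.
exact: (compat_perm Hw Cc Hh ig).
Qed.

Lemma iota_mapS k m : iota k.+1 m = map S (iota k m).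
Proof. by rewrite -add1n iotaDl. Qed.

(* The chain of a pipe dream versus that of the dream without its first row. *)
Lemma chain_lift m u v C : is_perm m.+1 v -> all (is_perm m.+1) C -> 
  chain_from_to m.+2 u (iota 1 m.+1) (u :: map (cons m.+2) (v :: C)) <->
  has_inc_chain 1 u (m.+2 :: v) /\ chain_from_to m.+1 v (iota 1 m) (v :: C).
Proof.
move=> Hv HC; rewrite /chain_from_to w0S.
have HvC : all (is_perm m.+1) (v :: C) by rewrite /= Hv.
have lastE : last [::] (u :: map (cons m.+2) (v :: C)) = m.+2 :: last [::] (v :: C).
  by rewrite /= last_map.
rewrite lastE -[iota 1 m.+1]/(1 :: iota 2 m) iota_mapS.
have L := compat_lift HvC (iota 1 m).
split.
- by case=> /compat_cons [I /L Cc] _ [<-].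
- by case=> I [/L Cc _ ->]; split=> //; apply/compat_cons.
Qed.

Lemma chain_PD_ok n P : 1 <= n -> forall w, is_PD n w P -> 
  chain_from_to n w (iota 1 n.-1) (chain_PD n P).
Proof.
elim: n P => // -[|m] IH P _ w Hw.
  have Hp := is_PD_perm Hw; case: Hw => S _ E.
  have Ew : w = [:: 1].
    case: w Hp {E} => [|x [|y w]] Hp; have := is_perm_size Hp => // _.
    by have := is_perm_mem x Hp; rewrite inE eqxx => /esym; case: x Hp => [|[|x]].
  have [rw [P' EP]] := pd_shape_pos S; subst P.
  by rewrite chain_PD_cons /chain_PD /= E Ew.
have Hp := is_PD_perm Hw; case: Hw => S R E.
have [rw [P' EP]] := pd_shape_pos S; subst P.
have [Sr S'] := (proj1 (pd_shape_cons _ _ _) S).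
have [R' NC] := (proj1 (pd_reduced_cons S (pd_facts S')) R).
have [Hu _] := pd_facts S' R'.
rewrite chain_PD_cons E.
have := IH P' isT (pd_perm m.+1 P') (And3 S' R' erefl).
have := size_chain_PD m.+1 P'; case: (chain_PD m.+1 P') => // v C [_] HC.
have Ev : v = pd_perm m.+1 P' by case: HC.
have /andP[Hv HC'] := chain_perms Hu HC.
apply/(chain_lift w Hv HC'); split; last by rewrite {1}Ev.
by rewrite Ev -E (pd_perm_cons S); apply: rowact_chain.
Qed.

Lemma head_chain_PD m P : head [::] (chain_PD m P) = pd_perm m P.
Proof.
case: m => // m; rewrite /chain_PD iota_rcons rev_rcons map_cons add1n.
by rewrite -[LHS]/(rev (iota m.+2 (m.+1 - m.+1)) ++ pd_perm m.+1 (drop (m.+1 - m.+1) P)) subnn drop0.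
Qed.

Lemma cons_inj (T : Type) (x y : T) s t : x :: s = y :: t -> x = y /\ s = t.
Proof. by case=> -> ->. Qed.

Lemma chain_PD_inj n P1 P2 w : is_PD n w P1 -> is_PD n w P2 ->
  chain_PD n P1 = chain_PD n P2 -> P1 = P2.
Proof.
elim: n P1 P2 w => [|m IH] P1 P2 w [S1 R1 E1] [S2 R2 E2].
  by case: S1 S2 => /size0nil -> _ [/size0nil -> _].
have [rw1 [Q1 EP]] := pd_shape_pos S1; subst P1.
have [rw2 [Q2 EP]] := pd_shape_pos S2; subst P2.
have [Sr1 S1'] := (proj1 (pd_shape_cons _ _ _) S1).
have [Sr2 S2'] := (proj1 (pd_shape_cons _ _ _) S2).
have [R1' N1] := (proj1 (pd_reduced_cons S1 (pd_facts S1')) R1).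
have [R2' N2] := (proj1 (pd_reduced_cons S2 (pd_facts S2')) R2).
rewrite !chain_PD_cons => E0; have [E3 E4] := cons_inj E0.
have inj : injective (cons m.+1) by move=> x y [].
have {}E4 := inj_map inj E4.
have Eu : pd_perm m Q1 = pd_perm m Q2.
  by rewrite -!head_chain_PD E4.
have EQ : Q1 = Q2 by apply: (IH Q1 Q2 (pd_perm m Q1)).
subst Q2; congr cons.
have [Hu _] := pd_facts S1' R1'.
by apply: (rowact_inj Hu) => //; rewrite -(pd_perm_cons S1) -(pd_perm_cons S2).
Qed.

Lemma chain_PD_surj n w C : 1 <= n -> is_perm n w -> chain_from_to n w (iota 1 n.-1) C ->
  exists P, is_PD n w P /\ chain_PD n P = C.
Proof.
elim: n w C => // -[|m] IH w C _ Hw HC.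
  exists [:: [::]]; case: HC => -[/= SC _] Hh Hl.
  case: C SC Hh Hl => // x [|//] _ /= -> Ew; subst w.
  split=> //; split=> //; first by split=> // -[].
  by move=> i j i1 ij j1; move: (leq_trans ij j1) i1; clia.
have D := chain_dom Hw HC; have HA := chain_perms Hw HC.
have [[SC HCi] Hh Hl] := HC; rewrite size_iota in SC.
(* By dominance every member after the first starts with the maximum [m.+2]. *)
have [C' EC'] : exists C', C = w :: map (cons m.+2) C'.
  case: C SC Hh HC D HA {HCi Hl} => // x C [SC] /= -> HC D /andP[_ HA].
  have HD y : y \in C -> exists2 b, is_perm m.+1 b & y = m.+2 :: b.
    move=> yC; have Hy := allP HA _ yC; apply: dom2_top => //.
    have lt : index y C < m.+1 by rewrite -SC index_mem.
    have := D (index y C).+1 lt; rewrite /= nth_index // => Dy p q p1 p2.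
    by apply: Dy => //; apply: leq_trans p2 _.
  exists (map behead C); congr cons; rewrite -map_comp -[LHS]map_id; apply/eq_in_map => y yC.
  by have [b _ ->] := HD _ yC.
subst C; clear HCi Hh Hl D; case: C' SC HC HA => [//|v C'] SC HC /andP[_ HA].
have {}HA : all (is_perm m.+2) [seq m.+2 :: b | b <- v :: C'] by [].
have HvC : all (is_perm m.+1) (v :: C').
  apply/allP => b bC; have Hb : is_perm m.+2 (m.+2 :: b).
    by have := allP HA (m.+2 :: b); apply; apply/mapP; exists b.
  have [|b' Hb' [->]] // := dom2_top Hb.
  move=> p q p1 p2 pq qn; have Ep : p = 1 by move: p1 p2; clia.
  have U := pat_neq Hb (_ : 1 <= q <= m.+2) (_ : 1 <= 1 <= m.+2).
  have := perm_range Hb (_ : 1 <= q <= m.+2); subst p.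
  have Hq : 1 <= q <= m.+2 by move: pq qn; clia.
  move=> /(_ Hq); have := U Hq isT; rewrite [pat _ 1]/pat /=; move: pq; clia.
have [Hv HC2] := andP HvC.
have [I HC3] := (proj1 (chain_lift w Hv HC2) HC).
have [P' [PD' EP']] := IH v _ isT Hv HC3.
have [S' R' E'] := PD'; have Hv' : is_perm m.+1 (pd_perm m.+1 P') by rewrite E'.
rewrite -E' in I; have [rw [Srw Ew NC]] := chain_row Hv' Hw I.
have S : pd_shape m.+2 (rw :: P') by apply/pd_shape_cons.
exists (rw :: P'); split; last by rewrite chain_PD_cons EP' (pd_perm_cons S) -Ew.
split=> //; last by rewrite (pd_perm_cons S) -Ew.
by apply/(pd_reduced_cons S (pd_facts S')).
Qed.

(** * Bumpless pipe dreams *)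

Definition hz (x : tile) := e_left x && e_right x.
Definition hrun (t : nat -> tile) c s := forall x, c < x -> x <= s -> hz (t x).

Section Row.
Variables (n k : nat) (v : seq nat).
Hypotheses (Hv : is_perm n v) (k1 : 1 <= k) (kn : k <= n) (Dv : dec n k.-1 v).

Definition rowok (t : nat -> tile) : Prop :=
  [/\ forall c, 1 <= c -> c < n -> e_right (t c) = e_left (t c.+1),
      ~~ e_left (t 1), e_right (t n) &
      forall p, 1 <= p -> p <= n -> e_top (t (pat v p)) = (p < k)].

(* Pipe k enters the row from the right, the pipes p < k from above at column
   [pat v p]. *)
Definition start p := if p < k then (pat v p).-1 else n.

(** A pipe from above either keeps its column or turns left at once and runs to the next [ElbowRB];
    pipe [k], entering from the right, can only run. *)
Definition Exit t p d : Prop :=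
  [/\ p < k, e_bot (t (pat v p)) & d = pat v p] \/
  [/\ p < k -> t (pat v p) = ElbowTL, 1 <= d, d <= start p, t d = ElbowRB & hrun t d (start p)].

(** Whether a pipe passes from column [c + 1] into column [c]; for [c = n] it is the one entering at
    the right border. *)
Definition edge (t : nat -> tile) c := (c == n) || e_left (t c.+1).

Lemma dec_k : dec n k v.
Proof. by move=> p q kp; apply: Dv; apply: leq_ltn_trans kp; apply: leq_pred. Qed.

Lemma tail_lt q : k < q -> q <= n -> pat v q < pat v k.
Proof. by move=> kq qn; apply: Dv => //; rewrite prednK. Qed.

Lemma low y c p : is_perm n y -> (forall p, 1 <= p -> p <= n -> pat v p <= c -> pat y p = pat v p) ->
  1 <= p -> p <= n -> pat y p <= c -> pat v p = pat y p.
Proof.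
move=> Hy L p1 pn yc; have Hp : 1 <= p <= n by rewrite p1.
have [q /andP[q1 qn] Eq] := perm_surj Hv (perm_range Hy Hp).
have Eyq : pat y q = pat y p by rewrite L // Eq.
by rewrite -(perm_inj Hy _ _ Eyq) ?q1 // L ?Eq.
Qed.

Lemma hrun_refl t c : hrun t c c.
Proof. by move=> x a b; move: (leq_trans a b); rewrite ltnn. Qed.

Lemma hrun_ext t c s : hz (t c) -> hrun t c s -> hrun t c.-1 s.
Proof.
move=> Hc H x cx xs; have [->//|ne] := eqVneq x c.
by apply: H => //; move: cx ne; clia.
Qed.

(** * From a row of tiles to an increasing chain *)

Section Row_to_chain.
Variables (t : nat -> tile) (f : nat -> nat).
Hypotheses (W : rowok t) (Ef : forall p, 1 <= p -> p <= k -> Exit t p (f p)).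
Hypothesis NC : forall p q, 1 <= p -> p < q -> q < k -> pat v q < pat v p -> f q < f p.

Definition open t h c : Prop :=
  [/\ 1 <= h, h <= k, pat v h <= c -> h = k, h < k -> t (pat v h) = ElbowTL & hrun t c (start h)].

(* The tiles are read from right to left and those right of column c are done;
   pipe h runs from them into column c (h = 0: no pipe does).  Each column
   [pat v q] > c with k < q that was met by a running pipe has contributed a step
   with that label to the chain from y to v. *)
Record scan c (y : seq nat) (h : nat) : Prop := Scan {
  sc_perm : is_perm n y;
  sc_chain : exists cs, [/\ incc k y cs, last y cs = v & all (ltn c) (pairmap swapmin y cs)];
  sc_low : forall p, 1 <= p -> p <= n -> pat v p <= c -> pat y p = pat v p;
  sc_edge : (h != 0) = edge t c;
  sc_open : h != 0 -> open t h c /\ forall p, h < p -> p <= n -> ~~ (c < pat y p < pat y h);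
  sc_first : pat v k <= c -> h = k;
  sc_done : forall p, 1 <= p -> p <= k -> p != h -> c < pat y p -> f p = pat y p }.

Lemma scan_init : scan n v k.
Proof.
split=> //.
- by exists [::].
- by rewrite /edge eqxx -lt0n k1.
- move=> _; split.
    split=> //; first by rewrite ltnn.
    by rewrite /start ltnn; apply: hrun_refl.
  move=> p kp pn; apply/negP => /andP[a _].
  by have := @perm_range n v p Hv; move: a kp pn; clia.
- move=> p p1 pk _ lt; have := @perm_range n v p Hv; move: lt p1 pk kn; clia.
Qed.

Lemma edge_right c : 1 <= c -> c <= n -> e_right (t c) = edge t c.
Proof.
case: W => W1 _ W3 _ c1; rewrite leq_eqVlt /edge => /orP[/eqP ->|lt]; first by rewrite eqxx W3.
by rewrite W1 // (ltn_eqF lt).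
Qed.

Lemma edge_left c : 1 <= c -> c <= n -> edge t c.-1 = e_left (t c).
Proof. by move=> c1 cn; rewrite /edge prednK // (_ : _ == _ = false) //; move: c1 cn; clia. Qed.

Lemma Exit_open h c d : open t h c -> Exit t h d -> d <= c \/ h < k /\ e_bot (t (pat v h)).
Proof.
case=> h1 hk hc TL H [[a b _]|[_ d1 ds RB _]]; first by right.
left; rewrite leqNgt; apply/negP => cd.
by have := H d cd ds; rewrite RB.
Qed.

(** The position [q] of [c] in [v] decides. For [q < k] a pipe comes from above and a running pipe
    must cross it. For [q > k] nothing comes from above, and a running pipe [h] contributes the step
    exchanging [h] and [q]. The column with [q = k] is reached by pipe [k] itself and contributes
    nothing. *)
Lemma scan_step c y h : 1 <= c -> c <= n -> scan c y h -> exists y' h', scan c.-1 y' h'.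
Proof.
move=> c1 cn [Hy Hch L He Ho Hf Hd].
have Hc : 1 <= c <= n by rewrite c1.
have [q /andP[q1 qn] Eq] := perm_surj Hv Hc.
have Hq : 1 <= q <= n by rewrite q1.
have Eyq : pat y q = c by rewrite L ?Eq.
have Er := edge_right c1 cn; rewrite -He in Er.
have El := edge_left c1 cn.
have Et : e_top (t c) = (q < k) by have [_ _ _ W4] := W; rewrite -Eq W4.
have Iy p : 1 <= p -> p <= n -> p != q -> pat y p != c.
  by move=> p1 pn pq; rewrite -Eyq; apply: (pat_neq Hy); rewrite ?p1.
have lt_c p : 1 <= p -> p <= n -> p != q -> c.-1 < pat y p -> c < pat y p.
  by move=> p1 pn pq; have := Iy p p1 pn pq; move: c1; clia.
have L' p : 1 <= p -> p <= n -> pat v p <= c.-1 -> pat y p = pat v p.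
  by move=> p1 pn le; apply: L => //; move: le; clia.
have chain' : exists cs, [/\ incc k y cs, last y cs = v & all (ltn c.-1) (pairmap swapmin y cs)].
  have [cs [I La A]] := Hch; exists cs; split=> //.
  by apply: sub_all A => l /=; clia.
have [h0|h0] := eqVneq h 0.
  subst h; rewrite eqxx /= in Er He; move: (Er); have vkc : c < pat v k.
    by rewrite ltnNge; apply/negP => /Hf E; move: k1; rewrite -E.
  have vkc' : ~~ (pat v k <= c.-1) by rewrite -ltnNge; move: vkc; clia.
  have Bq : q < k -> e_bot (t c) -> f q = c.
    move=> qk b; case: (Ef q1 (ltnW qk)) => [[_ _ ->] //|[/(_ qk)]].
    by rewrite Eq => TL; rewrite TL in b.
  have qk : q != k by apply/eqP => E; move: vkc; rewrite -E Eq ltnn.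
  have stay : ~~ e_left (t c) -> (q < k -> e_bot (t c)) -> exists y' h', scan c.-1 y' h'.
    move=> nl b; exists y, 0; split=> //; first by rewrite El (negbTE nl).
      by move/negP: vkc'.
    move=> p p1 pk _ lt; have [E|pq] := eqVneq p q.
      by subst p; rewrite Eyq Bq ?b // ltn_neqAle qk pk.
    by apply: Hd; rewrite -?lt0n // lt_c // (leq_trans pk).
  case E : (t c) => // _; rewrite E /= in Et El stay *; try exact: stay.
    by apply: stay => //; rewrite -Et.
  have qk' : q < k by rewrite -Et.
  exists y, q; split=> //.
  - by rewrite El -lt0n q1.
  - move=> _; split.
      split=> //; [exact: ltnW|by rewrite Eq; move: c1; clia|by rewrite Eq|].
      by rewrite /start qk' Eq; apply: hrun_refl.
    by move=> p qp pn; rewrite Eyq; move: c1; clia.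
  - by move/negP: vkc'.
  - move=> p p1 pk pq lt; apply: Hd; rewrite -?lt0n // lt_c // (leq_trans pk) //.
rewrite h0 in Er He; have [op gap] := Ho h0; have [h1 hk hck hTL hr] := op.
have hn : h <= n := leq_trans hk kn.
have dn p : 1 <= p -> p <= k -> p != q -> p != h -> c.-1 < pat y p -> f p = pat y p.
  by move=> p1 pk pq ph lt; apply: Hd => //; apply: lt_c => //; apply: leq_trans kn.
case: (ltngtP q k) Et => qk Et.
- have E : t c = Cross by move: Et Er; case: (t c).
  have qh : q != h.
    by apply/eqP => E2; move: qk; rewrite E2 (hck _) ?ltnn // -E2 Eq.
  have fq : f q = c.
    case: (Ef q1 (ltnW qk)) => [[_ _ ->] //|[/(_ qk)]].
    by rewrite Eq E.
  exists y, h; split=> //.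
  + by rewrite El E h0.
  + move=> _; split.
      split=> //; last by apply: hrun_ext hr; rewrite E.
      by move=> le; apply: hck; move: le; clia.
    move=> p hp pn; have [E2|pq] := eqVneq p q; last first.
      have := gap p hp pn; have := Iy p _ pn pq; move: hp; clia.
    subst p; rewrite Eyq; apply/negP => /andP[_ lt].
    (* For [h < q] the two pipes form an inversion of [v]; crossing here would reverse their order
       once more, against [NC]. *)
    have hk' : h < k := ltn_trans hp qk.
    have vh : c < pat v h.
      by rewrite ltnNge; apply/negP => /hck E2; move: hk'; rewrite E2 ltnn.
    have := NC h1 hp qk; rewrite Eq => /(_ vh); rewrite fq.
    case: (Exit_open op (Ef h1 hk)) => [le|[_ b]]; first by move: le; clia.
    by rewrite hTL in b.
  + by move=> le; apply: Hf; move: le; clia.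
  + move=> p p1 pk ph lt; have [->|pq] := eqVneq p q; first by rewrite fq.
    exact: dn.
- have vkc : c < pat v k by rewrite -Eq; apply: tail_lt.
  have vh : c < pat v h.
    by rewrite ltnNge; apply/negP => le; move: (le); rewrite (hck le) leqNgt vkc.
  have qh : q != h by apply/eqP => E; move: vh; rewrite -E Eq ltnn.
  have yh : c < pat y h.
    rewrite ltnNge; apply/negP => le.
    by have := low Hy L h1 hn le; move: le vh; clia.
  pose y' := swap y h q.
  have Hy' : is_perm n y' by apply: swap_perm => //; rewrite ?h1.
  have Sy := is_perm_size Hy.
  have hq : h < q := leq_ltn_trans hk qk.
  (* The cover condition of the new step is the gap kept in [sc_open]. *)
  have [T yE] : tstep n y' y h q /\ y = swap y' h q.
    have E1 : pat y' h = c by rewrite pat_swap ?Sy ?h1 // eqxx Eyq.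
    have E2 : pat y' q = pat y h by rewrite pat_swap ?Sy ?q1 // eqxx (negbTE qh).
    have E3 : y = swap y' h q by rewrite (@swapK n) ?h1 ?q1.
    split=> //; rewrite [X in tstep _ _ X]E3; apply: tstepI => //; split; rewrite ?E1 ?E2 // => p Hp.
    have Hp1 : 1 <= p <= n by move: Hp h1 qn; clia.
    rewrite pat_swap ?Sy // !ifF; try (by apply/eqP; move: Hp; clia).
    by apply: gap; move: Hp qn; clia.
  have [_ _ _ Eh Eqq] := tstep_vals T.
  have out p := @tstep_out _ _ _ _ _ p T.
  have Eh' : pat y' h = c by rewrite -Eqq.
  have L2 p : 1 <= p -> p <= n -> pat v p <= c.-1 -> pat y' p = pat v p.
    move=> p1 pn le; rewrite -out //; first exact: L'.
      by apply/eqP => E; move: le vh; rewrite E; clia.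
    by apply/eqP => E; move: le c1; rewrite E Eq; clia.
  have ch2 : exists cs, [/\ incc k y' cs, last y' cs = v & all (ltn c.-1) (pairmap swapmin y' cs)].
    have [cs [I La A]] := Hch; exists (y :: cs).
    have ES : swapmin y' y = c by rewrite (tstep_swapmin T).
    split=> //=; last first.
      rewrite ES; apply/andP; split; first by move: c1; clia.
      by apply: sub_all A => l /=; clia.
    apply: incc_consI => //; last by rewrite ES.
    by rewrite (tstep_kcover k T) hk qk.
  have dn2 p : 1 <= p -> p <= k -> p != h -> c.-1 < pat y' p -> f p = pat y' p.
    move=> p1 pk ph; rewrite -out //; last by move: qk pk; clia.
    by apply: dn => //; move: qk pk; clia.
  have vkc' : pat v k <= c.-1 -> False by move: vkc; clia.
  case E : (t c) Et Er => // _ _; rewrite E /= in El.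
  + exists y', h; split=> //; first by rewrite El h0.
    move=> _; split; last by rewrite Eh' => p _ _; move: c1; clia.
    split=> //; last by apply: hrun_ext hr; rewrite E.
    by move: vh; clia.
  + exists y', 0; split=> //.
    move=> p p1 pk _ lt; have [->|ph] := eqVneq p h; last exact: dn2.
    have cs : c <= start h.
      by rewrite /start; case: ifP => _ //; move: vh; clia.
    rewrite Eh'; case: (Ef h1 hk) => [[a b _]|[_ d1 ds RB hr']].
      by rewrite hTL in b.
    have [lt2|lt2|//] := ltngtP (f h) c.
      by have := hr' c lt2 cs; rewrite E.
    by have := hr _ lt2 ds; rewrite RB.
- subst q; have Eh : h = k by apply: Hf; rewrite Eq.
  subst h; case E : (t c) Et Er => // _ _; rewrite E /= in El.
  + exists y, k; split=> //; first by rewrite El h0.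
      move=> _; split; last by rewrite Eyq => p _ _; move: c1; clia.
      by split=> //; apply: hrun_ext hr; rewrite E.
    by move=> p p1 pk ph; apply: dn.
  + exists y, 0; split=> //; first by rewrite Eq; move: c1; clia.
    move=> p p1 pk _ lt; have [->|ph] := eqVneq p k; last exact: dn.
    rewrite Eyq; case: (Ef h1 hk) => [[]|[_ d1 ds RB hr']]; first by rewrite ltnn.
    have [lt2|lt2|//] := ltngtP (f k) c.
      by have := hr' c lt2; rewrite E /start ltnn => /(_ cn).
    by have := hr _ lt2 ds; rewrite RB.
Qed.

Lemma row_to_chain : exists u cs, [/\ is_perm n u, incc k u cs, last u cs = v &
  forall p, 1 <= p -> p <= k -> pat u p = f p].
Proof.
have [y [h S]] : exists y h, scan 0 y h.
  rewrite -(subnn n); have := leqnn n; elim: {-2 3}n => [|d IH] dn.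
    by rewrite subn0; exists v, k; apply: scan_init.
  have [y [h S]] := IH (ltnW dn).
  rewrite subnS; apply: scan_step S; first by rewrite subn_gt0.
  exact: leq_subr.
have W2 : ~~ e_left (t 1) by case: W.
have h0 : h = 0.
  apply/eqP/negPn; rewrite (sc_edge S) /edge (negbTE W2) orbF.
  by move: k1 kn; clia.
subst h; have [cs [I La _]] := sc_chain S.
exists y, cs; split=> //; first exact: sc_perm S.
move=> p p1 pk; have Hp : 1 <= p <= n by rewrite p1 (leq_trans pk kn).
have /andP[yp _] := perm_range (sc_perm S) Hp.
by rewrite (sc_done S) // -lt0n.
Qed.
End Row_to_chain.

(** * From an increasing chain to a row of tiles *)

Section Chain_to_row.
Variables (u : seq nat) (cs : seq (seq nat)).
Hypotheses (Hu : is_perm n u) (Icu : incc k u cs) (Luv : last u cs = v).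

(** The last step of [cs1] has the largest remaining label, so it is the next one that a scan from
    the right has to realise; [a] is its lower position. *)
Definition moves cs1 y a := exists cs' b,
  [/\ cs1 = rcons cs' y, tstep n (last u cs') y a b, a <= k & k < b].

Definition upd (t : nat -> tile) c x := fun d => if d == c then x else t d.

(* The same scan in the other direction: the tiles right of column c are built
   from the steps with label > c, and [cs1] is the rest of the chain. *)
Record bscan c (t : nat -> tile) (y : seq nat) (h : nat) cs1 : Prop := BScan {
  bs_perm : is_perm n y;
  bs_dec : dec n k y;
  bs_path : path (kcover k) u cs1;
  bs_sort : sorted ltn (pairmap swapmin u cs1);
  bs_last : last u cs1 = y;
  bs_lab : all (fun l => l <= c) (pairmap swapmin u cs1);
  bs_low : forall p, 1 <= p -> p <= n -> pat v p <= c -> pat y p = pat v p;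
  bs_edge : (h != 0) = edge t c;
  bs_open : h != 0 -> open t h c;
  bs_on : h != 0 -> c < pat v k -> moves cs1 y h;
  bs_off : h = 0 -> forall a, moves cs1 y a -> pat y a <= c;
  bs_first : pat v k <= c -> h = k;
  bs_done : forall p, 1 <= p -> p <= k -> p != h -> c < pat y p -> Exit t p (pat y p);
  bs_right : forall x, c < x -> x <= n -> e_right (t x) = edge t x;
  bs_top : forall p, 1 <= p -> p <= n -> c < pat v p -> e_top (t (pat v p)) = (p < k);
  bs_nc : forall p q, 1 <= p -> p < q -> q < k -> pat v q < pat v p -> c < pat v q ->
     t (pat v p) = ElbowTL -> ~ hrun t (pat v q).-1 (pat v p).-1 }.

(** [Blank] is a placeholder for the columns not yet scanned. *)
Lemma bscan_init : bscan n (fun=> Blank) v k cs.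
Proof.
have [P S] := andP Icu; split=> //.
- exact: dec_k.
- elim: cs u Hu P => //= x s IH w Hw /andP[K /(IH x (kcover_perm Hw K)) ->]; rewrite andbT.
  have [a [b [T ab]]] := (proj1 (kcoverP _ _ Hw) K).
  rewrite (tstep_swapmin T); have [a1 ab' _ _ _] := tstep_vals T.
  have Ha : 1 <= a <= n by move: a1 ab'; clia.
  by case/andP: (perm_range Hw Ha).
- by rewrite /edge eqxx -lt0n k1.
- move=> _; split=> //; first by rewrite ltnn.
  by rewrite /start ltnn; apply: hrun_refl.
- by have := @perm_range n v k Hv; move=> + _; rewrite k1 kn => /(_ isT); clia.
- by move=> E; move: k1; rewrite E.
- move=> p p1 pk _ lt; have := @perm_range n v p Hv; move: lt p1 pk kn; clia.
- by move=> x a b; move: (leq_trans a b); rewrite ltnn.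
- move=> p p1 pn; have := @perm_range n v p Hv; rewrite p1 pn => /(_ isT); clia.
Qed.

Lemma moves_dec cs1 y : path (kcover k) u cs1 -> last u cs1 = y -> is_perm n y ->
  cs1 = [::] \/ exists a, moves cs1 y a.
Proof.
case/lastP: cs1 => [|s x]; first by left.
rewrite rcons_path last_rcons => /andP[P K] Ex Hy; subst x; right.
have Hl := path_perm Hu P.
have [a [b [T /andP[ak kb]]]] := (proj1 (kcoverP _ _ Hl) K).
by exists a, s, b.
Qed.

Lemma moves_uniq cs1 y a a' : moves cs1 y a -> moves cs1 y a' -> a = a'.
Proof.
case=> s [b [E T _ _]] [s' [b' [E' T' _ _]]].
move: E'; rewrite E => /rcons_inj [Es]; subst s'.
by have [] := tstep_inj T T'.
Qed.

Lemma moves_em s w a : path (kcover k) u s -> last u s = w -> is_perm n w ->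
  moves s w a \/ ~ moves s w a.
Proof.
move=> P L Hw; case: (moves_dec P L Hw) => [E|[a' M]].
  by right=> -[[|? ?] [b []]]; rewrite E.
have [<-|aq] := eqVneq a' a; first by left.
by right=> M'; case/eqP: aq; apply: moves_uniq M M'.
Qed.

Lemma moves_lab c cs1 y a : sorted ltn (pairmap swapmin u cs1) ->
  all (fun l => l <= c) (pairmap swapmin u cs1) -> moves cs1 y a ->
  exists cs' x b, [/\ cs1 = rcons cs' y, last u cs' = x, tstep n x y a b, a <= k < b & 
    [/\ pat x a <= c, sorted ltn (pairmap swapmin u cs') &
       forall d, pat x a <= d.+1 -> all (fun l => l <= d) (pairmap swapmin u cs')]].
Proof.
move=> S A [s [b [E T ak kb]]]; exists s, (last u s), b; split=> //; first by rewrite ak.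
have Ep : pairmap swapmin u cs1 = rcons (pairmap swapmin u s) (pat (last u s) a).
  by rewrite E -cats1 pairmap_cat /= (tstep_swapmin T) cats1.
move: S A; rewrite Ep all_rcons (sorted_pairwise ltn_trans) pairwise_rcons.
case/andP=> lt S /andP[le _]; split=> //; first by rewrite (sorted_pairwise ltn_trans).
move=> d led; apply: sub_all lt => l /= lt; move: (leq_trans lt led); clia.
Qed.

Lemma hrun_upd t c x d s : c <= d -> hrun (upd t c x) d s <-> hrun t d s.
Proof.
move=> cd; have E y : d < y -> upd t c x y = t y.
  by move=> dy; rewrite /upd gtn_eqF //; apply: leq_ltn_trans dy.
by split=> H y dy ys; have := H y dy ys; rewrite E.
Qed.

Lemma Exit_upd t c x p d : c < d -> Exit t p d -> Exit (upd t c x) p d.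
Proof.
have E y : c < y -> upd t c x y = t y by move=> cy; rewrite /upd gtn_eqF.
move=> cd [[pk b Ed]|[TL d1 ds RB hr]].
  by left; split=> //; subst d; rewrite E.
right; split=> //.
- move=> pk; rewrite E ?TL //; move: ds; rewrite /start pk => ds.
  by move: cd ds; clia.
- by rewrite E.
- by apply/hrun_upd => //; exact: ltnW.
Qed.

Section Step.
Variables (c q : nat) (t : nat -> tile) (y : seq nat) (h : nat) (cs1 : seq (seq nat)).
Hypotheses (c1 : 1 <= c) (cn : c <= n) (B : bscan c t y h cs1).
Hypotheses (q1 : 1 <= q) (qn : q <= n) (Eq : pat v q = c).

Let Hy := bs_perm B.
Let Dy := bs_dec B.
Let Py := bs_path B.
Let Sy := bs_sort B.
Let Ly := bs_last B.
Let Eyq : pat y q = c. Proof. by rewrite (bs_low B) ?Eq. Qed.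

Lemma bs_neq p : 1 <= p -> p <= n -> p != q -> pat y p != c.
Proof. by move=> p1 pn pq; rewrite -Eyq; apply: (pat_neq Hy); rewrite ?p1 ?q1. Qed.

(** The bookkeeping shared by all tiles [T] in column [c]: scanned columns are not disturbed, and
    the only new pair that could break the crossing condition is pipe [q] from above with the
    running pipe. *)
Lemma bs_upd T : e_right T = (h != 0) -> e_top T = (q < k) -> 
  (h != 0 -> q < k -> e_left T -> h < k -> q < h) ->
  (e_left T -> e_right T -> h != 0) ->
  let t' := upd t c T in
  [/\ edge t' c.-1 = e_left T, 
      h != 0 -> open t' h c, 
      forall p, 1 <= p -> p <= k -> p != h -> p != q -> c.-1 < pat y p -> Exit t' p (pat y p),
      forall x, c.-1 < x -> x <= n -> e_right (t' x) = edge t' x &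
      (forall p, 1 <= p -> p <= n -> c.-1 < pat v p -> e_top (t' (pat v p)) = (p < k)) /\
      forall p q, 1 <= p -> p < q -> q < k -> pat v q < pat v p -> c.-1 < pat v q ->
        t' (pat v p) = ElbowTL -> ~ hrun t' (pat v q).-1 (pat v p).-1].
Proof.
move=> TR TT Tq TLR t'.
have E x : c < x -> t' x = t x by move=> cx; rewrite /t' /upd gtn_eqF.
have Ec : t' c = T by rewrite /t' /upd eqxx.
have edgeE x : c <= x -> edge t' x = edge t x by move=> cx; rewrite /edge E.
have open' : h != 0 -> open t' h c.
  move=> h0; have [h1 hk hc TL hr] := bs_open B h0.
  split=> // [hk'|]; last exact/hrun_upd.
  rewrite E ?TL // ltnNge; apply/negP => /hc Eh; by rewrite Eh ltnn in hk'.
split=> //.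
- by rewrite /edge prednK // Ec (_ : _ == _ = false) //; move: c1 cn; clia.
- move=> p p1 pk ph pq lt; have pn := leq_trans pk kn.
  have cp : c < pat y p by have := bs_neq p1 pn pq; move: lt c1; clia.
  by apply: Exit_upd => //; apply: (bs_done B).
- move=> x; rewrite prednK // leq_eqVlt => /orP[/eqP <- _|cx xn].
    by rewrite Ec edgeE // TR (bs_edge B).
  by rewrite E // edgeE ?(ltnW cx) // (bs_right B).
split.
  move=> p p1 pn; rewrite prednK // leq_eqVlt => /orP[/eqP Ep|cx].
    have -> : p = q by apply: (perm_inj Hv); rewrite ?p1 ?q1 // -Ep Eq.
    by rewrite Eq Ec TT.
  by rewrite E // (bs_top B).
move=> p r p1 pr rk vv; rewrite prednK // leq_eqVlt => /orP[/eqP Er|cr].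
  rewrite -Er in vv *; rewrite E // => TL hr.
  have Erq : r = q.
    by apply: (perm_inj Hv); rewrite ?q1 ?(leq_trans p1 (ltnW pr)) ?(leq_trans (ltnW rk) kn) // -Er Eq.
  subst r; have hT : hz T by rewrite -Ec; apply: hr; rewrite ?prednK //; move: vv; clia.
  have [TL1 TR1] := andP hT; have h0 := TLR TL1 TR1.
  have [h1 hk hc _ _] := bs_open B h0.
  have pk := ltn_trans pr rk; have pn := leq_trans (ltnW pk) kn.
  have Eph : p = h.
    apply/eqP/negPn/negP => ph.
    have yp : c < pat y p.
      rewrite ltnNge; apply/negP => le.
      by have := low Hy (bs_low B) p1 pn le; move: le vv; clia.
    case: (bs_done B p1 (ltnW pk) ph yp) => [[_ b _]|[_ d1 ds RB _]]; first by rewrite TL in b.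
    have : hz (t' (pat y p)); last by rewrite E // RB.
    apply: hr; first by move: yp; clia.
    by move: ds; rewrite /start pk.
  by have := Tq h0 rk TL1; rewrite -Eph => /(_ pk); move: pr; clia.
rewrite !E //; last exact: ltn_trans vv.
move=> TL hr; apply: (bs_nc B p1 pr rk vv cr TL).
by apply/(@hrun_upd t c T) => //; move: cr; clia.
Qed.

Lemma bs_lab_pred : q <= k -> all (fun l => l <= c.-1) (pairmap swapmin u cs1).
Proof.
move=> qk; case: (moves_dec (bs_path B) (bs_last B) Hy) => [-> //|[a M]].
have [cs' [x [b [E1 E2 T /andP[ak kb] [le S lt]]]]] := moves_lab (bs_sort B) (bs_lab B) M.
have [_ ab _ _ Eb] := tstep_vals T.
have bq : pat y b != c.
  by apply: bs_neq; move: ab kb qk; clia.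
have le' : pat x a <= c.-1 by move: bq le; rewrite Eb; clia.
rewrite E1 -cats1 pairmap_cat /= all_cat E2 (tstep_swapmin T) /= le' !andbT.
by apply: lt; apply: leq_trans le' _; exact: leqnSn.
Qed.

Lemma bs_low_pred p : 1 <= p -> p <= n -> pat v p <= c.-1 -> pat y p = pat v p.
Proof. by move=> p1 pn le; apply: (bs_low B) => //; apply: leq_trans le _; exact: leq_pred. Qed.

Let Lo := bs_low_pred.

Lemma bs_edgeE T : edge (upd t c T) c.-1 = e_left T.
Proof. by rewrite /edge prednK // /upd eqxx (_ : _ == _ = false) //; move: c1 cn; clia. Qed.

(** With no pipe running, a pipe from above turns left exactly if the next step to realise moves its
    position. *)
Lemma bs_step_off : h = 0 -> exists t' y' h' cs', bscan c.-1 t' y' h' cs'.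
Proof.
move=> h0; have vkc : c < pat v k.
  by rewrite ltnNge; apply/negP => /(bs_first B) E; move: k1; rewrite -E h0.
have vkc' : pat v k <= c.-1 -> False by move: vkc; clia.
have off a : moves cs1 y a -> a != q -> pat y a <= c.-1.
  move=> M aq; have := bs_off B h0 M; case: (M) => s [b [_ T ak kb]].
  have [a1 _ _ _ _] := tstep_vals T.
  by have := bs_neq a1 (leq_trans ak kn) aq; clia.
have [qk|kq|Ek] := ltngtP q k; last by move: vkc; rewrite -Ek Eq ltnn.
- have [M|M] := moves_em q (bs_path B) (bs_last B) Hy.
  + have [|||//|_ _ U1 U2 [U3 U4]] := @bs_upd ElbowTL; rewrite ?h0 ?qk //.
    exists (upd t c ElbowTL), y, q, cs1; split=> //.
    * exact/bs_lab_pred/ltnW.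
    * by rewrite bs_edgeE -lt0n q1.
    * move=> _; split=> //; [exact: ltnW|by rewrite Eq; move: c1; clia|by rewrite /upd Eq eqxx|].
      by rewrite /start qk Eq; apply: hrun_refl.
    * by move=> E; move: q1; rewrite E.
    * by move=> p p1 pk pq; apply: U1 => //; rewrite h0 -lt0n.
  + have [|||//|_ _ U1 U2 [U3 U4]] := @bs_upd Vert; rewrite ?h0 ?qk //.
    exists (upd t c Vert), y, 0, cs1; split=> //.
    * exact/bs_lab_pred/ltnW.
    * by rewrite bs_edgeE.
    * by move=> _ a Ma; apply: off => //; apply/eqP => E; subst a.
    * move=> p p1 pk p0 lt; have [E|pq] := eqVneq p q; last by apply: U1; rewrite ?h0.
      by subst p; left; rewrite Eyq Eq /upd eqxx.
- have [||||_ _ U1 U2 [U3 U4]] := @bs_upd Blank; rewrite ?h0 //.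
    by rewrite /= ltnNge (ltnW kq).
  exists (upd t c Blank), y, 0, cs1; split=> //.
  + case: (moves_dec (bs_path B) (bs_last B) Hy) => [-> //|[a M]].
    have [cs' [x [b [E1 E2 T /andP[ak kb] [le S lt]]]]] := moves_lab (bs_sort B) (bs_lab B) M.
    have [_ _ F Ea _] := tstep_vals T.
    have aq : a != q by rewrite neq_ltn (leq_ltn_trans ak kq).
    have le' : pat x a <= c.-1 by have := off a M aq; move: F; rewrite Ea; clia.
    rewrite E1 -cats1 pairmap_cat /= all_cat E2 (tstep_swapmin T) /= le' !andbT.
    by apply: lt; apply: leq_trans le' _; exact: leqnSn.
  + by rewrite bs_edgeE.
  + move=> _ a Ma; apply: off => //; case: (Ma) => s [b [_ _ ak _]].
    by rewrite neq_ltn (leq_ltn_trans ak kq).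
  + move=> p p1 pk p0 lt; apply: U1 => //; rewrite ?h0 //.
    by rewrite neq_ltn (leq_ltn_trans pk kq).
Qed.

Lemma bs_open_gt : h != 0 -> c < pat v k -> c < pat v h /\ c < pat y h.
Proof.
move=> h0 vkc; have [h1 hk hc _ _] := bs_open B h0.
have vh : c < pat v h.
  by rewrite ltnNge; apply/negP => le; move: (le); rewrite (hc le) leqNgt vkc.
split=> //; rewrite ltnNge; apply/negP => le.
by have := low Hy (bs_low B) h1 (leq_trans hk kn) le; move: le vh; clia.
Qed.

Lemma bs_step_cross : h != 0 -> q < k -> exists t' y' h' cs', bscan c.-1 t' y' h' cs'.
Proof.
move=> h0 qk; have [h1 hk hc _ hr] := bs_open B h0.
have qh : q != h.
  by apply/eqP => E; move: qk; rewrite E (hc _) ?ltnn // -E Eq.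
have lab : c.-1 < pat v k -> c < pat v k.
  have : pat v k != c.
    by rewrite -Eq; apply: (pat_neq Hv); rewrite ?k1 ?q1 //; move: qk; clia.
  by move: c1; clia.
have [||||_ U0 U1 U2 [U3 U4]] := @bs_upd Cross; rewrite ?h0 ?qk //.
  (* If [h < q], the entry [c] at [q] would lie between the positions and values of the last step,
     which moves [h]. *)
  move=> _ _ _ hk'; have vkc : c < pat v k.
    by rewrite ltnNge; apply/negP => /(bs_first B) E; move: hk'; rewrite E ltnn.
  have [vh yh] := bs_open_gt h0 vkc.
  have [cs' [x [b [E1 E2 T /andP[ak kb] [le S lt]]]]] := moves_lab (bs_sort B) (bs_lab B) (bs_on B h0 vkc).
  have [_ ab F Ea Eb] := tstep_vals T.
  rewrite ltnNge; apply/negP => hq.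
  have qb : q != b by move: qk kb; clia.
  have Eb' : pat y b != c by apply: bs_neq; move: ab qb; rewrite 1?eq_sym; clia.
  have Ex : pat x q = c by rewrite -(tstep_out T q1 qh qb).
  apply: (tstep_no (x := q) T); rewrite ?Ex -?Ea -?Eb //.
  - by move: hq qh; clia.
  - by move: qk kb; clia.
  - by move: le Eb'; rewrite Eb; clia.
exists (upd t c Cross), y, h, cs1; split=> //.
- exact/bs_lab_pred/ltnW.
- by rewrite bs_edgeE h0.
- move=> _; have [_ _ _ TL hr'] := U0 h0; split=> //.
    by move=> le; apply: hc; apply: leq_trans le (leq_pred _).
  by apply: hrun_ext hr'; rewrite /upd eqxx.
- by move=> _ /lab; apply: (bs_on B).
- by move=> E; rewrite E in h0.
- by move=> le; apply: (bs_first B); apply: leq_trans le (leq_pred _).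
- move=> p p1 pk ph lt; have [E|pq] := eqVneq p q; last exact: U1.
  by subst p; left; rewrite Eyq Eq /upd eqxx.
Qed.

Lemma bs_step_first : h != 0 -> q = k -> exists t' y' h' cs', bscan c.-1 t' y' h' cs'.
Proof.
move=> h0 Eqk; have Ek : pat v k = c by rewrite -Eqk.
have Eh : h = k by apply: (bs_first B); rewrite Ek.
have [h1 hk hc TL hr] := bs_open B h0.
have yk : pat y k = c by rewrite -Eqk.
have vk' : ~ (pat v k <= c.-1) by rewrite Ek; move: c1; clia.
have nq : q < k = false by rewrite Eqk ltnn.
have [M|M] := moves_em k (bs_path B) (bs_last B) Hy.
- have [||||_ U0 U1 U2 [U3 U4]] := @bs_upd Horiz; rewrite ?h0 ?nq //.
  exists (upd t c Horiz), y, k, cs1; split=> //.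
  + by apply: bs_lab_pred; rewrite Eqk.
  + by rewrite bs_edgeE -lt0n k1.
  + move=> _; have := U0 h0; rewrite Eh => -[_ _ _ TL' hr']; split=> //.
    by apply: hrun_ext hr'; rewrite /upd eqxx.
  + by move=> E; move: k1; rewrite E.
  + by move=> p p1 pk pk'; apply: U1; rewrite ?Eh ?Eqk.
- have [||||_ U0 U1 U2 [U3 U4]] := @bs_upd ElbowRB; rewrite ?h0 ?nq //.
  exists (upd t c ElbowRB), y, 0, cs1; split=> //.
  + by apply: bs_lab_pred; rewrite Eqk.
  + by rewrite bs_edgeE.
  + move=> _ a Ma; have [cs' [x [b [E1 E2 T /andP[ak kb] [le S lt]]]]] := moves_lab (bs_sort B) (bs_lab B) Ma.
    have [a1 ab F Ea Eb] := tstep_vals T.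
    have nak : a != k by apply/eqP => E; subst a.
    have ka : k != a by rewrite eq_sym.
    have kb' : k != b by move: kb; clia.
    have xk : pat x k = c by rewrite -(tstep_out T k1 ka kb').
    rewrite leqNgt; apply/negP => gt.
    have ya : pat y a != c by apply: bs_neq; rewrite ?Eqk // (leq_trans ak kn).
    have yb : pat y b != c by apply: bs_neq; move: ab kb' kb; rewrite ?Eqk; clia.
    apply: (tstep_no (x := k) T) => //; rewrite ?xk -?Ea -?Eb.
    * by move: ak nak; clia.
    * by move: le yb; rewrite Eb; clia.
    * by move: gt ya c1; clia.
  + move=> p p1 pk _ lt; have [E|pk'] := eqVneq p k; last by apply: U1; rewrite ?Eh ?Eqk.
    subst p; right; rewrite yk; split=> //; [by rewrite ltnn|by rewrite /start ltnn|by rewrite /upd eqxx|].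
    by apply/hrun_upd => //; move: hr; rewrite Eh /start ltnn.
Qed.

(** Here the running pipe realises the last step of the chain. The upper position of that step is
    [q]: otherwise the entry [c] obstructs it, because the entries beyond [k] decrease. The pipe
    runs on exactly if the preceding step moves the same position. *)
Lemma bs_step_tail : h != 0 -> k < q -> exists t' y' h' cs', bscan c.-1 t' y' h' cs'.
Proof.
move=> h0 kq; have [h1 hk hc TL hr] := bs_open B h0.
have vkc : c < pat v k by rewrite -Eq; apply: tail_lt.
have vkc' : pat v k <= c.-1 -> False by move: vkc; clia.
have [vh yh] := bs_open_gt h0 vkc.
have hq : h != q by move: hk kq; clia.
have M := bs_on B h0 vkc.
have [cs' [x [b [E1 E2 T /andP[ak kb] [le S lt]]]]] := moves_lab (bs_sort B) (bs_lab B) M.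
have [_ ab F Ea Eb] := tstep_vals T.
have [Hx _ _ _ _] := T.
have Ebq : b = q.
  apply/eqP/negPn/negP => bq.
  have yb : pat y b != c by apply: bs_neq => //; move: ab; clia.
  have qh : q != h by rewrite eq_sym.
  have qb : q != b by rewrite eq_sym.
  have Ex : pat x q = c by rewrite -(tstep_out T q1 qh qb).
  have yb' : pat y b < c by move: le yb; rewrite Eb; clia.
  have qb' : q < b.
    rewrite ltnNge; apply/negP => bq'.
    have := bs_dec B kb (_ : b < q) qn; rewrite Eyq => /(_ _); move: bq' bq yb'; clia.
  by apply: (tstep_no (x := q) T); rewrite ?Ex -?Ea -?Eb //; move: hk kq; clia.
subst b; have xh : pat x h = c by rewrite -Eb.
have xq : pat x q = pat y h by [].
have out p : 1 <= p -> p != h -> p != q -> pat x p = pat y p.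
  by move=> p1 ph pq; rewrite (tstep_out T).
have Dx : dec n k x := dec_back T ak (bs_dec B).
have Px : path (kcover k) u cs' by move: (bs_path B); rewrite E1 rcons_path => /andP[].
have lab' : all (fun l => l <= c.-1) (pairmap swapmin u cs').
  by apply: lt; rewrite prednK // xh.
have low' p : 1 <= p -> p <= n -> pat v p <= c.-1 -> pat x p = pat v p.
  move=> p1 pn lep; rewrite out //; first exact: Lo.
    by apply/eqP => E; move: lep vh; rewrite E; clia.
  by apply/eqP => E; move: lep c1; rewrite E Eq; clia.
have nq : q < k = false by rewrite ltnNge (ltnW kq).
have pkq p : p <= k -> p != q by move=> pk; rewrite neq_ltn (leq_ltn_trans pk kq).
have [M'|M'] := moves_em h Px E2 Hx.
- have [||||_ U0 U1 U2 [U3 U4]] := @bs_upd Horiz; rewrite ?h0 ?nq //.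
  exists (upd t c Horiz), x, h, cs'; split=> //.
  + by rewrite bs_edgeE h0.
  + move=> _; have [_ _ _ TL' hr'] := U0 h0; split=> //.
      by move=> lev; apply: hc; apply: leq_trans lev (leq_pred _).
    by apply: hrun_ext hr'; rewrite /upd eqxx.
  + by move=> E; rewrite E in h0.
  + by move=> p p1 pk ph; rewrite out ?pkq //; apply: U1 => //; apply: pkq.
- have [||||_ U0 U1 U2 [U3 U4]] := @bs_upd ElbowRB; rewrite ?h0 ?nq //.
  exists (upd t c ElbowRB), x, 0, cs'; split=> //.
  + by rewrite bs_edgeE.
  + move=> _ a Ma.
    have [cs2 [x2 [b2 [_ E3 T2 /andP[ak2 kb2] [le2 _ _]]]]] := moves_lab S lab' Ma.
    have [a1 ab2 F2 Ea2 Eb2] := tstep_vals T2.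
    have ah : a != h by apply/eqP => E; subst a.
    have xa : pat x a != c.
      by rewrite -xh; apply: (pat_neq Hx); rewrite ?h1 ?a1 ?(leq_trans hk kn) // (leq_trans ak2 kn).
    rewrite leqNgt; apply/negP => gt.
    have gt' : c < pat x a by move: gt xa c1; clia.
    have b2lt : pat x b2 < c by rewrite Eb2; move: le2 c1; clia.
    have qb2 : q < b2.
      rewrite ltnNge; apply/negP; rewrite leq_eqVlt => /orP[/eqP E|b2q].
        by move: b2lt; rewrite E xq; move: yh; clia.
      by have := Dx _ _ kb2 b2q qn; rewrite xq; move: b2lt yh; clia.
    have b2n : b2 <= n by case/andP: ab2.
    have Dx2 := dec_back T2 ak2 Dx.
    have x2q : pat x2 q = pat y h.
      rewrite -xq (tstep_out T2) //; [|by move: qb2; clia].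
      by move: ak2 kq; clia.
    have zlt : pat x a < pat y h by have := Dx2 _ _ kq qb2 b2n; rewrite x2q Ea2.
    (* Whichever of [a] and [h] lies further right obstructs the step of the other one. *)
    case: (ltngtP a h) ah => // ah _.
    * have x2h : pat x2 h = c.
        rewrite -xh (tstep_out T2) //; first by move: ah; clia.
        by move: hk kb2; clia.
      apply: (tstep_no (x := h) T2) => //; rewrite ?x2h -?Ea2 -?Eb2 //.
      by move: hk kb2; clia.
    * apply: (tstep_no (x := a) T) => //; rewrite ?xh ?xq //.
      by move: ak2 kq; clia.
  + move=> p p1 pk _ ltp; have [E|ph] := eqVneq p h.
      subst p; right; rewrite xh; have [_ _ _ TL' _] := U0 h0; split=> //.
      * by rewrite /start; case: ifP => _ //; move: vh; clia.
      * by rewrite /upd eqxx.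
      * exact/hrun_upd.
    by rewrite out ?pkq //; apply: U1; rewrite ?pkq // -out ?pkq.
Qed.

Lemma bs_step_any : exists t' y' h' cs', bscan c.-1 t' y' h' cs'.
Proof.
have [h0|h0] := eqVneq h 0; first exact: bs_step_off.
by case: (ltngtP q k) => [||E]; [exact: bs_step_cross|exact: bs_step_tail|exact: bs_step_first].
Qed.
End Step.

Lemma chain_to_row : exists t, [/\ rowok t, forall p, 1 <= p -> p <= k -> Exit t p (pat u p) &
  forall p q, 1 <= p -> p < q -> q < k -> pat v q < pat v p -> pat u q < pat u p].
Proof.
have [t [y [h [cs1 S]]]] : exists t y h cs1, bscan 0 t y h cs1.
  rewrite -(subnn n); have := leqnn n; elim: {-2 3}n => [|d IH] dn.
    by rewrite subn0; exists (fun=> Blank), v, k, cs; apply: bscan_init.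
  have [t [y [h [cs1 S]]]] := IH (ltnW dn).
  have Hc : 1 <= n - d <= n by rewrite subn_gt0 dn leq_subr.
  have [q /andP[q1 qn] Eq] := perm_surj Hv Hc; have [c1 cn] := andP Hc.
  by rewrite subnS; apply: (bs_step_any c1 cn S q1 qn Eq).
have E0 : edge t 0 = e_left (t 1) by rewrite /edge (_ : 0 == n = false) //; move: k1 kn; clia.
have [Hy Dy] := (bs_perm S, bs_dec S).
have noM a : ~ moves cs1 y a.
  move=> M; have [cs' [x [b [_ _ T _ [le _ _]]]]] := moves_lab (bs_sort S) (bs_lab S) M.
  have [a1 ab _ _ _] := tstep_vals T; have [Hx _ _ _ _] := T.
  have Ha : 1 <= a <= n by move: a1 ab; clia.
  by have := perm_range Hx Ha; move: le; clia.
have h0 : h = 0.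
  apply/eqP/negPn/negP => h0; have Hk : 1 <= k <= n by rewrite k1.
  have [vk _] := andP (perm_range Hv Hk).
  exact: (noM h (bs_on S h0 vk)).
have Euy : y = u.
  by case: (moves_dec (bs_path S) (bs_last S) Hy) => [E|[a /noM //]]; rewrite -(bs_last S) E.
subst y h; exists t; split.
- split.
  + move=> c c1 cn; rewrite (bs_right S) ?(ltnW cn) //.
    by rewrite /edge (ltn_eqF cn).
  + by rewrite -E0 -(bs_edge S).
  + rewrite (bs_right S) //; first by rewrite /edge eqxx.
    exact: leq_trans k1 kn.
  + move=> p p1 pn; apply: (bs_top S) => //.
    by have := perm_range Hv (_ : 1 <= p <= n); rewrite p1 pn => /(_ isT) /andP[].
- move=> p p1 pk; apply: (bs_done S) => //; first by rewrite -lt0n.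
  by have := perm_range Hu (_ : 1 <= p <= n); rewrite p1 (leq_trans pk kn) => /(_ isT) /andP[].
- move=> p q p1 pq qk vv; rewrite ltnNge; apply/negP => le.
  have q1 : 1 <= q := leq_trans p1 (ltnW pq).
  have pk := ltn_trans pq qk.
  have Hp : 1 <= p <= n by rewrite p1 (leq_trans (ltnW pk) kn).
  have Hq : 1 <= q <= n by rewrite q1 (leq_trans (ltnW qk) kn).
  have lt : pat u p < pat u q.
    have : pat u p != pat u q by apply: (pat_neq Hu) => //; move: pq; clia.
    by move: le; clia.
  have dn r : 1 <= r -> r < k -> 1 <= r <= n -> Exit t r (pat u r).
    move=> r1 rk Hr; apply: (bs_done S) => //; [exact: ltnW|by rewrite -lt0n|].
    by have /andP[] := perm_range Hu Hr.
  have uq : pat u q <= pat v q.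
    case: (dn q q1 qk Hq) => [[_ _ -> //]|[_ _ ds _ _]].
    by apply: leq_trans ds _; rewrite /start qk leq_pred.
  have [vq _] := andP (perm_range Hv Hq).
  (* To exit left of pipe [q], pipe [p] would have to turn and run past column [pat v q], which
     [bs_nc] excludes. *)
  case: (dn p p1 pk Hp) => [[_ _ E]|[TL _ _ RB hr]].
    by move: lt uq vv; rewrite E; clia.
  apply: (bs_nc S p1 pq qk vv vq (TL pk)) => z zq zp; move: hr; rewrite /start pk; apply=> //.
  by move: lt uq zq; clia.
Qed.
End Chain_to_row.
End Row.

(** * Exits and crossings within one row of a bumpless pipe dream *)

Section RowExit.
Variables (n k : nat) (v : seq nat) (t : nat -> tile).
Hypotheses (Hv : is_perm n v) (k1 : 1 <= k) (kn : k <= n) (W : rowok n k v t).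

Lemma left_run s : 1 <= s -> s <= n -> e_right (t s) ->
  exists d, [/\ 1 <= d, d <= s, t d = ElbowRB & hrun t d s].
Proof.
have [W1 W2 _ _] := W; elim: s => // s IH _ sn r.
case: (boolP (e_left (t s.+1))) => l; last first.
  exists s.+1; split=> //; first by case: (t s.+1) r l.
  exact: hrun_refl.
case: (posnP s) => [s0|s0]; first by rewrite s0 (negbTE W2) in l.
have [|d [d1 ds RB hr]] := IH s0 (ltnW sn); first by rewrite W1.
exists d; split=> //; first exact: leqW.
move=> x dx; rewrite leq_eqVlt => /orP[/eqP -> |]; first by rewrite /hz l r.
exact: hr.
Qed.

Lemma row_col p : 1 <= p -> p < k -> 1 <= pat v p /\ pat v p <= n.
Proof. by move=> p1 pk; apply/andP/(perm_range Hv); rewrite p1 (leq_trans (ltnW pk) kn). Qed.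

Lemma row_top p : 1 <= p -> p < k -> e_top (t (pat v p)).
Proof. by have [_ _ _ W4] := W; move=> p1 pk; rewrite W4 // (leq_trans (ltnW pk) kn). Qed.

Lemma Exit_ex p : 1 <= p -> p <= k -> exists d, Exit n k v t p d.
Proof.
have [W1 W2 W3 W4] := W; move=> p1; rewrite leq_eqVlt => /orP[/eqP ->|pk].
  have [d [d1 dn RB hr]] := left_run (leq_trans k1 kn) (leqnn n) W3.
  by exists d; right; rewrite /start ltnn; split.
have [v1 vn] := row_col p1 pk; have T := row_top p1 pk.
case: (boolP (e_bot (t (pat v p)))) => b; first by exists (pat v p); left.
have TL : t (pat v p) = ElbowTL by case: (t _) T b.
have l : e_left (t (pat v p)) by rewrite TL.
have v2 : 1 < pat v p.
  by rewrite ltn_neqAle v1 andbT; apply/eqP => E; move: W2; rewrite E l.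
have [|||d [d1 dn RB hr]] := @left_run (pat v p).-1.
- by move: v2; clia.
- by move: vn; clia.
- rewrite W1 ?prednK //; first by move: v2; clia.
- by exists d; right; rewrite /start pk; split.
Qed.

Lemma Exit_bot p d : Exit n k v t p d -> e_bot (t d).
Proof. by case=> [[_ b ->] //|[_ _ _ -> _]]. Qed.

Lemma Exit_le p d : 1 <= p -> p <= k -> Exit n k v t p d ->
  1 <= d /\ d <= (if p < k then pat v p else n).
Proof.
move=> p1 _ [[pk _ ->]|[_ d1 ds _ _]]; first by rewrite pk; have [] := row_col p1 pk.
split=> //; apply: leq_trans ds _; rewrite /start; case: ifP => // _; exact: leq_pred.
Qed.

Lemma Exit_fun p d d' : Exit n k v t p d -> Exit n k v t p d' -> d = d'.
Proof.
case=> [[pk b ->]|[TL d1 ds RB hr]]; case=> [[pk' b' ->]|[TL' d1' ds' RB' hr']] //.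
- by rewrite TL' in b.
- by rewrite TL in b'.
- have [lt|lt|//] := ltngtP d d'.
    by have := hr _ lt ds'; rewrite RB'.
  by have := hr' _ lt ds; rewrite RB.
Qed.

(** If nothing enters from above, the pipe is traced back to the right until an [ElbowTL] or the
    right border; the induction is on the distance to that border. *)
Lemma bot_Exit c : 1 <= c -> c <= n -> e_bot (t c) ->
  exists p, [/\ 1 <= p, p <= k & Exit n k v t p c].
Proof.
move=> c1 cn b; have [W1 W2 W3 W4] := W.
have Hc : 1 <= c <= n by rewrite c1.
have [p /andP[p1 pn] Ep] := perm_surj Hv Hc.
case: (boolP (e_top (t c))) => T.
  have pk : p < k by rewrite -W4 ?Ep.
  by exists p; split=> //; [exact: ltnW|left; rewrite Ep].
have RB : t c = ElbowRB by case: (t c) b T.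
have : forall d s, s = n - d -> c <= s -> hrun t c s -> e_right (t s) ->
   exists p, [/\ 1 <= p, p <= k & Exit n k v t p c].
  elim=> [|d IH] s Es cs hr r.
    exists k; split=> //; right; rewrite /start ltnn; split=> //.
    by move: hr; rewrite Es subn0.
  case: (ltnP s n) => sn; last by apply: IH hr r => //; move: Es sn cs c1; clia.
  have l : e_left (t s.+1) by rewrite -W1 // (leq_trans c1).
  case E : (t s.+1) (l) => // _.
  - apply: (IH s.+1); [by move: Es sn cs c1; clia|exact: leqW| |by rewrite E].
    by move=> x cx; rewrite leq_eqVlt => /orP[/eqP -> |]; [rewrite E|apply: hr].
  - apply: (IH s.+1); [by move: Es sn cs c1; clia|exact: leqW| |by rewrite E].
    by move=> x cx; rewrite leq_eqVlt => /orP[/eqP -> |]; [rewrite E|apply: hr].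
  - have Hs : 1 <= s.+1 <= n by rewrite sn.
    have [r0 /andP[r1 rn] Er] := perm_surj Hv Hs.
    have rk : r0 < k by rewrite -W4 // Er E.
    exists r0; split=> //; first exact: ltnW.
    by right; rewrite /start rk Er.
by move=> H; apply: (H (n - c) c) => //; [rewrite subKn|exact: hrun_refl|rewrite RB].
Qed.

(* Pipe p enters the row to the left of pipe q (pipe k enters from the right). *)
Definition before p q := p < k /\ (q < k -> pat v p < pat v q).

Definition common p q d d' x :=
  [&& d <= x <= (if p < k then pat v p else n), d' <= x <= (if q < k then pat v q else n) & is_cross (t x)].

Section Pair.
Variables (p q d d' : nat).
Hypotheses (p1 : 1 <= p) (q1 : 1 <= q) (qk : q <= k) (B : before p q).
Hypotheses (Ep : Exit n k v t p d) (Eq : Exit n k v t q d').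

Let pk : p < k. Proof. by case: B. Qed.

Lemma before_start : pat v p <= start n k v q.
Proof.
rewrite /start; case: ifP => qk'; last by have [] := row_col p1 pk.
by have := proj2 B qk'; clia.
Qed.

Lemma TL_not_run x : t (pat v p) = ElbowTL -> x < pat v p -> hrun t x (start n k v q) -> False.
Proof. by move=> TL xp hr; have := hr _ xp before_start; rewrite TL. Qed.

Lemma Exit_inj : d != d'.
Proof.
apply/eqP => E; subst d'; have T := row_top p1 pk.
have Tq qk' := row_top q1 qk'.
case: Ep Eq => [[_ b Ed]|[TL d1 ds RB hr]] [[qk' b' Ed']|[TL' d1' ds' RB' hr']].
- by have := proj2 B qk'; rewrite -Ed -Ed' ltnn.
- by rewrite -Ed RB' in T.
- by have := Tq qk'; rewrite -Ed' RB.
- apply: (TL_not_run (TL pk) _ hr'); move: ds; rewrite /start pk.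
  by have [] := row_col p1 pk; move: d1; clia.
Qed.

(** If [p] turns left, its elbow stops any run of [q] from further right. So the two meet only where
    [p] goes straight down and [q] runs across. *)
Lemma common_eq x : common p q d d' x -> x = pat v p.
Proof.
rewrite /common pk => /and3P[/andP[dx xp] /andP[dx' xq] cx].
case: Ep => [[_ b Ed]|[TL d1 ds RB hr]]; first by move: dx xp; rewrite Ed; clia.
have xp' : x < pat v p.
  by rewrite ltn_neqAle xp andbT; apply/eqP => E; move: cx; rewrite E TL.
case: Eq => [[qk' b' Ed']|[TL' d1' ds' RB' hr']].
  by have := proj2 B qk'; move: xp' dx'; rewrite Ed'; clia.
have ne : d' != x by apply/eqP => E; move: cx; rewrite -E RB'.
exfalso; apply: (TL_not_run (TL pk) _ hr'); move: ne dx' xp'; clia.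
Qed.

Lemma common_at : common p q d d' (pat v p) = (d' < d).
Proof.
have [v1 vn] := row_col p1 pk; have T := row_top p1 pk.
have [d1 dp] := Exit_le p1 (ltnW pk) Ep; rewrite pk in dp.
apply/idP/idP.
- rewrite /common pk => /and3P[/andP[_ _] /andP[dx' xq] cx].
  case: Ep => [[_ b ->]|[TL _ _ _ _]]; last by rewrite TL in cx.
  rewrite ltn_neqAle dx' andbT; apply/eqP => E.
  case: Eq => [[qk' b' Ed']|[_ _ _ RB _]]; last by move: cx; rewrite -E RB.
  by have := proj2 B qk'; rewrite -Ed' E ltnn.
- move=> lt; case: Eq => [[qk' b' Ed']|[_ _ ds' _ hr']].
    by have := proj2 B qk'; move: lt dp; rewrite Ed'; clia.
  have H : hz (t (pat v p)) by apply: hr'; [apply: leq_trans dp|exact: before_start].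
  have C : t (pat v p) = Cross by case: (t _) H T.
  rewrite /common pk C dp leqnn (ltnW (leq_trans lt dp)) /= andbT.
  by apply: leq_trans before_start _; rewrite /start; case: ifP => // _; apply: leq_pred.
Qed.
End Pair.

Definition span p := if p < k then pat v p else n.

Definition rowcnt p q d d' :=
  count (fun x => (d' <= x <= span q) && is_cross (t x)) (iota d (span p - d).+1).

Lemma rowcntE p q d d' x0 : d <= span p ->
  (forall x, common p q d d' x -> x = x0) -> rowcnt p q d d' = common p q d d' x0.
Proof.
move=> dp H; rewrite /rowcnt (eq_in_count (a2 := common p q d d')); last first.
  move=> x; rewrite mem_iota /common -!/(span _) => Hx.
  by have -> // : d <= x <= span p by move: Hx dp; clia.
rewrite (@count_one _ _ _ x0) //; case E : (common _ _ _ _ _); last by rewrite andbF.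
by move: E; rewrite /common -!/(span _) => /andP[Hx _]; rewrite andbT; move: Hx; clia.
Qed.

Lemma commonC p q d d' x : common p q d d' x = common q p d' d x.
Proof. by rewrite /common andbCA. Qed.

Lemma rowcnt_before p q d d' : 1 <= p -> 1 <= q -> q <= k -> before p q ->
  Exit n k v t p d -> Exit n k v t q d' ->
  rowcnt p q d d' = (d' < d) /\ rowcnt q p d' d = (d' < d).
Proof.
move=> p1 q1 qk B Ep Eq; have pk : p <= k by case: B => /ltnW.
have [_ dp] := Exit_le p1 pk Ep; have [_ dq] := Exit_le q1 qk Eq.
have U := common_eq p1 B Ep Eq; have A := common_at p1 B Ep Eq.
rewrite (rowcntE dp U) A; split=> //.
rewrite (@rowcntE q p d' d (pat v p)) //; first by rewrite commonC A.
by move=> x; rewrite commonC; apply: U.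
Qed.
End RowExit.

(** The fuel-free form of [bpd_trace]: in row [k.+1] the pipe has left through the bottom. *)
Inductive bprun D k : nat -> nat -> bool -> seq (nat * nat) -> nat -> Prop :=
| BpStop c : bprun D k k.+1 c false [::] c
| BpLeft r c fr l e : r <= k -> 1 <= c ->
    (if fr then hz (tileat D r c) : Prop else tileat D r c = ElbowTL) ->
    bprun D k r c.-1 true l e -> bprun D k r c fr ((r, c) :: l) e
| BpDown r c fr l e : r <= k ->
    (if fr then tileat D r c = ElbowRB else (e_top (tileat D r c) && e_bot (tileat D r c) : Prop)) ->
    bprun D k r.+1 c false l e -> bprun D k r c fr ((r, c) :: l) e.

Lemma bprun_trace D k r c fr l e : bprun D k r c fr l e ->
  forall f, size l < f -> bpd_trace D k f r c fr = (l, e).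
Proof.
elim=> {r c fr l e} [c|r c fr l e rk c1 H _ IH|r c fr l e rk H _ IH] [|f] //= lf.
- by rewrite ltnSn.
- rewrite ltnNge rk /=; case: fr H; last by move=> ->; rewrite IH.
  by case: (tileat D r c) => // _; rewrite IH.
- rewrite ltnNge rk /=; case: fr H; first by move=> ->; rewrite IH.
  by case: (tileat D r c) => // _; rewrite IH.
Qed.

Lemma bprun_size D k r c fr l e : bprun D k r c fr l e ->
  e <= c /\ size l = k.+1 - r + (c - e).
Proof.
elim=> {r c fr l e} [c|r c fr l e rk c1 H _ [IH1 IH2]|r c fr l e rk H _ [IH1 IH2]] /=.
- by rewrite !subnn.
- by rewrite IH2; move: rk c1 IH1; clia.
- by rewrite IH2; move: rk IH1; clia.
Qed.

Lemma bprun_row D k r c fr l e x : bprun D k r c fr l e -> x \in l -> x.1 <= k.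
Proof.
elim=> {r c fr l e} [c|r c fr l e rk c1 H _ IH|r c fr l e rk H _ IH] //=;
by rewrite inE => /orP[/eqP -> //|/IH].
Qed.

Lemma bprun_next D k r c fr l e l2 e2 : bprun D k r c fr l e ->
  bprun D k.+1 k.+1 e false l2 e2 -> bprun D k.+1 r c fr (l ++ l2) e2.
Proof.
move=> R R2; elim: R R2 => {r c fr l e} [c|r c fr l e rk c1 H _ IH|r c fr l e rk H _ IH] //= R2.
- by apply: BpLeft => //; [exact: leqW|exact: IH].
- by apply: BpDown => //; [exact: leqW|exact: IH].
Qed.

Definition cells r d s : seq (nat * nat) := [seq (r, x) | x <- rev (iota d (s - d).+1)].

Lemma cells_last r d s : d < s -> cells r d s = (r, s) :: cells r d s.-1.
Proof.
move=> ds; rewrite /cells; have -> : s - d = (s.-1 - d).+1 by move: ds; clia.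
rewrite iota_rcons rev_rcons map_cons; congr cons; congr pair.
by move: ds; clia.
Qed.

Lemma mem_cells r d s y : d <= s -> ((r, y) \in cells r d s) = (d <= y <= s).
Proof.
move=> ds; rewrite mem_map; last by move=> ? ? [].
by rewrite mem_rev mem_iota; move: ds; clia.
Qed.

Lemma bprun_hrun D k d s : 1 <= d -> d <= s -> tileat D k d = ElbowRB ->
  hrun (tileat D k) d s -> bprun D k k s true (cells k d s) d.
Proof.
move=> d1 + RB; elim: s => [|s IH]; first by rewrite leqNgt d1.
rewrite leq_eqVlt => /orP[/eqP E _|ds hr].
  by rewrite -E /cells subnn /=; apply: BpDown => //; apply: BpStop.
rewrite cells_last //; apply: BpLeft => //; first exact: hr.
apply: IH => // x dx xs; apply: hr => //; exact: leqW.
Qed.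

Lemma bpd_trace_prefix D k k' f f' r c fr : k <= k' -> f <= f' ->
  exists s, (bpd_trace D k' f' r c fr).1 = (bpd_trace D k f r c fr).1 ++ s.
Proof.
move=> kk; elim: f f' r c fr => [|f IH] [|f'] r c fr //= ff; try by eexists.
case: (ltnP k r) => rk; first by eexists.
rewrite ltnNge (leq_trans rk kk) /=.
have I r' c' fr' := IH f' r' c' fr' ff.
case: (tileat D r c) => //; case: fr => /=; try (by exists [::]);
match goal with |- context [(bpd_trace D k f ?r ?c ?fr).1] => case: (I r c fr) => s -> end; by exists s.
Qed.

Lemma bpd_reduced_leq n k k' D : k <= k' -> bpd_reduced n k' D -> bpd_reduced n k D.
Proof.
move=> kk R i j i1 ij jk; apply: leq_trans (R i j i1 ij (leq_trans jk kk)).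
have pre p : exists s, (bpd_pipe n k' D p).1 = (bpd_pipe n k D p).1 ++ s.
  by apply: bpd_trace_prefix => //; rewrite !ltnS leq_add2l.
have [s ->] := pre i; have [s' ->] := pre j.
rewrite count_cat; apply: leq_trans (leq_addr _ _); apply: sub_count => x /=.
by rewrite mem_cat => /andP[-> ->].
Qed.

Lemma exits_bot n k v t y p : is_perm n v -> is_perm n y -> 1 <= k -> k <= n ->
  rowok n k v t -> (forall q, 1 <= q -> q <= k -> Exit n k v t q (pat y q)) ->
  1 <= p <= n -> e_bot (t (pat y p)) = (p <= k).
Proof.
move=> Hv Hy k1 kn T E Hp; apply/idP/idP => [b|pk]; last first.
  by apply: (Exit_bot (E p _ pk)); case/andP: Hp.
have [c1 cn] := andP (perm_range Hy Hp).
have [r [r1 rk Er]] := bot_Exit Hv k1 T c1 cn b.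
have Hr : 1 <= r <= n by rewrite r1 (leq_trans rk kn).
by rewrite (perm_inj Hy Hp Hr) // (Exit_fun Er (E r r1 rk)).
Qed.

(** * The first $k$ rows of a bumpless pipe dream *)

Section Grid.
Variables (n : nat) (D : seq (seq tile)).
Hypotheses (n1 : 1 <= n) (W : bpd_wf n n D).

Definition bcnt k i j := count (fun x => (x \in (bpd_pipe n k D j).1) &&
  is_cross (tileat D x.1 x.2)) (bpd_pipe n k D i).1.

Lemma bprun_pipe k i l e : i <= k -> k <= n -> 1 <= i -> bprun D k i n true l e -> bpd_pipe n k D i = (l, e).
Proof.
move=> ik kn i1 R; apply: (bprun_trace R); have [en ->] := bprun_size R.
by move: i1 ik kn en; clia.
Qed.

(** The invariant of the induction on rows. By [fa_cnt] the pairs that have crossed are the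
    inversions, so whether the next row creates a second crossing can be read off the
    permutation. *)
Record facts k : Prop := Facts {
  fa_perm : is_perm n (bpd_perm n k D);
  fa_dec : dec n k (bpd_perm n k D);
  fa_run : forall p, 1 <= p -> p <= k -> bprun D k p n true (bpd_pipe n k D p).1 (pat (bpd_perm n k D) p);
  fa_bot : 0 < k -> forall p, 1 <= p -> p <= n ->
     e_bot (tileat D k (pat (bpd_perm n k D) p)) = (p <= k);
  fa_cnt : forall p q, 1 <= p -> p < q -> q <= k ->
     bcnt k p q = (pat (bpd_perm n k D) q < pat (bpd_perm n k D) p) }.

Lemma perm_tail k y f : is_perm n y -> dec n k y -> k <= n ->
  (forall p, 1 <= p -> p <= k -> pat y p = f p) ->
  y = map f (iota 1 k) ++ rev [seq c <- iota 1 n | c \notin map f (iota 1 k)].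
Proof.
move=> Hy Dy kn E; have Sy := is_perm_size Hy.
have Uy : uniq y by rewrite (perm_uniq Hy) iota_uniq.
have -> : map f (iota 1 k) = take k y.
  apply: (@eq_from_nth _ 0); first by rewrite size_map size_iota size_takel ?Sy.
  move=> i; rewrite size_map size_iota => ik.
  rewrite (nth_map 0) ?size_iota // nth_iota // add1n -E // nth_take //.
rewrite -{1}(cat_take_drop k y); congr cat.
apply: (@irr_sorted_eq _ gtn).
- by move=> a b c /= ba ac; apply: ltn_trans ac ba.
- by move=> a; rewrite /= ltnn.
- apply/(sortedP 0) => i; rewrite size_drop Sy !nth_drop => lt /=.
  by apply: (Dy (k + i).+1 (k + i.+1).+1); move: lt; clia.
- by rewrite rev_sorted; apply: (sorted_filter ltn_trans); apply: iota_ltn_sorted.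
- move=> x; rewrite mem_rev mem_filter mem_iota add1n ltnS -(is_perm_mem x Hy).
  move: Uy; rewrite -{1 4}(cat_take_drop k y) cat_uniq mem_cat => /and3P[_ /hasPn H _].
  case: (boolP (x \in drop k y)) => xd; last by rewrite orbF andNb.
  by rewrite orbT andbT (H x xd).
Qed.

Lemma bpd_perm0 : bpd_perm n 0 D = w0 n.
Proof. by rewrite /bpd_perm /= /w0; congr rev; apply/all_filterP/allP. Qed.

Lemma facts0 : facts 0.
Proof.
split=> //; rewrite ?bpd_perm0.
- by rewrite /is_perm /w0 perm_rev.
- exact: w0_dec.
- by move=> p p1 p0; move: (leq_trans p1 p0).
- by move=> p q p1 pq q0; move: (leq_trans pq q0).
Qed.

Section Row.
Variable k : nat.
Hypotheses (kn : k < n) (F : facts k).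

Let u := bpd_perm n k D.
Let t := tileat D k.+1.
Let Hu : is_perm n u := fa_perm F.
Let f p := (bpd_pipe n k.+1 D p).2.

Lemma grid_rowok : rowok n k.+1 u t.
Proof.
have [_ _ [A B] [C1 [C2 C3]]] := W; split.
- by move=> c c1 cn; apply: A; rewrite ?c1.
- exact: C1.
- exact: C3.
- move=> p p1 pn; have Hp : 1 <= p <= n by rewrite p1.
  have Hc := perm_range Hu Hp; rewrite ltnS.
  case: (posnP k) => [k0|k0]; last by rewrite -(fa_bot F k0 p1 pn) B // k0.
  by rewrite /t k0 leqNgt p1; apply/negbTE/C2.
Qed.

Lemma row_run p d : 1 <= p -> p <= k.+1 -> Exit n k.+1 u t p d ->
  bprun D k.+1 k.+1 (span n k.+1 u p) (p == k.+1) (cells k.+1 d (span n k.+1 u p)) d.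
Proof.
move=> p1 pk E; rewrite /span; case: ltnP => pk'; last first.
  have -> : p = k.+1 by apply/eqP; rewrite eqn_leq pk.
  rewrite eqxx; case: E => [[a _ _]|[_ d1 ds RB hr]]; first by move: (leq_ltn_trans pk' a); rewrite ltnn.
  by move: ds hr; rewrite /start ltnNge pk' /= => ds hr; apply: bprun_hrun.
rewrite (ltn_eqF pk'); have T := row_top kn grid_rowok p1 pk'.
case: E => [[_ b ->]|[TL d1 ds RB hr]].
  rewrite /cells subnn /=; apply: BpDown => //; last exact: BpStop.
  by rewrite T b.
move: ds hr; rewrite /start pk' => ds hr.
have dv : d < pat u p by move: ds d1; clia.
rewrite cells_last //; apply: BpLeft => //; [exact: leq_trans dv|exact: TL|].
exact: bprun_hrun.
Qed.

Lemma pipe_step p : 1 <= p -> p <= k.+1 -> Exit n k.+1 u t p (f p) /\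
  (bpd_pipe n k.+1 D p).1 = (if p <= k then (bpd_pipe n k D p).1 else [::]) ++
     cells k.+1 (f p) (span n k.+1 u p) /\
  bprun D k.+1 p n true (bpd_pipe n k.+1 D p).1 (f p).
Proof.
move=> p1 pk; have [d E] := Exit_ex Hu (ltn0Sn k) kn grid_rowok p1 pk.
have R := row_run p1 pk E.
have R2 : bprun D k.+1 p n true ((if p <= k then (bpd_pipe n k D p).1 else [::]) ++
     cells k.+1 d (span n k.+1 u p)) d.
  case: (leqP p k) => pk'.
    apply: bprun_next (fa_run F p1 pk') _.
    by move: R; rewrite /span ltnS pk' ltn_eqF.
  have Ep : p = k.+1 by apply/eqP; rewrite eqn_leq pk.
  by move: R; rewrite /span Ep ltnn eqxx.
by rewrite /f (bprun_pipe pk kn p1 R2).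
Qed.

Lemma bcnt_step p q : 1 <= p -> p < q -> q <= k.+1 ->
  bcnt k.+1 p q = (if q <= k then bcnt k p q else 0) + rowcnt n k.+1 u t p q (f p) (f q).
Proof.
move=> p1 pq qk; have q1 : 1 <= q := leq_trans p1 (ltnW pq).
have pk : p <= k by move: pq qk; clia.
have [Ep [lp _]] := pipe_step p1 (leqW pk); have [Eq [lq _]] := pipe_step q1 qk.
have [_ dq] := Exit_le Hu kn q1 qk Eq.
rewrite {1}/bcnt lp lq pk count_cat; congr (_ + _).
- have rp x : x \in (bpd_pipe n k D p).1 -> x.1 <= k by apply: bprun_row (fa_run F p1 pk).
  have nc x d s : x.1 <= k -> (x \in cells k.+1 d s) = false.
    by move=> xk; apply/negbTE/mapP => -[y _ E]; move: xk; rewrite E ltnn.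
  case: (leqP q k) => qk'.
    by apply: eq_in_count => x /rp xk; rewrite mem_cat nc // orbF.
  transitivity (count pred0 (bpd_pipe n k D p).1); last exact: count_pred0.
  by apply: eq_in_count => x /rp xk; rewrite mem_cat nc.
- rewrite /cells count_map count_rev; apply: eq_count => x /=.
  rewrite mem_cat mem_cells // (_ : _ \in (if _ then _ else _) = false) //.
  case: (leqP q k) => qk' //; apply/negbTE/negP => /(bprun_row (fa_run F q1 qk')).
  by rewrite ltnn.
Qed.

Definition rownc := forall p q, 1 <= p -> p < q -> q <= k -> pat u q < pat u p -> f q < f p.

Lemma rowcnt_new p : 1 <= p -> p <= k ->
  rowcnt n k.+1 u t p k.+1 (f p) (f k.+1) = (f k.+1 < f p).
Proof.
move=> p1 pk; have [Ep _] := pipe_step p1 (leqW pk); have [Eq _] := pipe_step (ltn0Sn k) (leqnn k.+1).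
have B : before k.+1 u p k.+1 by split; rewrite ?ltnn.
by have [] := rowcnt_before Hu kn grid_rowok p1 (ltn0Sn k) (leqnn _) B Ep Eq.
Qed.

Lemma rowcnt_old p q : 1 <= p -> 1 <= q -> p <= k -> q <= k -> p != q ->
  rowcnt n k.+1 u t p q (f p) (f q) =
    (pat u p < pat u q) && (f q < f p) || (pat u q < pat u p) && (f p < f q).
Proof.
move=> p1 q1 pk qk pq; have [Ep _] := pipe_step p1 (leqW pk); have [Eq _] := pipe_step q1 (leqW qk).
have : pat u p != pat u q.
  by apply: (pat_neq Hu); rewrite // ?p1 ?q1 (leq_trans _ (ltnW kn)).
case: ltngtP => // lt _; rewrite ?orbF.
- have B : before k.+1 u p q by split.
  by have [] := rowcnt_before Hu kn grid_rowok p1 q1 (leqW qk) B Ep Eq.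
- have B : before k.+1 u q p by split.
  by have [] := rowcnt_before Hu kn grid_rowok q1 p1 (leqW pk) B Eq Ep.
Qed.

Lemma f_neq p q : 1 <= p -> 1 <= q -> p <= k -> q <= k -> pat u p < pat u q -> f p != f q.
Proof.
move=> p1 q1 pk qk lt; have [Ep _] := pipe_step p1 (leqW pk); have [Eq _] := pipe_step q1 (leqW qk).
have B : before k.+1 u p q by split.
exact: (Exit_inj Hu kn grid_rowok p1 q1 B Ep Eq).
Qed.

Lemma reduced_step : bpd_reduced n k.+1 D <-> bpd_reduced n k D /\ rownc.
Proof.
split.
- move=> R; split.
    move=> p q p1 pq qk; have := R p q p1 pq (leqW qk).
    by rewrite -/(bcnt k.+1 p q) bcnt_step ?(leqW qk) // qk; apply: leq_trans; apply: leq_addr.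
  move=> p q p1 pq qk lt; have := R p q p1 pq (leqW qk).
  have q1 : 1 <= q := leq_trans p1 (ltnW pq); have pk := leq_trans (ltnW pq) qk.
  rewrite -/(bcnt k.+1 p q) bcnt_step ?(leqW qk) // qk (fa_cnt F) // lt.
  rewrite rowcnt_old //; last by rewrite (ltn_eqF pq).
  by have := f_neq q1 p1 qk pk lt; move: lt; clia.
- case=> R NC p q p1 pq qk; rewrite -/(bcnt k.+1 p q) bcnt_step //.
  have pk : p <= k by move: pq qk; clia.
  move: qk; rewrite leq_eqVlt ltnS => /orP[/eqP E|qk].
    by subst q; rewrite ltnn add0n rowcnt_new // leq_b1.
  have q1 : 1 <= q := leq_trans p1 (ltnW pq).
  rewrite qk (fa_cnt F) // rowcnt_old //; last by rewrite (ltn_eqF pq).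
  have := NC p q p1 pq qk; move: (pat _ p) (pat _ q) (f p) (f q); clia.
Qed.

Lemma facts_step : rownc -> facts k.+1 /\ has_inc_chain k.+1 (bpd_perm n k.+1 D) u.
Proof.
move=> NC; have Ef p (p1 : 1 <= p) (pk : p <= k.+1) := proj1 (pipe_step p1 pk).
(* The chain supplies a permutation with the exits of the new row as its first entries; its
   decreasing tail identifies it with [bpd_perm]. *)
have [y [cs [Hy I L E]]] := row_to_chain Hu (ltn0Sn k) kn (fa_dec F) grid_rowok Ef NC.
have [P _] := andP I.
have Dy : dec n k.+1 y.
  apply: (path_dec Hy P (leqnn _)); rewrite L => a b ka; apply: (fa_dec F).
  exact: ltnW.
have Ey : bpd_perm n k.+1 D = y by rewrite [RHS](perm_tail Hy Dy kn E).
split; last by rewrite Ey; apply/has_incP; exists cs.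
split; rewrite ?Ey //.
- move=> p p1 pk; rewrite E //.
  by have [_ [_]] := pipe_step p1 pk.
- move=> _ p p1 pn; apply: (exits_bot Hu Hy _ kn grid_rowok) => //; last by rewrite p1.
  by move=> q q1 qk; rewrite E //; apply: Ef.
- move=> p q p1 pq qk; rewrite bcnt_step // !E ?(leq_trans (ltnW pq)) // ?(leq_trans p1 (ltnW pq)) //.
  have pk : p <= k by move: pq qk; clia.
  move: (qk); rewrite leq_eqVlt ltnS => /orP[/eqP Eq|qk'].
    by subst q; rewrite ltnn add0n rowcnt_new.
  have q1 : 1 <= q := leq_trans p1 (ltnW pq).
  rewrite qk' (fa_cnt F) // rowcnt_old //; last by rewrite (ltn_eqF pq).
  have : pat u p != pat u q.
    by apply: (pat_neq Hu); rewrite ?p1 ?q1 ?(ltn_eqF pq) ?(leq_trans _ (ltnW kn)).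
  have := NC p q p1 pq qk'; move: (pat _ p) (pat _ q) (f p) (f q); clia.
Qed.
End Row.

Lemma grid_facts k : k <= n -> bpd_reduced n k D -> facts k.
Proof.
elim: k => [|k IH] kn R; first exact: facts0.
have F : facts k := IH (ltnW kn) (bpd_reduced_leq (leqnSn k) R).
have /reduced_step := R => /(_ kn F) [_ NC].
exact: (proj1 (facts_step kn F NC)).
Qed.
End Grid.

(** * Chains of bumpless pipe dreams *)

Lemma tileat_take m D r c : 1 <= r -> r <= m -> tileat (take m D) r c = tileat D r c.
Proof. by move=> r1 rm; rewrite /tileat nth_take // prednK. Qed.

Lemma bpd_trace_take m D k f r c fr : k <= m -> 1 <= r ->
  bpd_trace (take m D) k f r c fr = bpd_trace D k f r c fr.
Proof.
move=> km; elim: f r c fr => //= f IH r c fr r1; case: ltnP => // rk.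
rewrite tileat_take ?(leq_trans rk) // !IH //.
Qed.

Lemma bpd_perm_take n k D : bpd_perm n k (take k D) = bpd_perm n k D.
Proof.
rewrite /bpd_perm; set e1 := map _ _; set e2 := map _ _.
suff -> : e1 = e2 by [].
apply/eq_in_map => i; rewrite mem_iota => /andP[i1 _].
by rewrite /bpd_pipe bpd_trace_take.
Qed.

Lemma nth_chain_BPD n D s : s < n -> nth [::] (chain_BPD n D) s = bpd_perm n (n.-1 - s) D.
Proof.
move=> sn; rewrite (nth_map 0) ?size_rev ?size_iota // nth_rev ?size_iota // nth_iota; last first.
  by move: sn; clia.
by rewrite add0n bpd_perm_take; congr bpd_perm; move: sn; clia.
Qed.

Lemma incc_full n k u cs : is_perm n u -> n <= k -> incc k u cs -> cs = [::].
Proof.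
case: cs => // v cs Hu nk /andP[/= /andP[K _] _].
have [a [b [T /andP[_ kb]]]] := proj1 (kcoverP k v Hu) K.
by case: T => ??; move: nk kb; clia.
Qed.

Lemma is_BPD_facts n D k : 1 <= n -> is_kBPD n n D -> k <= n -> facts n D k.
Proof.
by move=> n1 [W R] kn; apply: grid_facts => //; apply: bpd_reduced_leq R.
Qed.

Lemma BPD_step n D k : 1 <= n -> is_kBPD n n D -> k < n ->
  has_inc_chain k.+1 (bpd_perm n k.+1 D) (bpd_perm n k D).
Proof.
move=> n1 B kn; have F := is_BPD_facts n1 B (ltnW kn); case: B => W R.
have /(reduced_step n1 W kn F) [_ NC] := bpd_reduced_leq kn R.
by have [] := facts_step n1 W kn F NC.
Qed.

(** There are no steps with label [n], so the last row does not change the permutation; hence the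
    chain, which stops at row [n - 1], starts at [w]. *)
Lemma BPD_perm_last n D : 1 <= n -> is_kBPD n n D -> bpd_perm n n.-1 D = bpd_perm n n D.
Proof.
move=> n1 B; have F := is_BPD_facts n1 B (leqnn n).
have lt : n.-1 < n by rewrite ltn_predL.
have := BPD_step n1 B lt; rewrite prednK // => /has_incP[cs I <-].
by rewrite (incc_full (fa_perm F) (leqnn n) I).
Qed.

Lemma chain_BPD_ok n w D : 1 <= n -> is_BPD n w D ->
  chain_from_to n w (rev (iota 1 n.-1)) (chain_BPD n D).
Proof.
move=> n1 [B Ew]; have S : size (chain_BPD n D) = n by rewrite size_map size_rev size_iota.
split.
- split; first by rewrite S size_rev size_iota prednK.
  move=> s; rewrite size_rev size_iota => sn.
  rewrite nth_rev ?size_iota // nth_iota; last by move: sn; clia.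
  rewrite !nth_chain_BPD; [|by move: sn; clia|by move: sn; clia].
  have -> : n.-1 - s = (n.-1 - s.+1).+1 by move: sn; clia.
  by rewrite add1n; apply: BPD_step => //; move: sn; clia.
- by rewrite -nth0 nth_chain_BPD // subn0 BPD_perm_last.
- by rewrite -nth_last S nth_chain_BPD ?ltn_predL // subnn bpd_perm0.
Qed.

Lemma tile_eq x y : e_top x = e_top y -> e_bot x = e_bot y -> e_right x = e_right y -> x = y.
Proof. by case: x; case: y. Qed.

(** A tile is determined by its top, bottom and right edges. The permutations give the bottom edges,
    the row above gives the top edges, and the right edges follow from right to left, starting at
    the border. *)
Lemma chain_BPD_inj n D D' w : 1 <= n -> is_BPD n w D -> is_BPD n w D' ->
  chain_BPD n D = chain_BPD n D' -> D = D'.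
Proof.
move=> n1 [B Ew] [B' Ew'] E.
have EU k : k <= n -> bpd_perm n k D = bpd_perm n k D'.
  rewrite leq_eqVlt => /orP[/eqP ->|kn]; first by rewrite Ew Ew'.
  have lt : n.-1 - k < n by move: kn; clia.
  have -> : k = n.-1 - (n.-1 - k) by move: kn; clia.
  by rewrite -!nth_chain_BPD // E.
have F k := is_BPD_facts n1 B (k := k); have F' k := is_BPD_facts n1 B' (k := k).
have [[SD SDr [R V] [_ [T L]]] _] := B; have [[SD' SDr' [R' V'] [_ [T' L']]] _] := B'.
have Eb k c : 1 <= k <= n -> 1 <= c <= n -> e_bot (tileat D k c) = e_bot (tileat D' k c).
  case/andP=> k1 kn Hc; have [p /andP[p1 pn] <-] := perm_surj (fa_perm (F k kn)) Hc.
  by rewrite {2}EU // !fa_bot //; [exact: F'|exact: F].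
have Et k c : 1 <= k <= n -> 1 <= c <= n -> e_top (tileat D k c) = e_top (tileat D' k c).
  case: k => // -[|k] /= kn Hc; first by rewrite (negbTE (T _ Hc n1)) (negbTE (T' _ Hc n1)).
  by rewrite -V -?V' // Eb // (ltnW kn).
have Etile k c : 1 <= k <= n -> 1 <= c <= n -> tileat D k c = tileat D' k c.
  move=> Hk; move: {2}(n - c) (leqnn (n - c)) => m; elim: m c => [|m IH] c le Hc.
    have -> : c = n by move: le Hc; clia.
    by apply: tile_eq; rewrite ?Et ?Eb ?L ?L' ?n1 ?leqnn.
  apply: tile_eq; rewrite ?Et ?Eb //.
  move: (Hc) => /andP[c1]; rewrite leq_eqVlt => /orP[/eqP ->|cn]; first by rewrite L ?L'.
  by rewrite R ?R' ?c1 // IH //; move: le cn; clia.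
apply: (@eq_from_nth _ [::]); first by rewrite SD.
move=> r; rewrite SD => rn; apply: (@eq_from_nth _ Blank); first by rewrite SDr ?SDr'.
by move=> c; rewrite SDr // => cn; apply: (Etile r.+1 c.+1).
Qed.

Lemma rowok_ext n k v t t' : is_perm n v -> (forall c, 1 <= c <= n -> t c = t' c) -> 1 <= n ->
  rowok n k v t -> rowok n k v t'.
Proof.
move=> Hv E n1 [A B C H]; split.
- by move=> c c1 cn; rewrite -!E ?c1 ?(ltnW cn) // A.
- by rewrite -E ?n1.
- by rewrite -E ?n1 ?leqnn.
- move=> p p1 pn; have Hp : 1 <= p <= n by rewrite p1.
  by rewrite -E ?H // (perm_range Hv Hp).
Qed.

Lemma Exit_ext n k v t t' p d : is_perm n v -> k <= n -> (forall c, 1 <= c <= n -> t c = t' c) ->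
  1 <= p -> p <= k -> Exit n k v t p d -> Exit n k v t' p d.
Proof.
move=> Hv kn E p1 pk; have Hp : 1 <= p <= n by rewrite p1 (leq_trans pk).
have Hc := perm_range Hv Hp.
case=> [[a b ->]|[TL d1 ds RB hr]]; [left|right]; first by rewrite -E.
have sn : start n k v p <= n by rewrite /start; case: ltnP => // _; move: Hc; clia.
split=> //.
- by move=> lt; rewrite -E // TL.
- by rewrite -E // d1 (leq_trans ds).
- move=> x dx xs; rewrite -E ?hr // (leq_trans _ dx) ?(leq_trans xs) //.
Qed.

Lemma rows_ex (A : Type) (x0 : A) (P : nat -> A -> Prop) n :
  (forall k, k < n -> exists x, P k x) ->
  exists2 s, size s = n & forall k, k < n -> P k (nth x0 s k).
Proof.
elim: n => [|n IH] H; first by exists [::].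
have [s S Hs] := IH (fun k kn => H k (ltnW kn)); have [x Hx] := H n (leqnn _).
exists (rcons s x); first by rewrite size_rcons S.
move=> k; rewrite ltnS leq_eqVlt => /orP[/eqP ->|kn]; first by rewrite -S nth_rcons ltnn eqxx S.
by rewrite nth_rcons S kn; apply: Hs.
Qed.

Lemma chain_BPD_surj n w C : 1 <= n -> is_perm n w -> chain_from_to n w (rev (iota 1 n.-1)) C ->
  exists D, is_BPD n w D /\ chain_BPD n D = C.
Proof.
move=> n1 Hw HC; have [Cc Hh Hl] := HC; have [SC HI] := Cc.
rewrite size_rev size_iota prednK // in SC.
(* Truncated subtraction makes [U n] equal to [U n.-1], in accordance with a last row that
   contributes no step. *)
pose U k := nth [::] C (n.-1 - k).
have U0 : U 0 = w0 n by rewrite /U subn0 -Hl -nth_last SC.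
have Un : U n = w by rewrite /U (_ : n.-1 - n = 0) ?nth0 //; clia.
have HU k : is_perm n (U k).
  by apply: (compat_perm Hw Cc Hh); rewrite size_rev size_iota leq_subr.
have DU k : k < n -> dec n k (U k).
  move=> kn; apply: (compat_dec Hw HC); last by rewrite size_rev size_iota leq_subr.
  move=> s; rewrite size_rev size_iota => ks sn.
  rewrite nth_rev ?size_iota // nth_iota; last by move: sn; clia.
  by move: ks sn kn; clia.
have IU k : k < n -> exists2 cs, incc k.+1 (U k.+1) cs & last (U k.+1) cs = U k.
  move=> kn; have [E|ne] := eqVneq k.+1 n.
    by exists [::] => //=; rewrite /U; congr nth; move: E; clia.
  apply/has_incP; have sn : n.-1 - k.+1 < n.-1 by move: kn ne; clia.
  have := HI (n.-1 - k.+1); rewrite size_rev size_iota => /(_ sn).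
  rewrite nth_rev ?size_iota // nth_iota; last by move: sn; clia.
  have -> : 1 + (n.-1 - (n.-1 - k.+1).+1) = k.+1 by move: kn ne; clia.
  by have -> : (n.-1 - k.+1).+1 = n.-1 - k by move: kn ne; clia.
pose good k (r : seq tile) := size r = n /\
  [/\ rowok n k.+1 (U k) (fun c => nth Blank r c.-1),
      forall p, 1 <= p -> p <= k.+1 -> Exit n k.+1 (U k) (fun c => nth Blank r c.-1) p (pat (U k.+1) p)
    & forall p q, 1 <= p -> p < q -> q <= k -> pat (U k) q < pat (U k) p ->
        pat (U k.+1) q < pat (U k.+1) p].
have [D SD HD] : exists2 D, size D = n & forall k, k < n -> good k (nth [::] D k).
  apply: rows_ex => k kn; have [cs I L] := IU k kn.
  have [t [T1 T2 T3]] := chain_to_row (HU k) (ltn0Sn k) kn (DU k kn) (HU k.+1) I L.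
  exists [seq t c | c <- iota 1 n]; split; first by rewrite size_map size_iota.
  have E c : 1 <= c <= n -> t c = nth Blank [seq t c | c <- iota 1 n] c.-1.
    move=> Hc; rewrite (nth_map 0) ?size_iota ?nth_iota; move: Hc; clear; try lia.
    by move=> Hc; congr t; lia.
  split=> //; first exact: rowok_ext (HU k) E n1 T1.
  by move=> p p1 pk; apply: (Exit_ext (HU k) kn E p1 pk); apply: T2.
(* The rows were chosen independently; their vertical edges match because the bottom edges of a row
   lie exactly in the columns where pipes enter the next one. *)
have W : bpd_wf n n D.
  have V k c : k < n -> 1 <= c <= n ->
     exists p, [/\ 1 <= p <= n, pat (U k) p = c & e_top (tileat D k.+1 c) = (p < k.+1)].
    move=> kn Hc; have [p Hp Ec] := perm_surj (HU k) Hc; exists p; split=> //.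
    by have [_ [[_ _ _ H] _ _]] := HD k kn; rewrite -Ec; apply: H; case/andP: Hp.
  split=> //.
  - by move=> r /HD [].
  - split.
      move=> [//|r] c /= rn /andP[c1 cn].
      by have [_ [[H _ _ _] _ _]] := HD r rn; apply: H.
    move=> [//|r] c /= rn Hc; have [p [Hp Ec ->]] := V r.+1 c rn Hc.
    have [_ [H1 H2 _]] := HD r (ltnW rn).
    by rewrite -Ec ltnS; apply: (exits_bot (HU r) (HU r.+1) _ (ltnW rn) H1 H2 Hp).
  - split; first by move=> [//|r] /= rn; have [_ [[_ H _ _] _ _]] := HD r rn.
    split; last by move=> [//|r] /= rn; have [_ [[_ _ H _] _ _]] := HD r rn.
    move=> c Hc _; have [p [/andP[p1 _] _ ->]] := V 0 c n1 Hc.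
    by rewrite ltnS -ltnNge.
(* Since exits are unique, tracing the pipes of the assembled grid gives the entries that the rows
   were built for. *)
have key k : k <= n -> [/\ facts n D k, bpd_perm n k D = U k & bpd_reduced n k D].
  elim: k => [|k IH] kn.
    split; [exact: facts0|by rewrite bpd_perm0|].
    by move=> i j i1 ij j0; move: (leq_trans ij j0).
  have [F EU R] := IH (ltnW kn); have [_ [H1 H2 H3]] := HD k kn.
  have Ef p : 1 <= p -> p <= k.+1 -> (bpd_pipe n k.+1 D p).2 = pat (U k.+1) p.
    move=> p1 pk; have [E _] := pipe_step n1 W kn F p1 pk.
    by rewrite EU in E; apply: Exit_fun E (H2 p p1 pk).
  have NC : rownc n D k.
    move=> p q p1 pq qk; rewrite EU => lt.
    have q1 := leq_trans p1 (ltnW pq); have pk := leq_trans (ltnW pq) qk.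
    by rewrite !Ef ?leqW //; apply: H3.
  have [F' _] := facts_step n1 W kn F NC; split=> //; last by apply/(reduced_step n1 W kn F).
  have D' : dec n k.+1 (U k.+1).
    have [E|ne] := eqVneq k.+1 n; last by apply: DU; move: kn ne; clia.
    by move=> p q; rewrite E => np pq qn; move: (leq_trans (ltn_trans np pq) qn); rewrite ltnn.
  by rewrite [RHS](perm_tail (HU k.+1) D' kn (fun p p1 pk => esym (Ef p p1 pk))).
exists D; split.
  by have [_ E R] := key n (leqnn n); split; [split|rewrite E].
apply: (@eq_from_nth _ [::]); first by rewrite size_map size_rev size_iota SC.
move=> s; rewrite size_map size_rev size_iota => sn.
have le : n.-1 - s <= n by move: sn; clia.
have [_ E _] := key _ le.
by rewrite nth_chain_BPD // E /U; congr nth; move: sn; clia.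
Qed.

Theorem theorem5p15 (n : nat) (w : seq nat) :
  1 <= n -> is_perm n w ->
  [/\ (forall C, chain_from_to n w (rev (iota 1 n.-1)) C ->
                 chain_from_to n w (iota 1 n.-1) (flip n C)),
      (forall C C', chain_from_to n w (rev (iota 1 n.-1)) C ->
                    chain_from_to n w (rev (iota 1 n.-1)) C' ->
                    flip n C = flip n C' -> C = C'),
      (forall C', chain_from_to n w (iota 1 n.-1) C' ->
                  exists C, chain_from_to n w (rev (iota 1 n.-1)) C /\
                            flip n C = C'),
      (forall C, chain_from_to n w (rev (iota 1 n.-1)) C ->
                 wt (flip n C) = rev (wt C)) &
      ((forall D, is_BPD n w D ->
          exists! P, is_PD n w P /\ chain_PD n P = flip n (chain_BPD n D)) /\
       (forall P, is_PD n w P ->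
          exists! D, is_BPD n w D /\ chain_PD n P = flip n (chain_BPD n D)))].
Proof.
move=> n1 Hw; have FB := flip_bijection Hw n1; have [Fok Finj Fsurj _] := FB.
case: FB => F1 F2 F3 F4; split=> //; split.
- move=> D HD; have HC := Fok _ (chain_BPD_ok n1 HD).
  have [P [HP EP]] := chain_PD_surj n1 Hw HC; exists P; split=> // P' [HP' EP'].
  by apply: (chain_PD_inj HP HP'); rewrite EP EP'.
- move=> P HP; have [C [HC EC]] := Fsurj _ (chain_PD_ok n1 HP).
  have [D [HD ED]] := chain_BPD_surj n1 Hw HC; exists D; split; first by rewrite ED EC.
  move=> D' [HD' ED']; apply: (chain_BPD_inj n1 HD HD').
  by rewrite ED; apply: Finj; rewrite ?EC //; apply: chain_BPD_ok.
Qed.
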